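(* Let $\Omega\subset\mathbb C^m$ be a bounded domain and let $\mathcal I\subseteq\mathbb C[z_1,\dots,z_m]$ be an ideal with generators $p_1,\dots,p_t$. Let $\mathcal H,\mathcal H'\subseteq\mathcal O(\Omega)$ be analytic Hilbert modules and let $\mathcal M,\mathcal M'$ be the closures of $\mathcal I$ in $\mathcal H,\mathcal H'$, respectively. Assume that $V(\mathcal M)=V(\mathcal M')=\{z\in\Omega:p_1(z)=\cdots=p_t(z)=0\}$ is a (complex) submanifold of $\Omega$ of codimension $t$. If the modules $\mathcal M$ and $\mathcal M'$ are unitarily equivalent, then: (a) $E_{\mathcal M}$ is equivalent to $E_{\mathcal M'}$ as an anti-holomorphic hermitian vector bundle on $V(\mathcal M)=V(\mathcal M')$. (b) If $F_{\mathcal M}=\{F_1,\dots,F_t\}$ and $F_{\mathcal M'}=\{F_1',\dots,F_t'\}$ are the canonical global frames of $E_{\mathcal M}$ and $E_{\mathcal M'}$ associated with $\{p_1,\dots,p_t\}$, then $$\mathcal K_{E_{\mathcal M}}(F_{\mathcal M})=\mathcal K_{E_{\mathcal M'}}(F_{\mathcal M'}),$$ where $\mathcal K_{E_{\mathcal M}}(F_{\mathcal M})$ and $\mathcal K_{E_{\mathcal M'}}(F_{\mathcal M'})$ are the curvature matrices of $E_{\mathcal M}$ and $E_{\mathcal M'}$ with respect to the frames $F_{\mathcal M}$ and $F_{\mathcal M'}$.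
   Context: A domain is a connected open set; $\mathcal O(\Omega)$ is the ring of holomorphic functions on $\Omega$. An analytic Hilbert module over $\mathbb C[z_1,\dots,z_m]$ is a Hilbert space $\mathcal H\subseteq\mathcal O(\Omega)$ possessing a reproducing kernel (holomorphic in the first variable, anti-holomorphic in the second), such that pointwise multiplication by every polynomial is bounded on $\mathcal H$, and such that $\mathbb C[z_1,\dots,z_m]$ is contained and dense in $\mathcal H$. Two Hilbert modules $\mathcal M,\mathcal M'$ are unitarily equivalent if there is a unitary $L:\mathcal M\to\mathcal M'$ with $LM_p=M'_pL$ for all polynomials $p$, where $M_p,M'_p$ denote multiplication by $p$ on $\mathcal M,\mathcal M'$. Canonical frame. Let $\mathcal M$ be the closure of $\mathcal I=\langle p_1,\dots,p_t\rangle$ in an analytic Hilbert module, with reproducing kernel $K$, and suppose $V(\mathcal M)$ is a submanifold of codimension $t$. There are unique anti-holomorphic maps $F_1,\dots,F_t:V(\mathcal M)\to\mathcal M$ such that each $w\in V(\mathcal M)$ has a neighbourhood $\Omega_w\subseteq\Omega$ and anti-holomorphic maps $F^1_{\Omega_w},\dots,F^t_{\Omega_w}:\Omega_w\to\mathcal M$ with $F^j_{\Omega_w}=F_j$ on $V(\mathcal M)\cap\Omega_w$ and $K(\cdot,u)=\sum_{j=1}^t\overline{p_j(u)}F^j_{\Omega_w}(u)$ for $u\in\Omega_w$. For each $w\in V(\mathcal M)$ the vectors $F_1(w),\dots,F_t(w)$ are linearly independent and span $\bigcap_{i=1}^m\ker(M_{z_i}-w_i)^*\subseteq\mathcal M$.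 These maps form the canonical global frame associated with $\{p_1,\dots,p_t\}$. $E_{\mathcal M}$ is the trivial rank $t$ anti-holomorphic vector bundle on $V(\mathcal M)$ whose fibre at $w$ is $\mathrm{span}\{F_1(w),\dots,F_t(w)\}\subseteq\mathcal M$, with the hermitian structure induced by the inner product of $\mathcal M$. Two such bundles over the same base are equivalent if there is an anti-holomorphic bundle isomorphism covering the identity that is isometric on fibres. For an anti-holomorphic frame $F=(F_1,\dots,F_t)$ let $N(F)=(\langle F_j,F_i\rangle)_{i,j=1}^t$; the curvature matrix with respect to $F$ is $\mathcal K(F)=\partial\big(N(F)^{-1}\bar\partial N(F)\big)$, a matrix of forms on $V(\mathcal M)$. *)

(* Defs.v *)
From HB Require Import structures.
From mathcomp Require Import all_boot all_order all_algebra.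
From mathcomp Require Import all_classical all_reals all_analysis.
From mathcomp Require Import complex.
From mathcomp Require Import(canonicals) mpoly.

Set Implicit Arguments.
Unset Strict Implicit.
Unset Printing Implicit Defensive.
Import Order.TTheory GRing.Theory Num.Theory.
Import numFieldNormedType.Exports.
Local Open Scope classical_set_scope.
Local Open Scope ring_scope.

(* R[i] packed as a numClosedFieldType, so that the generic topology and
   normed-module structures of a numClosedFieldType (norm with values in the
   nonnegative reals of the field, scalars the field itself) apply to it. *)
Definition cplx (R : realType) : numClosedFieldType := R[i].

Section ComplexAnalysis.
Variable R : realType.
Local Notation C := (cplx R).

Definition holomorphic_on (n : nat) (X : normedModType C)
    (U : set 'rV[C]_n) (f : 'rV[C]_n -> X) : Prop :=
  forall z, U z -> differentiable f z.

Definition conj_rV (n : nat) (z : 'rV[C]_n) : 'rV[C]_n :=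
  map_mx Num.conj z.

(* f is anti-holomorphic on U when z |-> f (conj z) is holomorphic on conj U. *)
Definition antiholomorphic_on (n : nat) (X : normedModType C)
    (U : set 'rV[C]_n) (f : 'rV[C]_n -> X) : Prop :=
  holomorphic_on [set z | U (conj_rV z)] (fun z => f (conj_rV z)).

(* Anti-holomorphic maps on a submanifold V: locally on V, restrictions of
   anti-holomorphic maps on open subsets of the ambient space. *)
Definition antiholomorphic_along (n : nat) (X : normedModType C)
    (V : set 'rV[C]_n) (f : 'rV[C]_n -> X) : Prop :=
  forall w, V w -> exists U : set 'rV[C]_n, exists g : 'rV[C]_n -> X,
    [/\ open U, U w, antiholomorphic_on U g
      & forall z, V z -> U z -> g z = f z].

Definition bounded_domain (n : nat) (Omega : set 'rV[C]_n) : Prop :=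
  [/\ open Omega, connected Omega & bounded_set Omega].

(* phi : U -> W is biholomorphic with inverse psi, and it straightens V to the
   slice of W where the first t coordinates vanish.  The coordinates of
   index >= t then form a holomorphic coordinate system on the part of V in U. *)
Definition slice_chart (n t : nat) (V U W : set 'rV[C]_n)
    (phi psi : 'rV[C]_n -> 'rV[C]_n) : Prop :=
  [/\ (t <= n)%N,
      open U /\ open W,
      holomorphic_on U phi /\ holomorphic_on W psi,
      (forall z, U z -> W (phi z) /\ psi (phi z) = z) /\
      (forall x, W x -> U (psi x) /\ phi (psi x) = x)
    & forall z, U z -> (V z <-> forall i : 'I_n, (i < t)%N -> phi z 0 i = 0)].

Definition submanifold (n t : nat) (Omega V : set 'rV[C]_n) : Prop :=
  V `<=` Omega /\
  forall w, V w -> exists U W : set 'rV[C]_n,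
    exists phi psi : 'rV[C]_n -> 'rV[C]_n,
    [/\ U w, U `<=` Omega & slice_chart t V U W phi psi].

(* Derivative at x of f along v, for a real parameter. *)
Definition real_deriv (n : nat) (f : 'rV[C]_n -> C) (v x : 'rV[C]_n) : C :=
  Complex
    (derive1 (fun h : R => complex.Re (f (x + (Complex h 0 : C) *: v))) 0)
    (derive1 (fun h : R => complex.Im (f (x + (Complex h 0 : C) *: v))) 0).

Definition wirtinger (n : nat) (a : 'I_n) (f : 'rV[C]_n -> C)
    (x : 'rV[C]_n) : C :=
  (real_deriv f (delta_mx 0 a) x - 'i * real_deriv f ('i *: delta_mx 0 a) x) / 2.

Definition wirtinger_bar (n : nat) (b : 'I_n) (f : 'rV[C]_n -> C)
    (x : 'rV[C]_n) : C :=
  (real_deriv f (delta_mx 0 b) x + 'i * real_deriv f ('i *: delta_mx 0 b) x) / 2.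

Definition wirtinger_mx (n t : nat) (a : 'I_n) (A : 'rV[C]_n -> 'M[C]_t)
    (x : 'rV[C]_n) : 'M[C]_t :=
  \matrix_(i, j) wirtinger a (fun y => A y i j) x.

Definition wirtinger_bar_mx (n t : nat) (b : 'I_n) (A : 'rV[C]_n -> 'M[C]_t)
    (x : 'rV[C]_n) : 'M[C]_t :=
  \matrix_(i, j) wirtinger_bar b (fun y => A y i j) x.

End ComplexAnalysis.

Section HilbertModules.
Variables (R : realType) (m : nat).
Local Notation C := (cplx R).
Local Notation poly_m := (mpoly.mpoly m C).

Definition peval (q : poly_m) (z : 'rV[C]_m) : C :=
  mpoly.meval (fun i => z 0 i) q.

(* ip is an inner product (linear in its first argument) inducing the norm of
   H; positivity and definiteness come from the norm axioms. *)
Definition inner_product (H : normedModType C) (ip : H -> H -> C) : Prop :=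
  [/\ forall (a : C) (f g h : H), ip (a *: f + g) h = a * ip f h + ip g h,
      forall f g : H, ip g f = (ip f g)^*
    & forall f : H, ip f f = `|f| ^+ 2].

Section OneModule.
Variables (Omega : set 'rV[C]_m) (H : completeNormedModType C).
Variables (ip : H -> H -> C) (ev : H -> 'rV[C]_m -> C).

(* The Hilbert space of functions H is given through ev : ev f is the
   function on Omega represented by f (its values off Omega are irrelevant). *)
Definition hilbert_function_space : Prop :=
  [/\ inner_product ip,
      forall (a : C) (f g : H) z, Omega z ->
        ev (a *: f + g) z = a * ev f z + ev g z,
      forall f : H, (forall z, Omega z -> ev f z = 0) -> f = 0
    & forall f : H, holomorphic_on Omega (ev f : 'rV[C]_m -> C)].

Definition represents (f : H) (q : poly_m) : Prop :=
  forall z, Omega z -> ev f z = peval q z.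

Definition is_mul (q : poly_m) (f g : H) : Prop :=
  forall z, Omega z -> ev g z = peval q z * ev f z.

Definition is_kernel_at (M : set H) (u : 'rV[C]_m) (k : H) : Prop :=
  M k /\ forall f, M f -> ip f k = ev f u.

Definition analytic_hilbert_module : Prop :=
  [/\ hilbert_function_space,
      exists k : 'rV[C]_m -> H,
        [/\ forall w, Omega w -> is_kernel_at setT w (k w),
            forall w, Omega w ->
              holomorphic_on Omega ((fun z => ev (k w) z) : 'rV[C]_m -> C)
          & forall z, Omega z ->
              antiholomorphic_on Omega ((fun w => ev (k w) z) : 'rV[C]_m -> C)],
      forall q : poly_m, exists c : C,
        forall f : H, exists g : H, is_mul q f g /\ `|g| <= c * `|f|,
      forall q : poly_m, exists f : H, represents f q
    & closure [set f : H | exists q : poly_m, represents f q] = setT].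

Variables (t : nat) (p : 'I_t -> poly_m).

Definition in_ideal (q : poly_m) : Prop :=
  exists c : 'I_t -> poly_m, q = \sum_j c j * p j.

Definition ideal_closure : set H :=
  closure [set f : H | exists q : poly_m, in_ideal q /\ represents f q].

Definition zero_set (M : set H) : set 'rV[C]_m :=
  [set z | Omega z /\ forall f, M f -> ev f z = 0].

(* The last clause says K(., u) = \sum_j conj (p_j u) G_j(u), with K the
   reproducing kernel of M. *)
Definition frame_decomposition (M : set H) (F : 'I_t -> 'rV[C]_m -> H) : Prop :=
  [/\ forall j w, zero_set M w -> M (F j w),
      forall j, antiholomorphic_along (zero_set M) (F j)
    & forall w, zero_set M w ->
      exists U : set 'rV[C]_m, exists G : 'I_t -> 'rV[C]_m -> H,
      [/\ open U /\ U w, U `<=` Omega,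
          forall j, (forall u, U u -> M (G j u)) /\ antiholomorphic_on U (G j),
          forall j z, zero_set M z -> U z -> G j z = F j z
        & forall u, U u ->
            is_kernel_at M u (\sum_j (peval (p j) u)^* *: G j u)]].

(* F (which only matters on V(M)) is the unique family with the property
   above. *)
Definition canonical_frame (M : set H) (F : 'I_t -> 'rV[C]_m -> H) : Prop :=
  frame_decomposition M F /\
  forall F2, frame_decomposition M F2 ->
    forall j w, zero_set M w -> F2 j w = F j w.

(* Fibre at w of the bundle with global frame F. *)
Definition fibre (F : 'I_t -> 'rV[C]_m -> H) (w : 'rV[C]_m) : set H :=
  [set x | exists c : 'I_t -> C, x = \sum_j c j *: F j w].

Definition gram (F : 'I_t -> 'rV[C]_m -> H) (w : 'rV[C]_m) : 'M[C]_t :=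
  \matrix_(i, j) ip (F j w) (F i w).

(* In the coordinates x given by a slice chart with inverse psi, the curvature
   matrix is \sum_(a, b >= t) (curvature F psi a b x) dx_a /\ dbar x_b. *)
Definition curvature (F : 'I_t -> 'rV[C]_m -> H) (psi : 'rV[C]_m -> 'rV[C]_m)
    (a b : 'I_m) (x : 'rV[C]_m) : 'M[C]_t :=
  let N y := gram F (psi y) in
  wirtinger_mx a (fun y => invmx (N y) *m wirtinger_bar_mx b N y) x.

End OneModule.

Section TwoModules.
Variables (Omega : set 'rV[C]_m) (H H' : completeNormedModType C).
Variables (ip : H -> H -> C) (ev : H -> 'rV[C]_m -> C).
Variables (ip' : H' -> H' -> C) (ev' : H' -> 'rV[C]_m -> C).

(* Only the restriction of L to M matters. *)
Definition unitarily_equivalent (M : set H) (M' : set H') : Prop :=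
  exists L : H -> H',
  [/\ forall (a : C) f g, M f -> M g -> L (a *: f + g) = a *: L f + L g,
      L @` M = M',
      forall f g, M f -> M g -> ip' (L f) (L g) = ip f g
    & forall (q : poly_m) f g, M f -> M g ->
        is_mul Omega ev q f g -> is_mul Omega ev' q (L f) (L g)].

(* Phi w maps the fibre at w of the bundle with frame F to that of the bundle
   with frame F'.  The bundles being trivialised by their frames, Phi is
   anti-holomorphic when its matrix A in these frames is; then so is its
   inverse. *)
Definition bundle_equivalent (t : nat) (V : set 'rV[C]_m)
    (F : 'I_t -> 'rV[C]_m -> H) (F' : 'I_t -> 'rV[C]_m -> H') : Prop :=
  exists Phi : 'rV[C]_m -> H -> H',
    (forall w, V w ->
      [/\ forall (a : C) x y, fibre F w x -> fibre F w y ->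
            Phi w (a *: x + y) = a *: Phi w x + Phi w y,
          set_bij (fibre F w) (fibre F' w) (Phi w)
        & forall x y, fibre F w x -> fibre F w y ->
            ip' (Phi w x) (Phi w y) = ip x y]) /\
    exists A : 'I_t -> 'I_t -> 'rV[C]_m -> C,
      (forall i j, antiholomorphic_along V (A i j : 'rV[C]_m -> C)) /\
      forall w, V w -> forall j, Phi w (F j w) = \sum_i A i j w *: F' i w.

End TwoModules.
End HilbertModules.

(* Main.v *)
Require Import Defs.
From HB Require Import structures.
From mathcomp Require Import all_boot all_order all_algebra.
From mathcomp Require Import all_classical all_reals all_analysis.
From mathcomp Require Import complex ring lra.
From mathcomp Require Import(canonicals) mpoly.
Set Implicit Arguments.
Unset Strict Implicit.
Unset Printing Implicit Defensive.
Import Order.TTheory GRing.Theory Num.Theory.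
Import numFieldNormedType.Exports.
Local Open Scope classical_set_scope.
Local Open Scope ring_scope.

(** Why the theorem holds. A unitary module map [L : M -> M'] acts, near every
    point of [V], as multiplication by a holomorphic function. Write [f_i] for
    [L p_i]. Since [L] commutes with polynomials, [p_k f_i = p_i f_k], and more
    generally [p_i (L f) = f f_i] for every [f] in [M] ([module_relation]). The
    decomposition of the kernel of [M'] at a point [u] near [V] gives
    [f_i(u) = sum_j p_j(u) <L p_i, G'_j(u)>], hence [|f_i| <= A sum_j |p_j|];
    multiplied by the [|p_k|] and summed over [k] this becomes [|f_i| <= B |p_i|]
    ([generator_bound]). So [f_i / p_i] is bounded where it is defined, the
    Riemann extension theorem turns it into a holomorphic [Phi]
    ([riemann_extension]), and [L f = Phi f] for all [f] in [M]
    ([local_multiplier]).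

    Dually, the sections [conj(Phi) L F_j] decompose the kernel of [M'] as the
    canonical frame does; by uniqueness of that frame [F'_j = conj(c) L F_j] on
    [V], where [c] is the restriction of [Phi] to [V] ([frame_transport]).
    Uniqueness also makes [F_j(w)] biorthogonal to the generators
    ([frame_biorthogonal]), so [c] has no zero and the Gram matrices are
    invertible. Now [L] restricted to the fibres is the isometric bundle map of
    (a), with the scalar matrix [1 / conj(c)] in the two frames. For (b), in a
    slice chart [N' = m conj(m) N] with [m] anti-holomorphic, whence
    [N'^-1 dbar N' = N^-1 dbar N + (dbar m / m) 1], and the additional term is
    anti-holomorphic, so that [d] kills it ([wirtinger_gauge]).

    The computation of (b) differentiates twice, so it rests on the fact that
    the derivatives of a holomorphic map into a Hilbert space are holomorphic
    again ([dir_derivative_fder]). This and the extension theorem come from one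
    estimate, [taylor_1d]: a second order Taylor bound whose constants depend
    only on a bound of the map, and which tolerates finitely many removable
    singularities. Such bounds survive pointwise limits ([weierstrass]); they
    are applied to difference quotients in the one case and to translates of
    [f_i / p_i] in the other. [taylor_1d] is proved without integrals: midpoint
    sums over the boundary of a square vanish on affine maps, which is all that
    the bisection of Goursat uses, and the winding number only enters through a
    lower bound of the sum of [1 / (z - c)] ([center_estimate]). *)

(** * Real-valued norms *)

Section RealNorm.
Variable R : realType.
Local Notation C := (cplx R).

Definition rc (r : R) : C := Complex r 0.
Definition ci : C := Complex 0 1.

Lemma rcD (a b : R) : rc (a + b) = rc a + rc b.
Proof. exact: (rmorphD (real_complex R)). Qed.
Lemma rcB (a b : R) : rc (a - b) = rc a - rc b.
Proof. exact: (rmorphB (real_complex R)). Qed.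
Lemma rcM (a b : R) : rc (a * b) = rc a * rc b.
Proof. exact: (rmorphM (real_complex R)). Qed.
Lemma rcV (a : R) : rc (a^-1) = (rc a)^-1.
Proof. exact: (fmorphV (real_complex R)). Qed.
Lemma rc1 : rc 1 = 1. Proof. by []. Qed.
Lemma rc0 : rc 0 = 0. Proof. by []. Qed.
Lemma rc_nat n : rc n%:R = n%:R.
Proof. exact: (rmorph_nat (real_complex R)). Qed.
Lemma rc_eq0 a : (rc a == 0) = (a == 0).
Proof. exact: (fmorph_eq0 (real_complex R)). Qed.
Lemma ler_rc (a b : R) : (rc a <= rc b) = (a <= b).
Proof. exact: lecR. Qed.
Lemma ltr_rc (a b : R) : (rc a < rc b) = (a < b).
Proof. exact: ltcR. Qed.
Lemma complexE2 (z : C) : z = rc (complex.Re z) + ci * rc (complex.Im z).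
Proof.
case: z => a b; apply/eqP; rewrite eq_complex /=.
rewrite !(mul0r, mulr0, mul1r, sub0r, addr0, subr0, add0r, oppr0).
by rewrite !eqxx.
Qed.

Lemma ge0_rc (z : C) : 0 <= z -> z = rc (complex.Re z).
Proof. by case: z => a b; rewrite lecE /= => /andP[/eqP -> _]. Qed.

Section Nrm.
Variable X : normedModType C.
Implicit Types x y : X.

(** The norm of a normed space over C has its values in C; taken as a real
    number it becomes accessible to real linear arithmetic. *)
Definition nrm x : R := complex.Re (`|x| : C).

Lemma nrmE x : `|x| = rc (nrm x).
Proof. exact: ge0_rc. Qed.

Lemma nrm_ge0 x : 0 <= nrm x.
Proof. by rewrite -ler_rc -nrmE normr_ge0. Qed.

Lemma nrm0 : nrm 0 = 0.
Proof. by rewrite /nrm normr0. Qed.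

Lemma nrm_eq0 x : (nrm x == 0) = (x == 0).
Proof. by rewrite -rc_eq0 -nrmE normr_eq0. Qed.

Lemma nrm_gt0 x : (0 < nrm x) = (x != 0).
Proof. by rewrite lt_neqAle nrm_ge0 andbT eq_sym nrm_eq0. Qed.

Lemma nrmD x y : nrm (x + y) <= nrm x + nrm y.
Proof. by rewrite -ler_rc rcD -!nrmE ler_normD. Qed.

Lemma nrmN x : nrm (- x) = nrm x.
Proof. by rewrite /nrm normrN. Qed.

Lemma nrmB x y : nrm (x - y) <= nrm x + nrm y.
Proof. by rewrite -[nrm y]nrmN; apply: nrmD. Qed.

Lemma nrm_distC x y : nrm (x - y) = nrm (y - x).
Proof. by rewrite -nrmN opprB. Qed.

Lemma nrm_dist_add z x y : nrm (x - y) <= nrm (x - z) + nrm (z - y).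
Proof. by rewrite -[x - y](subrKA z); exact: nrmD. Qed.

Lemma nrm_le_add x y : nrm x <= nrm y + nrm (x - y).
Proof. by rewrite -{1}[x](subrK y) addrC; exact: nrmD. Qed.

Lemma nrm_sum (I : Type) (r : seq I) (P : pred I) (F : I -> X) :
  nrm (\sum_(i <- r | P i) F i) <= \sum_(i <- r | P i) nrm (F i).
Proof.
elim/big_rec2: _ => [|i a b _ h]; first by rewrite nrm0.
by rewrite (le_trans (nrmD _ _)) // lerD2l.
Qed.

Lemma nrm_small x : (forall e : R, 0 < e -> nrm x <= e) -> x = 0.
Proof.
move=> h; apply/eqP; rewrite -nrm_eq0 eq_le nrm_ge0 andbT.
by rewrite leNgt; apply/negP => x0; have := h _ (divr_gt0 x0 (ltr0n _ 2)); lra.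
Qed.

End Nrm.

Lemma nrmM (a b : C) : nrm (a * b) = nrm a * nrm b.
Proof.
have := normrM a b; rewrite !nrmE -rcM => /(congr1 (@complex.Re R)).
by [].
Qed.

Lemma nrmZ (X : normedModType C) (a : C) (x : X) : nrm (a *: x) = nrm a * nrm x.
Proof.
by have := normrZ a x; rewrite !nrmE -rcM => /(congr1 (@complex.Re R)).
Qed.

Lemma nrm1 : nrm (1 : C) = 1.
Proof. by rewrite /nrm normr1. Qed.

Lemma nrmV (a : C) : nrm a^-1 = (nrm a)^-1.
Proof. by have := normfV a; rewrite !nrmE -rcV => /(congr1 (@complex.Re R)). Qed.

Lemma nrmX (a : C) n : nrm (a ^+ n) = nrm a ^+ n.
Proof. by elim: n => [|n IH]; rewrite ?expr0 ?nrm1 // !exprS nrmM IH. Qed.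

Lemma nrm_conj (a : C) : nrm (a^*) = nrm a.
Proof. by rewrite /nrm norm_conjC. Qed.

Lemma nrm_rc r : nrm (rc r) = `|r|.
Proof.
by rewrite /nrm /= /Num.norm /= ?expr0n /= addr0 sqrtr_sqr.
Qed.

Lemma nrm_ci : nrm ci = 1.
Proof. by rewrite /nrm /= /Num.norm /= expr0n /= add0r expr1n sqrtr1. Qed.

Lemma nrm_sqr (z : C) : nrm z ^+ 2 = complex.Re z ^+ 2 + complex.Im z ^+ 2.
Proof.
case: z => a b; rewrite /nrm /= /Num.norm /= sqr_sqrtr //.
by rewrite addr_ge0 ?sqr_ge0.
Qed.

Lemma Re_le_nrm (z : C) : `|complex.Re z| <= nrm z.
Proof.
rewrite -(ler_pXn2r (ltn0Sn 1)) ?nnegrE ?nrm_ge0 // real_normK ?num_real //.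
by rewrite nrm_sqr lerDl sqr_ge0.
Qed.

Lemma Im_le_nrm (z : C) : `|complex.Im z| <= nrm z.
Proof.
rewrite -(ler_pXn2r (ltn0Sn 1)) ?nnegrE ?nrm_ge0 // real_normK ?num_real //.
by rewrite nrm_sqr lerDr sqr_ge0.
Qed.

Lemma nrm_le_ReIm (z : C) : nrm z <= `|complex.Re z| + `|complex.Im z|.
Proof.
rewrite {1}(complexE2 z) (le_trans (nrmD _ _)) //.
by rewrite nrmM nrm_ci mul1r !nrm_rc.
Qed.

Lemma nbhs_nrm (X : normedModType C) (x : X) (A : set X) :
  nbhs x A <-> exists2 e : R, 0 < e & forall y, nrm (y - x) < e -> A y.
Proof.
split.
  move=> /nbhs_ballP[e /= e0 he]; have ee := ge0_rc (ltW e0).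
  exists (complex.Re e); first by rewrite -ltr_rc -ee.
  move=> y hy; apply: he; rewrite -ball_normE /= ee nrmE ltr_rc nrm_distC //.
move=> [e e0 he]; apply/nbhs_ballP; exists (rc e) => /=; first by rewrite ltr_rc.
by move=> y; rewrite -ball_normE /= nrmE ltr_rc nrm_distC; exact: he.
Qed.

Lemma open_nrm (X : normedModType C) (U : set X) x : open U -> U x ->
  exists2 e : R, 0 < e & forall y, nrm (y - x) < e -> U y.
Proof. by move=> oU Ux; apply/nbhs_nrm; apply: open_nbhs_nbhs. Qed.

Lemma open_nrm_ball (X : normedModType C) (x : X) (e : R) :
  open [set y | nrm (y - x) < e].
Proof.
rewrite openE => y /= hy; apply/nbhs_nrm; exists (e - nrm (y - x)); first lra.
move=> z hz /=; have := nrm_dist_add y z x; lra.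
Qed.

Lemma continuous_nrm (X Y : normedModType C) (f : X -> Y) x :
  {for x, continuous f} <-> forall e : R, 0 < e -> exists2 d : R, 0 < d &
    forall y, nrm (y - x) < d -> nrm (f y - f x) < e.
Proof.
split.
  move=> fx e e0.
  have /fx /nbhs_nrm[d d0 hd] : nbhs (f x) [set y | nrm (y - f x) < e].
    by apply/nbhs_nrm; exists e.
  by exists d.
move=> h A /nbhs_nrm[e e0 he]; apply/nbhs_nrm; have [d d0 hd] := h e e0.
by exists d => // y /hd /he.
Qed.

End RealNorm.

(** * Midpoint sums over the boundary of a square *)

Section Bisection.
Variable R : realType.
Variable P : R -> R -> R -> Prop.
Hypothesis Pglue : forall s t r, 0 < r -> P s t (r / 2) ->
  P (s + r / 2) t (r / 2) -> P s (t + r / 2) (r / 2) ->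
  P (s + r / 2) (t + r / 2) (r / 2) -> P s t r.

Let bad_child (q : R * R * R) : R * R * R :=
  let: (s, t, r) := q in
  if ~~ `[< P s t (r / 2) >] then (s, t, r / 2) else
  if ~~ `[< P (s + r / 2) t (r / 2) >] then (s + r / 2, t, r / 2) else
  if ~~ `[< P s (t + r / 2) (r / 2) >] then (s, t + r / 2, r / 2) else
  (s + r / 2, t + r / 2, r / 2).

(** Goursat bisection as an induction principle. If P failed on the given
    square, repeated quartering would produce nested squares on which P fails,
    shrinking to a point (x, y) at which the local hypothesis is contradicted.
    P s t r speaks of the square with lower left corner (s, t) and side r. *)
Lemma square_bisection s0 t0 r0 : 0 < r0 ->
  (forall x y, s0 <= x <= s0 + r0 -> t0 <= y <= t0 + r0 ->
    exists2 d, 0 < d & forall s t r, 0 < r < d ->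
      s0 <= s -> s + r <= s0 + r0 -> t0 <= t -> t + r <= t0 + r0 ->
      s <= x <= s + r -> t <= y <= t + r -> P s t r) ->
  P s0 t0 r0.
Proof.
move=> r0_gt0 Ploc; apply: contrapT => nP0.
pose q := fix q k := if k is k'.+1 then bad_child (q k') else (s0, t0, r0).
pose s k := (q k).1.1; pose t k := (q k).1.2; pose r k := (q k).2.
have step k : [/\ r k.+1 = r k / 2, (s k.+1 = s k \/ s k.+1 = s k + r k / 2)
    & (t k.+1 = t k \/ t k.+1 = t k + r k / 2)].
  rewrite /s /t /r /=; case: (q k) => [[a b] c] /=.
  by do 3 (case: ifP => _; first by split=> //=; auto); split=> //=; auto.
have r_gt0 k : 0 < r k.
  by elim: k => [//|k IH]; have [-> _ _] := step k; lra.
have nP k : ~ P (s k) (t k) (r k).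
  elim: k => [//|k]; have := r_gt0 k; rewrite /s /t /r /=.
  case: (q k) => [[a b] c] /= c0 nP.
  case: ifPn => [/asboolPn //|/negPn/asboolP P1].
  case: ifPn => [/asboolPn //|/negPn/asboolP P2].
  case: ifPn => [/asboolPn //|/negPn/asboolP P3] /=.
  by move=> P4; apply: nP; apply: Pglue.
have rE k : r k = r0 / 2 ^+ k.
  elim: k => [|k IH]; first by rewrite expr0 divr1.
  by have [-> _ _] := step k; rewrite IH exprSr invfM mulrA.
have nest (u : nat -> R) : (forall k, u k.+1 = u k \/ u k.+1 = u k + r k / 2) ->
    exists x, forall k, u k <= x <= u k + r k.
  move=> ustep.
  have mono k j : (k <= j)%N -> u k <= u j /\ u j + r j <= u k + r k.
    move=> /subnK <-; elim: (j - k)%N => [|i [IH1 IH2]]; first by rewrite !lexx.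
    rewrite addSn; have [rk _ _] := step (i + k)%N; have := r_gt0 (i + k)%N.
    by have := ustep (i + k)%N; rewrite rk => -[] -> ?; split; lra.
  have ub k j : u j <= u k + r k.
    have [h1 _] := mono j (maxn j k) (leq_maxl _ _).
    have [_ h2] := mono k (maxn j k) (leq_maxr _ _).
    by have := r_gt0 (maxn j k); lra.
  have hs : has_sup (range u).
    split; first by exists (u 0), 0.
    by exists (u 0 + r 0) => _ [j _ <-].
  exists (sup (range u)) => k; apply/andP; split.
    by apply: (ub_le_sup (proj2 hs)); exists k.
  by apply: ge_sup; [exact: (proj1 hs)|move=> _ [j _ <-]].
have [x hx] : exists x, forall k, s k <= x <= s k + r k.
  by apply: nest => k; have [] := step k.
have [y hy] : exists y, forall k, t k <= y <= t k + r k.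
  by apply: nest => k; have [] := step k.
have [d d0 hd] := Ploc x y (hx 0) (hy 0).
have [k hk] : exists k, r k < d.
  have [k hk] : exists k, r0 / d < k%:R.
    by exists (Num.bound (r0 / d)); apply: archi_boundP; rewrite divr_ge0 ?ltW.
  exists k; rewrite rE ltr_pdivrMr ?exprn_gt0 // mulrC -ltr_pdivrMr //.
  rewrite (lt_le_trans hk) // -natrX ler_nat ltnW //; exact: ltn_expl.
have inv k' : s0 <= s k' /\ s k' + r k' <= s0 + r0 /\ t0 <= t k' /\ t k' + r k' <= t0 + r0.
  elim: k' => [|k' IH]; first by rewrite /s /t /r /=; lra.
  have [rk sk tk] := step k'; have := r_gt0 k'.
  by case: sk => ->; case: tk => ->; rewrite rk; lra.
have [h1 [h2 [h3 h4]]] := inv k.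
by apply: (nP k); apply: hd => //; rewrite ?r_gt0 ?hk.
Qed.
End Bisection.

(** The cancellation of the inner edges m1, ..., m4 when the boundary of a
    square is the sum of the boundaries of its four quarters; b, r, t and l
    are the halves of the bottom, right, top and left edges. *)
Lemma zmod_cells (V : zmodType) (b1 b2 r2 r4 t3 t4 l1 l3 m1 m2 m3 m4 : V) :
  (b1 + b2) + (r2 + r4) - (t3 + t4) - (l1 + l3) =
  (b1 + m1 - m3 - l1) + (b2 + r2 - m4 - m1) + (m3 + m2 - t3 - l3)
  + (m4 + r4 - t4 - m2).
Proof.
rewrite !opprD !addrA.
rewrite [RHS](ACl (1*5*6*14*11*15*4*12*(2*8)*(3*9)*(7*13)*(10*16)))/=.
by rewrite !(subrr, addNr) !addr0.
Qed.

Section BoundarySums.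
Variable R : realType.
Local Notation C := (cplx R).

Lemma scaleC (x y : C) : x *: y = x * y.
Proof. by []. Qed.

Section OneSpace.
Variable X : normedModType C.
Implicit Types (f g : C -> X) (u d a : C).

(** The composite midpoint rule with 2 ^ n nodes for the integral of f along
    the segment from u to u + d. *)
Fixpoint edge_sum n f u d : X :=
  if n is n'.+1 then edge_sum n' f u (d / 2) + edge_sum n' f (u + d / 2) (d / 2)
  else d *: f (u + d / 2).

(** Midpoint approximation of the integral of f along the boundary,
    counterclockwise, of the square with lower left corner a and side d. *)
Definition square_sum n f a d : X :=
  edge_sum n f a d + edge_sum n f (a + d) (ci R * d)
  - edge_sum n f (a + ci R * d) d - edge_sum n f a (ci R * d).

Lemma square_sumS n f a h :
  square_sum n.+1 f a (h * 2) =
    square_sum n f a h + square_sum n f (a + h) h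
    + square_sum n f (a + ci R * h) h + square_sum n f (a + h + ci R * h) h.
Proof.
rewrite /square_sum /=.
have -> : h * 2 / 2 = h by field.
have -> : ci R * (h * 2) / 2 = ci R * h by field.
rewrite (zmod_cells _ _ _ _ _ _ _ _ (edge_sum n f (a + h) (ci R * h))
  (edge_sum n f (a + h + ci R * h) (ci R * h))
  (edge_sum n f (a + ci R * h) h) (edge_sum n f (a + h + ci R * h) h)).
have -> : a + h * 2 = a + h + h by ring.
have -> : a + ci R * (h * 2) = a + ci R * h + ci R * h by ring.
have e1 : a + h + ci R * h = a + ci R * h + h by ring.
have e2 : a + h + ci R * h + ci R * h = a + ci R * h + ci R * h + h by ring.
have e3 : a + h + ci R * h + h = a + h + h + ci R * h by ring.
by rewrite e3 e2 -!e1.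
Qed.

Lemma edge_sumD n f g u d :
  edge_sum n (fun z => f z + g z) u d = edge_sum n f u d + edge_sum n g u d.
Proof.
by elim: n u d => [|n IH] u d /=; rewrite ?scalerDr // !IH addrACA.
Qed.

Lemma edge_sumN n f u d : edge_sum n (fun z => - f z) u d = - edge_sum n f u d.
Proof. by elim: n u d => [|n IH] u d /=; rewrite ?scalerN // !IH opprD. Qed.

Lemma square_sumB n f g a d :
  square_sum n (fun z => f z - g z) a d = square_sum n f a d - square_sum n g a d.
Proof.
rewrite /square_sum !edge_sumD !edge_sumN !opprD !opprK !addrA.
by rewrite [LHS](ACl (1*3*5*7*2*4*6*8)).
Qed.

Lemma edge_sum_le n f u d (K : R) :
  (forall x : R, 0 <= x <= 1 -> nrm (f (u + rc x * d)) <= K) ->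
  nrm (edge_sum n f u d) <= nrm d * K.
Proof.
elim: n u d => [|n IH] u d h /=.
  rewrite nrmZ ler_wpM2l ?nrm_ge0 //.
  have -> : d / 2 = rc (2^-1) * d by rewrite rcV rc_nat mulrC.
  by apply: h; lra.
have d2 : nrm (d / 2) = nrm d / 2 by rewrite nrmM nrmV -rc_nat nrm_rc ger0_norm.
rewrite (le_trans (nrmD _ _)) //.
have h1 : nrm (edge_sum n f u (d / 2)) <= nrm (d / 2) * K.
  apply: IH => x hx.
  have -> : u + rc x * (d / 2) = u + rc (x / 2) * d.
    by rewrite rcM rcV rc_nat; field.
  by apply: h; lra.
have h2 : nrm (edge_sum n f (u + d / 2) (d / 2)) <= nrm (d / 2) * K.
  apply: IH => x hx.
  have -> : u + d / 2 + rc x * (d / 2) = u + rc ((1 + x) / 2) * d.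
    by rewrite rcM rcD rcV rc_nat rc1; field.
  by apply: h; lra.
by move: h1 h2; rewrite d2; lra.
Qed.

Lemma edge_sum_affine n (x y : X) u d :
  edge_sum n (fun z => x + z *: y) u d = d *: x + (d * (u + d / 2)) *: y.
Proof.
elim: n u d => [|n IH] u d /=; first by rewrite scalerDr scalerA.
rewrite !IH addrACA -!scalerDl; congr (_ *: _ + _ *: _);
  by rewrite ?scaleC; field.
Qed.

(** The midpoint rule is exact for affine maps; this is the only case of the
    Cauchy theorem that has to be computed. *)
Lemma square_sum_affine n (x y : X) a d :
  square_sum n (fun z => x + z *: y) a d = 0.
Proof.
rewrite /square_sum !edge_sum_affine !opprD -!scaleNr !addrA.
rewrite [LHS](ACl ((1*3*5*7)*(2*4*6*8)))/= -!scalerDl.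
rewrite [X in X *: x]( _ : _ = 0); last by rewrite !scaleC; ring.
rewrite [X in X *: y]( _ : _ = 0); last by rewrite !scaleC; field.
by rewrite !scale0r addr0.
Qed.

Lemma square_sum_le n f (s t r K : R) : 0 <= r ->
  (forall x y, s <= x <= s + r -> t <= y <= t + r ->
     [\/ x = s, x = s + r, y = t | y = t + r] -> nrm (f (Complex x y)) <= K) ->
  nrm (square_sum n f (Complex s t) (rc r)) <= 4 * r * K.
Proof.
move=> r0 hf.
have nr : nrm (rc r) = r by rewrite nrm_rc ger0_norm.
have nir : nrm (ci R * rc r) = r by rewrite nrmM nrm_ci mul1r.
have cE (x y x' y' : R) : x = x' -> y = y' -> Complex x y = Complex x' y' :> C.
  by move=> -> ->.
have e1 : nrm (edge_sum n f (Complex s t) (rc r)) <= nrm (rc r) * K.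
  apply: edge_sum_le => x hx; rewrite -rcM.
  have -> : Complex s t + rc (x * r) = Complex (s + x * r) t :> C.
    by apply: cE => /=; lra.
  by apply: hf; [nra|lra|apply: Or43].
have e2 : nrm (edge_sum n f (Complex s t + rc r) (ci R * rc r)) <= nrm (ci R * rc r) * K.
  apply: edge_sum_le => x hx.
  have -> : Complex s t + rc r + rc x * (ci R * rc r) = Complex (s + r) (t + x * r) :> C.
    by apply: cE => /=; lra.
  by apply: hf; [lra|nra|apply: Or42].
have e3 : nrm (edge_sum n f (Complex s t + ci R * rc r) (rc r)) <= nrm (rc r) * K.
  apply: edge_sum_le => x hx; rewrite -rcM.
  have -> : Complex s t + ci R * rc r + rc (x * r) = Complex (s + x * r) (t + r) :> C.
    by apply: cE => /=; lra.
  by apply: hf; [nra|lra|apply: Or44].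
have e4 : nrm (edge_sum n f (Complex s t) (ci R * rc r)) <= nrm (ci R * rc r) * K.
  apply: edge_sum_le => x hx.
  have -> : Complex s t + rc x * (ci R * rc r) = Complex s (t + x * r) :> C.
    by apply: cE => /=; lra.
  by apply: hf; [lra|nra|apply: Or41].
rewrite nr nir in e1 e2 e3 e4.
rewrite /square_sum (le_trans (nrmB _ _)) //.
have := nrmB (edge_sum n f (Complex s t) (rc r) +
   edge_sum n f (Complex s t + rc r) (ci R * rc r))
  (edge_sum n f (Complex s t + ci R * rc r) (rc r)).
have := nrmD (edge_sum n f (Complex s t) (rc r))
   (edge_sum n f (Complex s t + rc r) (ci R * rc r)).
lra.
Qed.

End OneSpace.
End BoundarySums.

(** * Goursat lemma with finitely many exceptional points *)

Section FirstOrder.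
Variable R : realType.
Local Notation C := (cplx R).

(** The error term common to the derivative in one complex variable, in
    several complex variables, and along a real parameter, so that one product
    rule serves all three. *)
Definition first_order (E : zmodType) (N : E -> R) (X : normedModType C) (f l : E -> X) :=
  forall e : R, 0 < e -> exists2 d : R, 0 < d &
    forall h, N h < d -> nrm (f h - f 0 - l h) <= e * N h.

Lemma first_order_bilinear (E : zmodType) (N : E -> R) (X Y Z : normedModType C)
    (B : X -> Y -> Z) (c a b : R) (f l : E -> X) (g k : E -> Y) :
  0 <= c -> (forall x y, nrm (B x y) <= c * nrm x * nrm y) ->
  (forall x x' y, B (x - x') y = B x y - B x' y) ->
  (forall x y y', B x (y - y') = B x y - B x y') ->
  (forall h, 0 <= N h) -> 0 <= a -> 0 <= b ->
  (forall h, nrm (l h) <= a * N h) -> (forall h, nrm (k h) <= b * N h) ->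
  first_order N f l -> first_order N g k ->
  first_order N (fun h => B (f h) (g h)) (fun h => B (l h) (g 0) + B (f 0) (k h)).
Proof.
move=> c0 Bc BDl BDr N0 a0 b0 la kb hf hg e e0.
have [r1 r10 h1] := hg 1 ltr01.
pose L := b + 1; have L0 : 0 < L by rewrite /L; lra.
pose G := nrm (g 0) + L; have G0 : 0 < G by rewrite /G; have := nrm_ge0 (g 0); lra.
pose F := nrm (f 0) + 1; have F0 : 0 < F by rewrite /F; have := nrm_ge0 (f 0); lra.
pose D := a + 1; have D0 : 0 < D by rewrite /D; lra.
pose c1 := c + 1; have c10 : 0 < c1 by rewrite /c1; lra.
have e1 : 0 < e / 3 / (c1 * G) by rewrite !divr_gt0 ?mulr_gt0.
have e2 : 0 < e / 3 / (c1 * F) by rewrite !divr_gt0 ?mulr_gt0.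
have [r2 r20 h2] := hf _ e1; have [r3 r30 h3] := hg _ e2.
pose r4 := e / 3 / (c1 * D * L).
have r40 : 0 < r4 by rewrite !divr_gt0 ?mulr_gt0.
exists (Num.min (Num.min r1 1) (Num.min (Num.min r2 r3) r4)).
  by rewrite !lt_min r10 ltr01 r20 r30.
move=> h; rewrite !lt_min => /andP[/andP[s1 sl] /andP[/andP[s2 s3] s4]].
have {}h1 := h1 h s1; have {}h2 := h2 h s2; have {}h3 := h3 h s3.
have {}h1 : nrm (g h - g 0) <= L * N h.
  by have := nrm_le_add (g h - g 0) (k h); have := kb h; rewrite /L; lra.
have := la h; have := N0 h; set t := N h in h1 h2 h3 sl s4 * => t0 lh.
have -> : B (f h) (g h) - B (f 0) (g 0) - (B (l h) (g 0) + B (f 0) (k h)) =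
   B (f h - f 0 - l h) (g h) + B (l h) (g h - g 0) + B (f 0) (g h - g 0 - k h).
  rewrite !BDl !BDr !opprD !addrA.
  by rewrite [RHS](ACl (1*7*5*8*(2*6)*(3*4)))/= !addNr !addr0.
have n1 : nrm (B (f h - f 0 - l h) (g h)) <= e / 3 * t.
  have gs : nrm (g h) <= G.
    have : L * t <= L by rewrite ler_piMr // ltW.
    by have := nrm_le_add (g h) (g 0); rewrite /G; lra.
  apply: le_trans (Bc _ _) _.
  have : c * nrm (f h - f 0 - l h) * nrm (g h) <= c1 * (e / 3 / (c1 * G) * t) * G.
    apply: ler_pM; rewrite ?mulr_ge0 ?nrm_ge0 //.
    by apply: ler_pM; rewrite ?nrm_ge0 // /c1 lerDl.
  by move/le_trans; apply; rewrite le_eqVlt; apply/orP; left; apply/eqP; field; rewrite !gt_eqF.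
have n3 : nrm (B (f 0) (g h - g 0 - k h)) <= e / 3 * t.
  apply: le_trans (Bc _ _) _.
  have : c * nrm (f 0) * nrm (g h - g 0 - k h) <= c1 * F * (e / 3 / (c1 * F) * t).
    apply: ler_pM; rewrite ?mulr_ge0 ?nrm_ge0 //.
    by apply: ler_pM; rewrite ?nrm_ge0 // lerDl.
  by move/le_trans; apply; rewrite le_eqVlt; apply/orP; left; apply/eqP; field; rewrite !gt_eqF.
have n2 : nrm (B (l h) (g h - g 0)) <= e / 3 * t.
  apply: le_trans (Bc _ _) _.
  have : c * nrm (l h) * nrm (g h - g 0) <= c1 * (D * t) * (L * t).
    apply: ler_pM; rewrite ?mulr_ge0 ?nrm_ge0 //.
    apply: ler_pM; rewrite ?nrm_ge0 // ?lerDl //.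
    by apply: le_trans lh _; rewrite ler_wpM2r // lerDl.
  move/le_trans; apply.
  have -> : c1 * (D * t) * (L * t) = c1 * D * L * t * t by ring.
  by rewrite ler_wpM2r // -ler_pdivlMl ?mulr_gt0 // mulrC ltW.
have := nrmD (B (f h - f 0 - l h) (g h) + B (l h) (g h - g 0)) (B (f 0) (g h - g 0 - k h)).
have := nrmD (B (f h - f 0 - l h) (g h)) (B (l h) (g h - g 0)).
lra.
Qed.

End FirstOrder.

Section ComplexDerivative.
Variable R : realType.
Local Notation C := (cplx R).

Definition cder (X : normedModType C) (f : C -> X) (z : C) (l : X) :=
  forall e : R, 0 < e -> exists2 d : R, 0 < d & forall y, nrm (y - z) < d ->
    nrm (f y - f z - (y - z) *: l) <= e * nrm (y - z).

Section Rules.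
Variable X : normedModType C.
Implicit Types (f g : C -> X) (z : C) (l : X).

Lemma cder_cst (x : X) z : cder (fun=> x) z 0.
Proof.
by move=> e e0; exists 1 => // y _; rewrite subrr scaler0 subr0 nrm0 mulr_ge0 ?nrm_ge0 ?ltW.
Qed.

Lemma cderB f g z l m : cder f z l -> cder g z m ->
  cder (fun y => f y - g y) z (l - m).
Proof.
move=> hf hg e e0; have e2 : 0 < e / 2 by lra.
have [d1 d10 h1] := hf _ e2; have [d2 d20 h2] := hg _ e2.
exists (Num.min d1 d2); first by rewrite lt_min d10.
move=> y; rewrite lt_min => /andP[/h1 {}h1 /h2 {}h2].
have -> : f y - g y - (f z - g z) - (y - z) *: (l - m) =
   (f y - f z - (y - z) *: l) - (g y - g z - (y - z) *: m).
  rewrite scalerBr !opprD !opprK !addrA.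
  by rewrite [RHS](ACl (1*4*2*5*3*6)).
have := nrmB (f y - f z - (y - z) *: l) (g y - g z - (y - z) *: m); lra.
Qed.

Lemma cder_lip f z l : cder f z l -> exists2 d : R, 0 < d &
  forall y, nrm (y - z) < d -> nrm (f y - f z) <= (nrm l + 1) * nrm (y - z).
Proof.
move=> hf; have [d d0 hd] := hf 1 ltr01; exists d => // y /hd h.
have := nrm_le_add (f y - f z) ((y - z) *: l); rewrite nrmZ; lra.
Qed.

End Rules.

Lemma cder_first_order (X : normedModType C) (f : C -> X) z l :
  cder f z l <-> first_order (@nrm R C) (fun h => f (z + h)) (fun h => h *: l).
Proof.
split=> hf e e0; have [d d0 hd] := hf e e0; exists d => // y yd.
  have := hd (z + y); rewrite addrAC subrr add0r => /(_ yd).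
  by rewrite addr0.
by have := hd (y - z) yd; rewrite addr0 [z + _]addrC subrK.
Qed.

Lemma cderZ (X : normedModType C) (a : C -> C) (f : C -> X) z a' l :
  cder a z a' -> cder f z l ->
  cder (fun y => a y *: f y) z (a' *: f z + a z *: l).
Proof.
move=> /cder_first_order ha /cder_first_order hf; apply/cder_first_order => e e0.
have bd (Y : normedModType C) (d : Y) (h : C) : nrm (h *: d) <= nrm d * nrm h.
  by rewrite nrmZ mulrC.
have [|||d d0 hd] := @first_order_bilinear R C (@nrm R C) C X X (fun x y => x *: y) 1
  (nrm a') (nrm l) _ _ _ _ ler01 _ _ _ (@nrm_ge0 R C) (nrm_ge0 _) (nrm_ge0 _)
  (bd C a') (bd X l) ha hf e e0.
- by move=> x y; rewrite mul1r nrmZ.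
- by move=> x x' y; rewrite scalerBl.
- by move=> x y y'; rewrite scalerBr.
exists d => // h /hd; rewrite !addr0; congr (nrm (_ - _) <= _).
by rewrite scalerDr !scalerA scaleC [a z * h]mulrC.
Qed.

Lemma eq_cder_near (X : normedModType C) (f g : C -> X) z l (d : R) : 0 < d ->
  (forall y, nrm (y - z) < d -> f y = g y) -> cder f z l -> cder g z l.
Proof.
move=> d0 fg hf e e0; have [d1 d10 h1] := hf e e0.
exists (Num.min d d1); first by rewrite lt_min d0.
move=> y; rewrite lt_min => /andP[yd yd1].
rewrite -(fg _ yd) -fg ?subrr ?nrm0 //; exact: h1.
Qed.

(** (y - c)^-1 - (z - c)^-1 + (y - z) (z - c)^-2 equals (y - z)^2 (z - c)^-2
    (y - c)^-1, and |y - c| stays above |z - c| / 2 near z. *)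
Lemma cder_inv_sub (c z : C) : z != c -> exists l, cder (fun y => (y - c)^-1) z l.
Proof.
move=> zc; have u0 : z - c != 0 by rewrite subr_eq0.
exists (- (z - c)^-2) => e e0.
set u := z - c in u0 *; have nu : 0 < nrm u by rewrite nrm_gt0.
pose d := Num.min (nrm u / 2) (e * nrm u ^+ 3 / 2).
exists d; first by rewrite lt_min !divr_gt0 ?mulr_gt0 ?exprn_gt0.
move=> y; rewrite lt_min => /andP[y1 y2].
have hy : nrm u / 2 < nrm (y - c).
  have := nrm_dist_add (y - z) u 0; rewrite !subr0 [nrm (u - _)]nrm_distC.
  have := nrm_le_add u (y - c).
  have -> : u - (y - c) = - (y - z) by rewrite /u; ring.
  rewrite nrmN; lra.
have yc : y - c != 0 by rewrite -nrm_gt0; lra.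
have -> : (y - c)^-1 - u^-1 - (y - z) *: (- u ^- 2) =
    (y - z) ^+ 2 * (u ^- 2 * (y - c)^-1).
  rewrite scaleC /u; field; first by rewrite u0 yc.
rewrite nrmM nrmX nrmM !nrmV nrmX expr2 -mulrA mulrC ler_wpM2r ?nrm_ge0 //.
have h : nrm (y - z) <= e * nrm u ^+ 3 / 2 by apply: ltW.
rewrite -invfM ler_pdivrMr ?mulr_gt0 ?exprn_gt0 //; last lra.
apply: le_trans h _.
have -> : e * nrm u ^+ 3 / 2 = e * (nrm u ^+ 2 * (nrm u / 2)) by rewrite !exprS; ring.
by rewrite ler_wpM2l ?(ltW e0) // ler_wpM2l ?exprn_ge0 ?nrm_ge0 // ltW.
Qed.

End ComplexDerivative.

Section Goursat.
Variable R : realType.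
Local Notation C := (cplx R).

(** The share of the point x in the interval from s to s + r. An end point
    counts for one half, which makes the share additive when the interval is
    halved. *)
Definition density1 (x s r : R) : R :=
  ((s <= x < s + r)%R%:R + (s < x <= s + r)%R%:R) / 2.

(** The number of points of E in a square, points of the boundary being shared
    among adjacent squares. *)
Definition density (E : seq C) (s t r : R) : R :=
  \sum_(z <- E) density1 (complex.Re z) s r * density1 (complex.Im z) t r.

Lemma density1_split x s r : 0 < r ->
  density1 x s r = density1 x s (r / 2) + density1 x (s + r / 2) (r / 2).
Proof.
move=> r0; rewrite /density1.
have -> : s + r / 2 + r / 2 = s + r by lra.
have [h1|h1|h1] := ltgtP x s; have [h2|h2|h2] := ltgtP x (s + r / 2);
  have [h3|h3|h3] := ltgtP x (s + r) => //=; lra.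
Qed.

Lemma density1_ge0 x s r : 0 <= density1 x s r.
Proof. by rewrite divr_ge0 // addr_ge0. Qed.

Lemma density1_le1 x s r : density1 x s r <= 1.
Proof.
by rewrite /density1; case: (_ && _); case: (_ && _) => /=; lra.
Qed.

Lemma density1_ge x s r : 0 < r -> s <= x <= s + r -> 1 / 2 <= density1 x s r.
Proof.
move=> r0; rewrite /density1.
by have [h1|h1|h1] := ltgtP x s; have [h2|h2|h2] := ltgtP x (s + r) => //= _; lra.
Qed.

Lemma density_split E s t r : 0 < r -> density E s t r =
  density E s t (r / 2) + density E (s + r / 2) t (r / 2)
  + density E s (t + r / 2) (r / 2) + density E (s + r / 2) (t + r / 2) (r / 2).
Proof.
move=> r0; rewrite /density -!big_split /=; apply: eq_bigr => z _.
by rewrite (density1_split _ s) // (density1_split _ t) //; ring.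
Qed.

Lemma density_ge E s t r z : z \in E -> 0 < r ->
  s <= complex.Re z <= s + r -> t <= complex.Im z <= t + r ->
  1 / 4 <= density E s t r.
Proof.
move=> zE r0 h1 h2; rewrite /density (big_rem z) //=.
have := density1_ge r0 h1; have := density1_ge r0 h2.
have : 0 <= \sum_(y <- rem z E) density1 (complex.Re y) s r * density1 (complex.Im y) t r.
  by apply: sumr_ge0 => y _; rewrite mulr_ge0 ?density1_ge0.
nra.
Qed.

Lemma density_ge0 E s t r : 0 <= density E s t r.
Proof. by apply: sumr_ge0 => y _; rewrite mulr_ge0 ?density1_ge0. Qed.

Lemma density_le E s t r : density E s t r <= (size E)%:R.
Proof.
rewrite /density -sum1_size natr_sum; apply: ler_sum => z _.
by rewrite mulr_ile1 ?density1_ge0 ?density1_le1.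
Qed.

Variable X : normedModType C.

(** Bisection with the bound ea * (area) + ep * (density of E), which is
    additive under quartering. Near a point of differentiability the affine
    part of f contributes nothing and the remainder is below the area term;
    near a point of E the sum is at most 4 r K, below the density term as soon
    as r is small. *)
Lemma goursat (f : C -> X) (E : seq C) (s0 t0 r0 K : R) : 0 < r0 ->
  (forall x y, s0 <= x <= s0 + r0 -> t0 <= y <= t0 + r0 ->
     nrm (f (Complex x y)) <= K) ->
  (forall x y, s0 <= x <= s0 + r0 -> t0 <= y <= t0 + r0 ->
     (Complex x y : C) \notin E -> exists l, cder f (Complex x y) l) ->
  forall e : R, 0 < e -> exists n0, forall n, (n0 <= n)%N ->
    nrm (square_sum n f (Complex s0 t0) (rc r0)) <= e.
Proof.
move=> r00 fK fE e e0.
have K0 : 0 <= K by apply: le_trans (fK s0 t0 _ _); rewrite ?nrm_ge0 //; lra.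
pose N : R := (size E)%:R + 1.
have N0 : 0 < N by rewrite /N ltr_wpDl.
pose ea := e / 2 / r0 ^+ 2; pose ep := e / 2 / N.
have ea0 : 0 < ea by rewrite !divr_gt0 ?exprn_gt0.
have ep0 : 0 < ep by rewrite !divr_gt0.
suff [n0 hn0] : exists n0, forall n, (n0 <= n)%N ->
    nrm (square_sum n f (Complex s0 t0) (rc r0)) <= ea * r0 ^+ 2 + ep * density E s0 t0 r0.
  exists n0 => n /hn0 h; apply: le_trans h _.
  have -> : ea * r0 ^+ 2 = e / 2 by rewrite divfK // expf_neq0 // gt_eqF.
  have : ep * density E s0 t0 r0 <= e / 2.
    rewrite /ep mulrAC ler_pdivrMr // ler_pM2l ?divr_gt0 //.
    by rewrite (le_trans (density_le _ _ _ _)) // /N lerDl.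
  lra.
(* Adding four quarters raises the order n of the sums by one, hence the bound
   is asked only for large n. *)
pose P s t r := exists n0, forall n, (n0 <= n)%N ->
    nrm (square_sum n f (Complex s t) (rc r)) <= ea * r ^+ 2 + ep * density E s t r.
apply: (@square_bisection _ P) => //.
  move=> s t r r_gt0 [n1 h1] [n2 h2] [n3 h3] [n4 h4].
  exists (maxn (maxn n1 n2) (maxn n3 n4)).+1 => n.
  case: n => // n; rewrite ltnS !geq_max => /andP[/andP[/h1 {}h1 /h2 {}h2] /andP[/h3 {}h3 /h4 {}h4]].
  have -> : rc r = rc (r / 2) * 2 by rewrite rcM rcV rc_nat; field.
  rewrite square_sumS (density_split _ _ _ r_gt0).
  have cE (x y x' y' : R) : x = x' -> y = y' -> Complex x y = Complex x' y' :> C.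
    by move=> -> ->.
  have -> : Complex s t + rc (r / 2) = Complex (s + r / 2) t :> C by apply: cE => /=; lra.
  have -> : Complex s t + ci R * rc (r / 2) = Complex s (t + r / 2) :> C by apply: cE => /=; lra.
  have -> : Complex (s + r / 2) t + ci R * rc (r / 2) = Complex (s + r / 2) (t + r / 2) :> C.
    by apply: cE => /=; lra.
  set S1 := square_sum _ _ _ _ in h1 *; set S2 := square_sum _ _ (Complex (s + _) t) _ in h2 *.
  set S3 := square_sum _ _ (Complex s (t + _)) _ in h3 *; set S4 := square_sum _ _ _ _ in h4 *.
  have := nrmD (S1 + S2 + S3) S4; have := nrmD (S1 + S2) S3; have := nrmD S1 S2.
  by nra.
move=> x y hx hy; have [zE|zE] := boolP ((Complex x y : C) \in E).
  pose d := ep / 4 / (4 * K + 1).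
  exists d; first by rewrite !divr_gt0 //; lra.
  move=> s t r /andP[r_gt0 rd] hs hsr ht htr hxs hyt; exists 0 => n _.
  have h : nrm (square_sum n f (Complex s t) (rc r)) <= 4 * r * K.
    by apply: square_sum_le => [|x' y' hx' hy' _]; [exact: ltW|apply: fK; lra].
  have h1 : 1 / 4 <= density E s t r by apply: (density_ge zE).
  have h2 : r * (4 * K + 1) <= ep / 4.
    by rewrite -ler_pdivlMr; [exact: ltW|lra].
  have : 0 <= ea * r ^+ 2 by rewrite mulr_ge0 ?exprn_ge0 ?ltW.
  nra.
have [l hl] := fE _ _ hx hy zE.
have e8 : 0 < ea / 8 by lra.
have [d d0 hd] := hl _ e8.
exists (d / 2); first lra.
move=> s t r /andP[r_gt0 rd] hs hsr ht htr hxs hyt; exists 0 => n _.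
pose z : C := Complex x y.
have -> : square_sum n f (Complex s t) (rc r) =
   square_sum n (fun y => f y - (f z - z *: l + y *: l)) (Complex s t) (rc r).
  by rewrite square_sumB square_sum_affine subr0.
have h : nrm (square_sum n (fun y => f y - (f z - z *: l + y *: l)) (Complex s t) (rc r))
    <= 4 * r * (ea / 8 * (2 * r)).
  apply: square_sum_le => [|x' y' hx' hy' _]; first exact: ltW.
  have -> : f (Complex x' y') - (f z - z *: l + Complex x' y' *: l) =
     f (Complex x' y') - f z - ((Complex x' y' : C) - z) *: l.
    by rewrite scalerBl !opprD !opprK !addrA addrAC.
  have hn : nrm ((Complex x' y' : C) - z) <= 2 * r.
    apply: le_trans (nrm_le_ReIm _) _ => /=.
    have hx1 : `|x' - x| <= r by rewrite ler_norml; lra.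
    have hy1 : `|y' - y| <= r by rewrite ler_norml; lra.
    lra.
  have hn2 : nrm ((Complex x' y' : C) - z) < d by lra.
  by apply: (le_trans (hd _ hn2)); rewrite ler_pM2l.
have := density_ge0 E s t r.
have -> : ea * r ^+ 2 = 4 * r * (ea / 8 * (2 * r)) by rewrite expr2; field.
by nra.
Qed.

End Goursat.

(** * Taylor estimates in one variable *)

Section CenterEstimate.
Variable R : realType.
Local Notation C := (cplx R).

Lemma edge_sum_Im n (f : C -> C) (u d : C) (k : R) :
  (forall x : R, 0 <= x <= 1 -> k <= complex.Im (d * f (u + rc x * d))) ->
  k <= complex.Im (edge_sum n f u d).
Proof.
have ImD (a b : C) : complex.Im (a + b) = complex.Im a + complex.Im b.
  by case: a b => [? ?] [].
have Im2 (a b : C) : complex.Im (a / 2 * b) = complex.Im (a * b) / 2.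
  have -> : a / 2 * b = rc (2^-1) * (a * b) by rewrite rcV rc_nat; field.
  by case: (a * b) => p q /=; rewrite mul0r addr0 mulrC.
elim: n u d k => [|n IH] u d k h /=.
  have -> : d / 2 = rc (2^-1) * d by rewrite rcV rc_nat mulrC.
  by rewrite scaleC; apply: h; lra.
have -> : k = k / 2 + k / 2 by field.
rewrite ImD lerD //; apply: IH => x hx; rewrite Im2 ler_pM2r //.
  have -> : u + rc x * (d / 2) = u + rc (x / 2) * d.
    by rewrite rcM rcV rc_nat; field.
  by apply: h; lra.
have -> : u + d / 2 + rc x * (d / 2) = u + rc ((1 + x) / 2) * d.
  by rewrite rcM rcD rcV rc_nat rc1; field.
by apply: h; lra.
Qed.

Lemma edge_sumZl (X : normedModType C) n (g : C -> C) (v : X) u d :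
  edge_sum n (fun z => g z *: v) u d = edge_sum n g u d *: v.
Proof.
by elim: n u d => [|n IH] u d /=; rewrite ?scalerA // !IH scalerDl.
Qed.

Lemma square_sumZl (X : normedModType C) n (g : C -> C) (v : X) a d :
  square_sum n (fun z => g z *: v) a d = square_sum n g a d *: v.
Proof. by rewrite /square_sum !edge_sumZl !scalerBl scalerDl. Qed.

(** The sums approximate 2 pi i; a lower bound of the imaginary part is enough
    to estimate a value at the centre. On each edge the integrand has
    imaginary part r / (s^2 + r^2) >= 1 / (2 r). *)
Lemma winding_ge n (c : C) (r : R) : 0 < r ->
  4 <= complex.Im (square_sum n (fun z => (z - c)^-1)
    (Complex (complex.Re c - r) (complex.Im c - r)) (rc (2 * r))).
Proof.
case: c => p q r0 /=.
have key (s : R) : - r <= s <= r -> 1 <= 2 * r * r / (s ^+ 2 + r ^+ 2).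
  move=> hs; rewrite ler_pdivlMr; last by rewrite ltr_wpDl ?sqr_ge0 ?exprn_gt0.
  by rewrite mul1r !expr2; nra.
have ImE (D1 D2 a b : R) : complex.Im ((Complex D1 D2 : C) * (Complex a b : C)^-1) =
    (D2 * a - D1 * b) / (a ^+ 2 + b ^+ 2).
  by rewrite /= mulrBl mulrN !mulrA addrC.
have cE (x y x' y' : R) : x = x' -> y = y' -> Complex x y = Complex x' y' :> C.
  by move=> -> ->.
have ImD (a b : C) : complex.Im (a + b) = complex.Im a + complex.Im b.
  by case: a b => [? ?] [].
have ImN (a : C) : complex.Im (- a) = - complex.Im a by case: a.
have e1 : 1 <= complex.Im (edge_sum n (fun z => (z - Complex p q)^-1)
    (Complex (p - r) (q - r)) (rc (2 * r))).
  apply: edge_sum_Im => x hx.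
  have -> : Complex (p - r) (q - r) + rc x * rc (2 * r) - Complex p q
    = Complex (r * (2 * x - 1)) (- r) :> C by apply: cE => /=; lra.
  rewrite ImE sqrrN [X in X / _](_ : _ = 2 * r * r); last by lra.
  by apply: key; nra.
have e2 : 1 <= complex.Im (edge_sum n (fun z => (z - Complex p q)^-1)
    (Complex (p - r) (q - r) + rc (2 * r)) (ci R * rc (2 * r))).
  apply: edge_sum_Im => x hx.
  have -> : Complex (p - r) (q - r) + rc (2 * r) + rc x * (ci R * rc (2 * r)) - Complex p q
    = Complex r (r * (2 * x - 1)) :> C by apply: cE => /=; lra.
  have -> : ci R * rc (2 * r) = Complex 0 (2 * r) by apply: cE => /=; lra.
  rewrite ImE [X in _ / X]addrC [X in X / _](_ : _ = 2 * r * r); last by lra.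
  by apply: key; nra.
have e3 : 1 <= complex.Im (edge_sum n (fun z => - (z - Complex p q)^-1)
    (Complex (p - r) (q - r) + ci R * rc (2 * r)) (rc (2 * r))).
  apply: edge_sum_Im => x hx.
  have -> : Complex (p - r) (q - r) + ci R * rc (2 * r) + rc x * rc (2 * r) - Complex p q
    = Complex (r * (2 * x - 1)) r :> C by apply: cE => /=; lra.
  rewrite mulrN ImN ImE -mulNr [X in X / _](_ : _ = 2 * r * r); last by lra.
  by apply: key; nra.
have e4 : 1 <= complex.Im (edge_sum n (fun z => - (z - Complex p q)^-1)
    (Complex (p - r) (q - r)) (ci R * rc (2 * r))).
  apply: edge_sum_Im => x hx.
  have -> : Complex (p - r) (q - r) + rc x * (ci R * rc (2 * r)) - Complex p q
    = Complex (- r) (r * (2 * x - 1)) :> C by apply: cE => /=; lra.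
  have -> : ci R * rc (2 * r) = Complex 0 (2 * r) by apply: cE => /=; lra.
  rewrite mulrN ImN ImE -mulNr sqrrN [X in _ / X]addrC [X in X / _](_ : _ = 2 * r * r); last by lra.
  by apply: key; nra.
rewrite !edge_sumN !ImN in e3 e4.
by rewrite /square_sum !ImD !ImN; lra.
Qed.

Variable X : normedModType C.

Lemma quotient_bounded (f : C -> X) (c : C) (l : X) (S : set C) (K : R) :
  cder f c l -> S c -> (forall z, S z -> nrm (f z) <= K) ->
  exists K', forall z, S z -> nrm ((z - c)^-1 *: (f z - f c)) <= K'.
Proof.
move=> hf Sc fK; have [d d0 hd] := cder_lip hf.
have K0 : 0 <= K by apply: le_trans (fK _ Sc); exact: nrm_ge0.
exists ((nrm l + 1) + 2 * K / d) => z Sz.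
have l0 := nrm_ge0 l; have Kd : 0 <= 2 * K / d by apply: divr_ge0; lra.
have [->|zc] := eqVneq z c; first by rewrite !subrr scaler0 nrm0; lra.
have zc0 : 0 < nrm (z - c) by rewrite nrm_gt0 subr_eq0.
rewrite nrmZ nrmV; have [h|h] := ltP (nrm (z - c)) d.
  by have {}h := hd _ h; rewrite mulrC; apply: ler_wpDr => //; rewrite ler_pdivrMr.
have h1 : nrm (f z - f c) <= 2 * K.
  by have := nrmB (f z) (f c); have := fK _ Sz; have := fK _ Sc; lra.
apply: ler_wpDl; first lra.
rewrite mulrC; apply: ler_pM; rewrite ?nrm_ge0 ?invr_ge0 ?nrm_ge0 //.
by rewrite lef_pV2 ?posrE.
Qed.

Lemma quotient_cder (f : C -> X) (c z : C) (l : X) : z != c -> cder f z l ->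
  exists l', cder (fun y => (y - c)^-1 *: (f y - f c)) z l'.
Proof.
move=> zc hf; have [m hm] := cder_inv_sub zc.
by eexists; apply: cderZ hm _; apply: cderB hf _; exact: cder_cst.
Qed.

(** A crude maximum principle. By the Goursat lemma the sums of (f z - f c) /
    (z - c) tend to 0, so 4 |f c| is at most the sum of f z / (z - c), which
    is at most 8 r (B / r) because the boundary has length 8 r and distance r
    from c. *)
Lemma center_estimate (f : C -> X) (E : seq C) (c : C) (r K B : R) : 0 < r ->
  c \notin E -> (forall z : C, nrm (z - c) <= 2 * r -> nrm (f z) <= K) ->
  (forall z : C, nrm (z - c) <= 2 * r -> z \notin E -> exists l, cder f z l) ->
  (forall z : C, r <= nrm (z - c) <= 2 * r -> nrm (f z) <= B) ->
  nrm (f c) <= 2 * B.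
Proof.
move=> r0 cE fK fE fB.
have cc : nrm (c - c) <= 2 * r by rewrite subrr nrm0; lra.
have [l hl] := fE c cc cE.
have [K' hK'] := @quotient_bounded f c l [set z | nrm (z - c) <= 2 * r] K hl cc fK.
pose s0 := complex.Re c - r; pose t0 := complex.Im c - r.
have sq (x y : R) : s0 <= x <= s0 + 2 * r -> t0 <= y <= t0 + 2 * r ->
    nrm ((Complex x y : C) - c) <= 2 * r.
  move=> hx hy; apply: le_trans (nrm_le_ReIm _) _.
  have -> : complex.Re (Complex x y - c : C) = x - complex.Re c by case: (c).
  have -> : complex.Im (Complex x y - c : C) = y - complex.Im c by case: (c).
  have h1 : `|x - complex.Re c| <= r by rewrite ler_norml /s0 in hx *; lra.
  have h2 : `|y - complex.Im c| <= r by rewrite ler_norml /t0 in hy *; lra.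
  lra.
suff h (e : R) : 0 < e -> nrm (f c) <= 2 * B + e.
  by apply/ler_addgt0Pr => e; apply: h.
move=> e0; have r20 : 0 < 2 * r by lra.
have e4 : 0 < 4 * e by lra.
have [n hn] : exists n, nrm (square_sum n (fun z => (z - c)^-1 *: (f z - f c))
    (Complex s0 t0) (rc (2 * r))) <= 4 * e.
  have [n0 hn0] : exists n0, forall n, (n0 <= n)%N ->
      nrm (square_sum n (fun z => (z - c)^-1 *: (f z - f c)) (Complex s0 t0)
        (rc (2 * r))) <= 4 * e.
    (* The centre is one more exceptional point: the quotient is only known to
       be bounded there. *)
    apply: (@goursat _ X _ (c :: E) s0 t0 (2 * r) K' r20 _ _ (4 * e) e4).
      by move=> x y hx hy; apply: hK'; apply: sq.
    move=> x y hx hy; rewrite inE negb_or => /andP[zc zE].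
    have [m hm] := fE _ (sq _ _ hx hy) zE.
    exact: quotient_cder hm.
  by exists n0; apply: hn0.
move: hn.
have -> : (fun z => (z - c)^-1 *: (f z - f c)) =
    (fun z => (z - c)^-1 *: f z - (z - c)^-1 *: f c).
  by apply/funext => z; rewrite scalerBr.
rewrite square_sumB square_sumZl => hn.
have h1 : nrm (square_sum n (fun z => (z - c)^-1 *: f z) (Complex s0 t0) (rc (2 * r)))
    <= 4 * (2 * r) * (B / r).
  apply: square_sum_le => [|x y hx hy hb]; first exact: ltW.
  have hr : r <= nrm ((Complex x y : C) - c).
    have := Re_le_nrm (Complex x y - c : C); have := Im_le_nrm (Complex x y - c : C).
    have -> : complex.Re (Complex x y - c : C) = x - complex.Re c by case: (c).
    have -> : complex.Im (Complex x y - c : C) = y - complex.Im c by case: (c).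
    have a1 := ler_norm (x - complex.Re c); have a2 := ler_norm (- (x - complex.Re c)).
    have a3 := ler_norm (y - complex.Im c); have a4 := ler_norm (- (y - complex.Im c)).
    rewrite normrN in a2; rewrite normrN in a4.
    by rewrite /s0 /t0 in hb * => ? ?; case: hb => ?; lra.
  rewrite nrmZ nrmV mulrC; apply: ler_pM; rewrite ?nrm_ge0 ?invr_ge0 ?nrm_ge0 //.
    by apply: fB; rewrite hr sq.
  by rewrite lef_pV2 ?posrE // (lt_le_trans r0).
have h2 := le_trans (winding_ge n c r0) (le_trans (ler_norm _) (Im_le_nrm _)).
have h3 := nrm_le_add (square_sum n (fun z => (z - c)^-1) (Complex s0 t0) (rc (2 * r)) *: f c)
  (square_sum n (fun z => (z - c)^-1 *: f z) (Complex s0 t0) (rc (2 * r))).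
rewrite nrm_distC nrmZ in h3.
have h4 : 4 * (2 * r) * (B / r) = 8 * B by field; rewrite gt_eqF.
have fc0 := nrm_ge0 (f c).
have h5 : 4 * nrm (f c) <= nrm (square_sum n (fun z => (z - c)^-1) (Complex s0 t0) (rc (2 * r))) * nrm (f c).
  by rewrite ler_wpM2r.
lra.
Qed.

Lemma seq_away (E : seq C) : 0 \notin E ->
  exists2 d : R, 0 < d & forall z, z \in E -> d <= nrm z.
Proof.
elim: E => [|a E IH]; first by exists 1.
rewrite inE negb_or => /andP[a0 /IH[d d0 hd]].
exists (Num.min d (nrm a)); first by rewrite lt_min d0 nrm_gt0 eq_sym.
by move=> z; rewrite inE ge_min => /orP[/eqP ->|/hd ->//]; rewrite lexx orbT.
Qed.

(** The slope h z = (f z - f 0) / z is bounded by center_estimate, and so is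
    its own slope (h z - h w) / (z - w) for w different from 0. Letting w tend
    to 0 turns the second bound into the second order estimate. Points of E
    are removable singularities, at which f is only known to be bounded. *)
Lemma taylor_1d (f : C -> X) (E : seq C) (r K : R) (l : X) : 0 < r -> 0 \notin E ->
  (forall z : C, nrm z <= r -> nrm (f z) <= K) ->
  (forall z : C, nrm z <= r -> z \notin E -> exists m, cder f z m) ->
  cder f 0 l ->
  nrm l <= 32 * K / r /\
  forall z : C, nrm z <= r / 16 -> z \notin E ->
    nrm (f z - f 0 - z *: l) <= 768 * K / r ^+ 2 * nrm z ^+ 2.
Proof.
move=> r0 E0 fK fE fl.
have K0 : 0 <= K by apply: le_trans (fK 0 _); rewrite ?nrm_ge0 ?nrm0 ?ltW.
(* The slope at 0 is completed by its limit l. *)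
pose h (z : C) := if z == 0 then l else (z - 0)^-1 *: (f z - f 0).
have hE (z : C) : z != 0 -> h z = (z - 0)^-1 *: (f z - f 0) by rewrite /h => /negPf ->.
pose S := [set z : C | nrm z <= r].
have [K1 hK1] : exists K1, forall z, S z -> nrm (h z) <= K1.
  have S0 : S 0 by rewrite /S /= nrm0 ltW.
  have [K1 hK1] := quotient_bounded fl S0 fK.
  exists (Num.max K1 (nrm l)) => z /hK1; rewrite /h le_max.
  by case: eqP => [_ _|_ ->//]; rewrite lexx orbT.
have hd (z : C) : nrm z <= r -> z != 0 -> z \notin E -> exists m, cder h z m.
  move=> zr z0 zE; have [m hm] := fE z zr zE; have [m' hm'] := quotient_cder z0 hm.
  have zp : 0 < nrm z by rewrite nrm_gt0.
  exists m'; apply: (eq_cder_near zp _ hm') => y hy; rewrite hE //; apply: contraTneq hy => ->.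
  by rewrite sub0r nrmN ltxx.
have far (c z : C) : nrm c <= r / 16 -> r / 4 <= nrm (z - c) <= 2 * (r / 4) ->
    r / 8 <= nrm z /\ nrm z <= r.
  by move=> hc hz; have := nrmB z c; have := nrm_le_add z c; lra.
have inr (c z : C) : nrm c <= r / 16 -> nrm (z - c) <= 2 * (r / 4) -> nrm z <= r.
  by move=> hc hz; have := nrm_le_add z c; lra.
have hfar (z : C) : r / 8 <= nrm z -> nrm z <= r -> nrm (h z) <= 16 * K / r.
  move=> z8 zr; have z0 : z != 0 by rewrite -nrm_gt0; lra.
  rewrite hE // subr0 nrmZ nrmV mulrC ler_pdivrMr ?nrm_gt0 //.
  have := nrmB (f z) (f 0); have := fK z zr; have f0K := fK 0.
  have {}f0K : nrm (f 0) <= K by apply: f0K; rewrite nrm0 ltW.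
  have : 2 * K <= 16 * K / r * nrm z.
    rewrite (_ : 2 * K = 16 * K / r * (r / 8)); last by field; rewrite gt_eqF.
    by rewrite ler_wpM2l //; apply: divr_ge0; lra.
  lra.
(* Circles of radius r / 4 to r / 2 about c keep the distance r / 8 from 0,
   where h is controlled by the bound of f. *)
have step1 (c : C) : nrm c <= r / 16 -> c != 0 -> c \notin E -> nrm (h c) <= 2 * (16 * K / r).
  move=> cr c0 cE; apply: (@center_estimate h (0 :: E) c (r / 4) K1).
  - lra.
  - by rewrite inE negb_or c0.
  - by move=> z hz; apply: hK1; apply: inr hz.
  - by move=> z hz; rewrite inE negb_or => /andP[z0 zE]; apply: hd => //; apply: inr hz.
  by move=> z hz; have [h1 h2] := far _ _ cr hz; apply: hfar.
have step2 (c w : C) : nrm c <= r / 16 -> c != 0 -> c \notin E ->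
    nrm w <= r / 16 -> w != 0 -> w \notin E ->
    nrm (h c - h w) <= 768 * K / r ^+ 2 * nrm (c - w).
  move=> cr c0 cE wr w0 wE.
  have [->|cw] := eqVneq c w; first by rewrite !subrr !nrm0 mulr0.
  have wr' : nrm w <= r by lra.
  have [m hm] := hd w wr' w0 wE.
  have [K2 hK2] := @quotient_bounded h w m S K1 hm wr' hK1.
  have G : nrm ((c - w)^-1 *: (h c - h w)) <= 2 * (384 * K / r ^+ 2).
    apply: (@center_estimate (fun z => (z - w)^-1 *: (h z - h w)) (w :: 0 :: E) c (r / 4) K2).
    - lra.
    - by rewrite !inE !negb_or cw c0.
    - by move=> z hz; apply: hK2; apply: inr hz.
    - move=> z hz; rewrite !inE !negb_or => /and3P[zw z0 zE].
      have [m' hm'] := hd z (inr _ _ cr hz) z0 zE; exact: quotient_cder hm'.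
    move=> z hz; have [h1 h2] := far _ _ cr hz.
    have zw : r / 8 <= nrm (z - w).
      by have := nrm_le_add z w; have := nrm_le_add z c; have := nrmB z c; lra.
    have zw0 : 0 < nrm (z - w) by lra.
    rewrite nrmZ nrmV mulrC ler_pdivrMr //.
    have := nrmB (h z) (h w); have := hfar z h1 h2; have := step1 w wr w0 wE.
    have : 48 * K / r <= 384 * K / r ^+ 2 * nrm (z - w).
      rewrite (_ : 48 * K / r = 384 * K / r ^+ 2 * (r / 8)); last by field; rewrite gt_eqF.
      by rewrite ler_wpM2l //; apply: divr_ge0; rewrite ?exprn_ge0; lra.
    lra.
  have cw0 : 0 < nrm (c - w) by rewrite nrm_gt0 subr_eq0.
  rewrite nrmZ nrmV mulrC ler_pdivrMr // in G.
  by apply: le_trans G _; rewrite le_eqVlt; apply/orP; left; apply/eqP; field; rewrite gt_eqF.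
have [d1 d10 hd1] := seq_away E0.
(* Real points w tending to 0 outside E. *)
have lim0 (e : R) : 0 < e -> exists w : C, [/\ nrm w <= r / 16, w != 0, w \notin E, nrm w <= e
    & nrm (h w - l) <= e].
  move=> e0; have [d2 d20 hd2] := fl e e0.
  pose s := Num.min (Num.min d1 d2) (Num.min (r / 16) e) / 2.
  have s0 : 0 < s by rewrite divr_gt0 // !lt_min d10 d20 e0 /=; lra.
  have hs : s * 2 <= Num.min (Num.min d1 d2) (Num.min (r / 16) e) by rewrite /s divfK.
  move: hs; rewrite !le_min => /andP[/andP[s1 s2] /andP[s3 s4]].
  have ns : nrm (rc s) = s by rewrite nrm_rc gtr0_norm.
  have w0 : rc s != 0 by rewrite rc_eq0 gt_eqF.
  exists (rc s); split=> //; rewrite ?ns; try lra.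
    by apply/negP => /hd1; rewrite ns; lra.
  rewrite hE // subr0.
  have -> : (rc s)^-1 *: (f (rc s) - f 0) - l = (rc s)^-1 *: (f (rc s) - f 0 - (rc s - 0) *: l).
    by rewrite subr0 [RHS]scalerBr scalerA mulVf // scale1r.
  rewrite nrmZ nrmV ns mulrC ler_pdivrMr //.
  by have := hd2 (rc s); rewrite subr0 ns; apply; lra.
split.
  apply/ler_addgt0Pr => e e0; have [w [w1 w2 w3 w4 w5]] := lim0 e e0.
  have := step1 w w1 w2 w3; have := nrm_le_add l (h w); rewrite nrm_distC.
  by rewrite (_ : 32 * K / r = 2 * (16 * K / r)); [lra|field; rewrite gt_eqF].
move=> z zr zE.
have [->|z0] := eqVneq z 0; first by rewrite scale0r subrr subr0 !nrm0 expr0n mulr0.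
have -> : f z - f 0 - z *: l = z *: (h z - l).
  by rewrite hE // subr0 scalerBr scalerA divff // scale1r.
rewrite nrmZ mulrC expr2 mulrA ler_wpM2r ?nrm_ge0 //.
set D := 768 * K / r ^+ 2.
have D0 : 0 <= D by apply: divr_ge0; rewrite ?exprn_ge0; lra.
apply/ler_addgt0Pr => e e0.
have e'0 : 0 < e / (D + 1) by rewrite divr_gt0 //; lra.
have [w [w1 w2 w3 w4 w5]] := lim0 _ e'0.
have := step2 z w zr z0 zE w1 w2 w3; have := nrm_dist_add (h w) (h z) l; rewrite -/D.
have : D * nrm (z - w) <= D * nrm z + D * (e / (D + 1)).
  by rewrite -mulrDr ler_wpM2l // (le_trans (nrmB _ _)) // lerD2l.
have : D * (e / (D + 1)) + e / (D + 1) = e by field; lra.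
lra.
Qed.

End CenterEstimate.

(** * Derivatives and Taylor estimates in several variables *)

Section RealNormLimits.
Variable R : realType.
Local Notation C := (cplx R).

Definition seq_lim (X : normedModType C) (u : nat -> X) (l : X) :=
  forall e : R, 0 < e -> exists n0, forall n, (n0 <= n)%N -> nrm (u n - l) <= e.

Definition seq_complete (X : normedModType C) :=
  forall u : nat -> X,
    (forall e : R, 0 < e -> exists n0, forall n m, (n0 <= n)%N -> (n0 <= m)%N ->
       nrm (u n - u m) <= e) ->
    exists l, seq_lim u l.

Section Lim.
Variable X : normedModType C.
Implicit Types (u v : nat -> X) (l m : X).

Lemma seq_lim_cst l : seq_lim (fun=> l) l.
Proof. by move=> e e0; exists 0 => n _; rewrite subrr nrm0 ltW. Qed.

Lemma seq_limD u v l m : seq_lim u l -> seq_lim v m ->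
  seq_lim (fun n => u n + v n) (l + m).
Proof.
move=> hu hv e e0; have e2 : 0 < e / 2 by lra.
have [n1 h1] := hu _ e2; have [n2 h2] := hv _ e2.
exists (maxn n1 n2) => n; rewrite geq_max => /andP[/h1 {}h1 /h2 {}h2].
by rewrite opprD addrACA (le_trans (nrmD _ _)) //; lra.
Qed.

Lemma seq_limN u l : seq_lim u l -> seq_lim (fun n => - u n) (- l).
Proof.
move=> hu e e0; have [n1 h1] := hu _ e0.
by exists n1 => n /h1; rewrite -opprD nrmN.
Qed.

Lemma seq_limZ (a : C) u l : seq_lim u l -> seq_lim (fun n => a *: u n) (a *: l).
Proof.
move=> hu e e0; have a0 := nrm_ge0 a.
have e2 : 0 < e / (nrm a + 1) by rewrite divr_gt0 //; lra.
have [n1 h1] := hu _ e2; exists n1 => n /h1 h; rewrite -scalerBr nrmZ.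
rewrite ler_pdivlMr in h; last lra.
by have := nrm_ge0 (u n - l); nra.
Qed.

Lemma seq_lim_sum (I : Type) (r : seq I) (u : I -> nat -> X) (l : I -> X) :
  (forall i, seq_lim (u i) (l i)) ->
  seq_lim (fun n => \sum_(i <- r) u i n) (\sum_(i <- r) l i).
Proof.
move=> h; elim: r => [|i r IH].
  rewrite big_nil (_ : (fun=> _) = fun=> 0); first exact: seq_lim_cst.
  by apply/funext => n; rewrite big_nil.
rewrite big_cons (_ : (fun=> _) = fun n => u i n + \sum_(j <- r) u j n).
  exact: seq_limD.
by apply/funext => n; rewrite big_cons.
Qed.

Lemma seq_lim_nrm_le u l (a : R) : seq_lim u l ->
  (exists n0, forall n, (n0 <= n)%N -> nrm (u n) <= a) -> nrm l <= a.
Proof.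
move=> hu [n1 h1]; apply/ler_addgt0Pr => e e0; have [n2 h2] := hu _ e0.
have := h1 _ (leq_maxl n1 n2); have := h2 _ (leq_maxr n1 n2).
by have := nrm_le_add l (u (maxn n1 n2)); rewrite nrm_distC; lra.
Qed.

Lemma seq_limP u l : seq_lim u l <-> u @ \oo --> l.
Proof.
split=> [hu|/cvgrPdist_lt hu e e0].
  apply/cvgrPdist_lt => e e0; have ee := ge0_rc (ltW e0).
  have e1 : 0 < complex.Re e / 2 by rewrite divr_gt0 // -ltr_rc -ee.
  have [n0 h] := hu _ e1; exists n0 => // n /= /h.
  by rewrite ee nrmE ltr_rc nrm_distC; lra.
have [n0 _ h] : \forall n \near \oo, `|l - u n| < rc e by apply: hu; rewrite ltr_rc.
by exists n0 => n /h /=; rewrite nrmE ltr_rc nrm_distC => /ltW.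
Qed.

End Lim.

(** The Archimedean property in the form in which small step sizes c / (n + 1)
    use it. *)
Lemma seq_lim_inv (c : R) : 0 <= c -> forall e : R, 0 < e ->
  exists n0, forall n, (n0 <= n)%N -> c / n.+1%:R <= e.
Proof.
move=> c0 e e0; exists (Num.bound (c / e)) => n hn.
have h : c / e < n.+1%:R.
  have h0 : 0 <= c / e by rewrite divr_ge0 // ltW.
  by apply: lt_le_trans (archi_boundP h0) _; rewrite ler_nat; apply: leqW.
by rewrite ler_pdivrMr ?ltr0Sn // mulrC -ler_pdivrMr // ltW.
Qed.

Lemma complete_seq_complete (X : completeNormedModType C) : seq_complete X.
Proof.
move=> u hu; suff : cvg (u @ \oo).
  by move=> /cvg_ex[l hl]; exists l; apply/seq_limP.
apply: cauchy_cvg; apply/cauchy_ballP => e e0; have ee := ge0_rc (ltW e0).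
have e1 : 0 < complex.Re e / 2 by rewrite divr_gt0 // -ltr_rc -ee.
have [n0 hn0] := hu _ e1.
exists ([set u n | n in [set n | (n0 <= n)%N]], [set u n | n in [set n | (n0 <= n)%N]]) => /=.
  by split; exists n0 => // n /= hn; exists n.
move=> [x y] /= [[n hn <-] [k hk <-]]; rewrite -ball_normE /= ee nrmE ltr_rc.
by have := hn0 n k hn hk; lra.
Qed.

Lemma real_cauchy (u : nat -> R) :
  (forall e : R, 0 < e -> exists n0, forall n m, (n0 <= n)%N -> (n0 <= m)%N ->
       `|u n - u m| <= e) ->
  exists l : R, forall e : R, 0 < e -> exists n0, forall n, (n0 <= n)%N -> `|u n - l| <= e.
Proof.
move=> hu; have : cvg (u @ \oo).
  apply: cauchy_cvg; apply/cauchy_ballP => e e0.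
  have e1 : 0 < e / 2 by lra.
  have [n0 hn0] := hu _ e1.
  exists ([set u n | n in [set n | (n0 <= n)%N]], [set u n | n in [set n | (n0 <= n)%N]]) => /=.
    by split; exists n0 => // n /= hn; exists n.
  move=> [x y] /= [[n hn <-] [k hk <-]]; rewrite -ball_normE /=.
  by have := hn0 n k hn hk; lra.
move=> /cvg_ex[l /cvgrPdist_lt hl]; exists l => e e0.
have [n0 _ h] := hl e e0; exists n0 => n /h /=; rewrite distrC; exact: ltW.
Qed.

Lemma cplx_seq_complete : seq_complete C.
Proof.
move=> u hu.
have [a ha] : exists l : R, forall e : R, 0 < e ->
    exists n0, forall n, (n0 <= n)%N -> `|complex.Re (u n) - l| <= e.
  apply: real_cauchy => e e0; have [n0 h] := hu e e0; exists n0 => n m hn hm.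
  apply: le_trans (h n m hn hm); apply: le_trans (Re_le_nrm _).
  by case: (u n) (u m) => [? ?] [].
have [b hb] : exists l : R, forall e : R, 0 < e ->
    exists n0, forall n, (n0 <= n)%N -> `|complex.Im (u n) - l| <= e.
  apply: real_cauchy => e e0; have [n0 h] := hu e e0; exists n0 => n m hn hm.
  apply: le_trans (h n m hn hm); apply: le_trans (Im_le_nrm _).
  by case: (u n) (u m) => [? ?] [].
exists (Complex a b) => e e0; have e2 : 0 < e / 2 by lra.
have [n1 h1] := ha _ e2; have [n2 h2] := hb _ e2.
exists (maxn n1 n2) => n; rewrite geq_max => /andP[/h1 {}h1 /h2 {}h2].
apply: le_trans (nrm_le_ReIm _) _.
by case: (u n) h1 h2 => x y /=; lra.
Qed.

End RealNormLimits.

Lemma zmod_diff4 (V : zmodType) (x y x0 y0 u u0 : V) :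
  x - x0 - (y - y0) = (x - u - (y - u)) - (x0 - u0 - (y0 - u0)).
Proof.
have h (a b c : V) : a - c - (b - c) = a - b by rewrite opprB subrKA.
by rewrite !h !opprD !opprK !addrA; congr (_ + _); rewrite addrAC.
Qed.

Section SeveralVariables.
Variables (R : realType) (n : nat).
Local Notation C := (cplx R).
Local Notation Cn := 'rV[C]_n.

Lemma coord_le_nrm (h : Cn) i : nrm (h 0 i) <= nrm h.
Proof.
rewrite -ler_rc -!nrmE; have -> : `|h| = mx_norm h by [].
rewrite mx_normE -[leLHS]nngE num_le.
exact: (le_bigmax _ (fun ij : 'I_1 * 'I_n => `|h ij.1 ij.2|%:nng) (0, i)).
Qed.

Lemma nrm_delta i : nrm (delta_mx 0 i : Cn) <= 1.
Proof.
rewrite -ler_rc -nrmE /=.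
have -> : `|delta_mx 0 i : Cn| = mx_norm (delta_mx 0 i : Cn) by [].
have [h|h] := eqVneq (mx_norm (delta_mx 0 i : Cn)) 0; first by rewrite h ler01.
have [[a b] ->] := mx_norm_neq0 h; rewrite mxE.
by case: (_ && _); rewrite ?normr1 ?normr0 ?ler01 ?lexx.
Qed.

Section Linear.
Variable X : normedModType C.
Implicit Types (f g : Cn -> X) (v : 'I_n -> X).

Definition lmap v (h : Cn) : X := \sum_i h 0 i *: v i.

Lemma lmap_is_linear v : linear (lmap v).
Proof.
move=> a x y; rewrite /lmap scaler_sumr -big_split /=; apply: eq_bigr => i _.
by rewrite !mxE scalerDl scalerA.
Qed.

HB.instance Definition _ v := GRing.isLinear.Build C Cn X _ (lmap v) (lmap_is_linear v).

Lemma lmapZ v (a : C) (h : Cn) : lmap v (a *: h) = a *: lmap v h.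
Proof. exact: linearZ. Qed.

Lemma lmapB v (h k : Cn) : lmap v (h - k) = lmap v h - lmap v k.
Proof. exact: linearB. Qed.

Lemma lmap0 v : lmap v 0 = 0.
Proof. exact: linear0. Qed.

Lemma lmap_delta v i : lmap v (delta_mx 0 i) = v i.
Proof.
rewrite /lmap (bigD1 i) //= big1 ?addr0 => [|j ji]; rewrite !mxE eqxx /=.
  by rewrite eqxx scale1r.
by rewrite (negPf ji) scale0r.
Qed.

Lemma linear_lmap (L : {linear Cn -> X}) h : L h = lmap (fun i => L (delta_mx 0 i)) h.
Proof.
rewrite {1}(matrix_sum_delta h) big_ord1 linear_sum /lmap; apply: eq_bigr => i _.
by rewrite linearZ.
Qed.

Lemma lmap_le v h : nrm (lmap v h) <= (\sum_i nrm (v i)) * nrm h.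
Proof.
apply: le_trans (nrm_sum _ _ _) _; rewrite mulr_suml; apply: ler_sum => i _.
by rewrite nrmZ mulrC ler_wpM2l ?nrm_ge0 ?coord_le_nrm.
Qed.

(** Differentiability in the form that the estimates use; the differential is
    recorded by its values v on the coordinate vectors. *)
Definition fder f (y : Cn) v := forall e : R, 0 < e -> exists2 d : R, 0 < d &
  forall h : Cn, nrm h < d -> nrm (f (y + h) - f y - lmap v h) <= e * nrm h.

Lemma differentiable_fder f y : differentiable f y ->
  fder f y (fun i => 'd f y (delta_mx 0 i)).
Proof.
move=> df e e0.
have /eqaddoP/(_ (rc e)) := diff_locally df; rewrite ltr_rc => /(_ e0).
move=> /nbhs_nrm[d d0 hd]; exists d => // h hd'.
have := hd h; rewrite subr0 => /(_ hd'); rewrite !nrmE -rcM ler_rc /=.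
rewrite -linear_lmap; congr (nrm _ <= _).
by rewrite !fctE /= opprD addrA [h + y]addrC.
Qed.

Lemma lmap_continuous v : continuous (lmap v).
Proof.
move=> x; apply/continuous_nrm => e e0.
pose S := \sum_i nrm (v i).
have S0 : 0 <= S by apply: sumr_ge0 => i _; exact: nrm_ge0.
exists (e / (S + 1)); first by rewrite divr_gt0 //; lra.
move=> y hy; rewrite -lmapB; apply: le_lt_trans (lmap_le _ _) _; rewrite -/S.
rewrite ltr_pdivlMr in hy; last lra.
by have := nrm_ge0 (y - x); nra.
Qed.

Lemma fder_differentiable f y v : fder f y v -> differentiable f y.
Proof.
move=> hf.
pose L : {linear Cn -> X} := lmap v.
have hl : f \o shift y = cst (f y) + L +o_ (0 : Cn) id.
  apply/eqaddoP => e e0; have ee := ge0_rc (ltW e0).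
  have e1 : 0 < complex.Re e by rewrite -ltr_rc -ee.
  have [d d0 hd] := hf _ e1; apply/nbhs_nrm; exists d => // h; rewrite subr0 => /hd.
  rewrite ee !nrmE -rcM ler_rc; congr (nrm _ <= _).
  by rewrite !fctE /= opprD addrA [h + y]addrC.
apply/diff_locallyP.
by rewrite (diff_unique (@lmap_continuous v) hl); split=> //; exact: lmap_continuous.
Qed.

Lemma fder_line f y v (h : Cn) : fder f y v -> cder (fun z => f (y + z *: h)) 0 (lmap v h).
Proof.
move=> hf e e0; have h0 := nrm_ge0 h.
have e1 : 0 < e / (nrm h + 1) by rewrite divr_gt0 //; lra.
have [d d0 hd] := hf _ e1; exists (d / (nrm h + 1)); first by rewrite divr_gt0 //; lra.
move=> z; rewrite subr0 => hz; rewrite scale0r addr0 -lmapZ.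
rewrite ltr_pdivlMr in hz; last lra.
have z0 := nrm_ge0 z.
have hzd : nrm (z *: h) < d by rewrite nrmZ; nra.
apply: le_trans (hd _ hzd) _; rewrite nrmZ mulrAC ler_pdivrMr; last lra.
have : 0 <= e * nrm z by rewrite mulr_ge0 // ltW.
nra.
Qed.

Lemma fder_line_at f y v (h : Cn) (z : C) : fder f (y + z *: h) v ->
  cder (fun z => f (y + z *: h)) z (lmap v h).
Proof.
move=> /(fder_line h) hf e e0; have [d d0 hd] := hf e e0; exists d => // w hw.
have := hd (w - z); rewrite subr0 => /(_ hw).
by rewrite scale0r addr0 -!addrA -scalerDl [z + _]addrC subrK.
Qed.

Lemma fderB f g y v w : fder f y v -> fder g y w ->
  fder (fun x => f x - g x) y (fun i => v i - w i).
Proof.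
move=> hf hg e e0; have e2 : 0 < e / 2 by lra.
have [d1 d10 h1] := hf _ e2; have [d2 d20 h2] := hg _ e2.
exists (Num.min d1 d2); first by rewrite lt_min d10.
move=> h; rewrite lt_min => /andP[/h1 {}h1 /h2 {}h2].
have -> : f (y + h) - g (y + h) - (f y - g y) - lmap (fun i => v i - w i) h =
   (f (y + h) - f y - lmap v h) - (g (y + h) - g y - lmap w h).
  have -> : lmap (fun i => v i - w i) h = lmap v h - lmap w h.
    by rewrite /lmap -sumrB; apply: eq_bigr => i _; rewrite scalerBr.
  by rewrite !opprD !opprK !addrA [RHS](ACl (1*4*2*5*3*6)).
have := nrmB (f (y + h) - f y - lmap v h) (g (y + h) - g y - lmap w h); lra.
Qed.

Lemma fderZ (a : C) f y v : fder f y v -> fder (fun x => a *: f x) y (fun i => a *: v i).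
Proof.
move=> hf e e0; have a0 := nrm_ge0 a.
have e1 : 0 < e / (nrm a + 1) by rewrite divr_gt0 //; lra.
have [d d0 hd] := hf _ e1; exists d => // h /hd {}hd.
have -> : a *: f (y + h) - a *: f y - lmap (fun i => a *: v i) h =
   a *: (f (y + h) - f y - lmap v h).
  rewrite !scalerBr; congr (_ - _); rewrite /lmap scaler_sumr.
  by apply: eq_bigr => i _; rewrite !scalerA mulrC.
rewrite nrmZ.
have h1 : nrm (f (y + h) - f y - lmap v h) * (nrm a + 1) <= e * nrm h.
  rewrite -ler_pdivlMr; last lra.
  by rewrite mulrAC.
have := nrm_ge0 (f (y + h) - f y - lmap v h); nra.
Qed.

Lemma fder_shift f (y a : Cn) v : fder f (y + a) v -> fder (fun x => f (x + a)) y v.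
Proof.
move=> hf e e0; have [d d0 hd] := hf e e0; exists d => // h /hd.
by rewrite [y + h + a]addrAC.
Qed.

(** A second order Taylor bound with an explicit constant; unlike mere
    differentiability it passes to pointwise limits. *)
Definition taylor2 f (y : Cn) v (r D : R) := forall h : Cn, nrm h <= r ->
  nrm (f (y + h) - f y - lmap v h) <= D * nrm h ^+ 2.

Lemma taylor2_fder f y v (r D : R) : 0 < r -> taylor2 f y v r D -> fder f y v.
Proof.
move=> r0 hf e e0; pose D' := `|D| + 1.
have D'0 : 0 < D' by rewrite ltr_wpDl.
exists (Num.min r (e / D')); first by rewrite lt_min r0 divr_gt0.
move=> h; rewrite lt_min => /andP[hr he]; apply: le_trans (hf h (ltW hr)) _.
rewrite ltr_pdivlMr // in he; have h0 := nrm_ge0 h; have := ler_norm D.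
rewrite /D' in he; rewrite expr2 => hD.
have : D * nrm h <= e by nra.
nra.
Qed.

(** On the complex line through y and y + h this is taylor_1d. The set of good
    points replaces E: its complement meets each complex line through y in
    finitely many points. *)
Lemma taylor_nd f y v (good : set Cn) (r K : R) : 0 < r -> good y ->
  (forall h : Cn, exists E : seq C, forall z : C, good (y + z *: h) <-> z \notin E) ->
  (forall h : Cn, nrm h <= r -> nrm (f (y + h)) <= K) ->
  (forall h : Cn, nrm h <= r -> good (y + h) -> exists w, fder f (y + h) w) ->
  fder f y v ->
  (forall h, nrm (lmap v h) <= 32 * K / r * nrm h) /\
  (forall h : Cn, nrm h <= r / 16 -> good (y + h) ->
    nrm (f (y + h) - f y - lmap v h) <= 768 * K / r ^+ 2 * nrm h ^+ 2).
Proof.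
move=> r0 gy gE fK fd fv.
have main (h : Cn) : h != 0 -> nrm (lmap v h) <= 32 * K / r * nrm h /\
    (nrm h <= r / 16 -> good (y + h) ->
    nrm (f (y + h) - f y - lmap v h) <= 768 * K / r ^+ 2 * nrm h ^+ 2).
  rewrite -nrm_gt0 => h0; have [E hE] := gE h.
  have rh0 : 0 < r / nrm h by rewrite divr_gt0.
  have zh (z : C) : nrm z <= r / nrm h -> nrm (z *: h) <= r by rewrite nrmZ ler_pdivlMr.
  have [||||h1 h2] := @taylor_1d _ X (fun z => f (y + z *: h)) E (r / nrm h) K (lmap v h) rh0.
  - by apply/hE; rewrite scale0r addr0.
  - by move=> z /zh; exact: fK.
  - move=> z zr zE; have [w hw] := fd _ (zh _ zr) ((hE z).2 zE).
    by eexists; apply: fder_line_at hw.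
  - exact: fder_line.
  split; first by rewrite invfM invrK mulrA in h1.
  move=> hr gh; have := h2 1; rewrite scale1r scale0r addr0 scale1r nrm1.
  have -> : 768 * K / (r / nrm h) ^+ 2 * 1 ^+ 2 = 768 * K / r ^+ 2 * nrm h ^+ 2.
    by field; rewrite !gt_eqF.
  apply; last by apply/hE; rewrite scale1r.
  by rewrite mulrAC ler_pdivlMr // mul1r.
split=> h; have [->|/main[]//] := eqVneq h 0; first by rewrite lmap0 !nrm0 mulr0.
by rewrite addr0 subrr lmap0 subr0 !nrm0 expr0n mulr0.
Qed.

Lemma taylor_nd_all f y v (r K : R) : 0 < r ->
  (forall h : Cn, nrm h <= r -> nrm (f (y + h)) <= K) ->
  (forall h : Cn, nrm h <= r -> exists w, fder f (y + h) w) ->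
  fder f y v ->
  (forall h, nrm (lmap v h) <= 32 * K / r * nrm h) /\
  taylor2 f y v (r / 16) (768 * K / r ^+ 2).
Proof.
move=> r0 fK fd fv.
have [||h1 h2] := @taylor_nd f y v setT r K r0 I _ fK _ fv.
- by move=> h; exists [::].
- by move=> h hr _; apply: fd.
by split=> // h hr; apply: h2.
Qed.

(** Where the maps k j converge and have a common second order bound, their
    differentials converge as well: for h = s e_i the difference of two of
    them is, up to 2 D s^2, a difference of values of maps, so dividing by a
    small fixed s makes the v j i a Cauchy sequence. *)
Lemma weierstrass (k : nat -> Cn -> X) (u : Cn -> X) (v : nat -> 'I_n -> X) y (r D : R) :
  seq_complete X -> 0 < r -> 0 <= D ->
  (forall j, taylor2 (k j) y (v j) r D) ->
  (forall h : Cn, nrm h <= r -> seq_lim (fun j => k j (y + h)) (u (y + h))) ->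
  exists w, taylor2 u y w r D.
Proof.
move=> cX r0 D0 hk hu.
have hu0 : seq_lim (fun j => k j y) (u y).
  by have := hu 0; rewrite addr0 nrm0; apply; exact: ltW.
have /choice[w hw] : forall i, exists w, seq_lim (fun j => v j i) w.
  move=> i; apply: cX => e e0.
  (* The step is small enough for the two Taylor errors, D s^2 each, to be at
     most s e / 8. *)
  pose s := Num.min r (e / (8 * (D + 1))).
  have s0 : 0 < s by rewrite lt_min r0 divr_gt0 //; lra.
  have sr : s <= r by rewrite /s ge_min lexx.
  have sD : D * s <= e / 8.
    have : s <= e / (8 * (D + 1)) by rewrite /s ge_min lexx orbT.
    by rewrite ler_pdivlMr; lra.
  pose h : Cn := rc s *: delta_mx 0 i.
  have hh : nrm h <= s.
    by rewrite nrmZ nrm_rc gtr0_norm //; have := nrm_delta i; nra.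
  have se : 0 < e * s / 16 by rewrite divr_gt0 // mulr_gt0.
  have [n1 h1] := hu h (le_trans hh sr) _ se; have [n2 h2] := hu0 _ se.
  exists (maxn n1 n2) => a b; rewrite !geq_max => /andP[a1 a2] /andP[b1 b2].
  have ka := hk a h (le_trans hh sr); have kb := hk b h (le_trans hh sr).
  have {}a1 := h1 _ a1; have {}a2 := h2 _ a2; have {}b1 := h1 _ b1; have {}b2 := h2 _ b2.
  have lin : nrm (lmap (v a) h - lmap (v b) h) = s * nrm (v a i - v b i).
    by rewrite /h !lmapZ !lmap_delta -scalerBr nrmZ nrm_rc gtr0_norm.
  have D2 : D * nrm h ^+ 2 <= e / 8 * s.
    have : nrm h ^+ 2 <= s ^+ 2 by rewrite !expr2; have := nrm_ge0 h; nra.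
    by move=> /(ler_wpM2l D0) hs; apply: le_trans hs _; rewrite expr2 mulrA ler_wpM2r // ltW.
  have : s * nrm (v a i - v b i) <= s * e.
    rewrite -lin.
    have := nrm_dist_add (k a (y + h) - k a y) (lmap (v a) h) (lmap (v b) h).
    have := nrm_dist_add (k b (y + h) - k b y) (k a (y + h) - k a y) (lmap (v b) h).
    have -> : k a (y + h) - k a y - (k b (y + h) - k b y) =
       (k a (y + h) - u (y + h) - (k b (y + h) - u (y + h))) -
       (k a y - u y - (k b y - u y)).
      exact: zmod_diff4.
    have := nrmB (k a (y + h) - u (y + h) - (k b (y + h) - u (y + h)))
       (k a y - u y - (k b y - u y)).
    have := nrmB (k a (y + h) - u (y + h)) (k b (y + h) - u (y + h)).
    have := nrmB (k a y - u y) (k b y - u y).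
    rewrite [nrm (lmap _ _ - (k _ _ - _))]nrm_distC.
    lra.
  by rewrite ler_pM2l.
exists w => h hr.
apply: (@seq_lim_nrm_le _ _ (fun j => k j (y + h) - k j y - lmap (v j) h)).
  apply: seq_limD; first by apply: seq_limD; [exact: hu|exact: seq_limN].
  apply: seq_limN; rewrite /lmap; apply: seq_lim_sum => i.
  exact: seq_limZ.
by exists 0 => j _; apply: hk.
Qed.

End Linear.
End SeveralVariables.

(** * Holomorphic derivatives and removable singularities *)

(** Arithmetic over the order hypotheses alone: quantified hypotheses and bodies
    of local definitions are irrelevant to it, and norm terms are best treated
    as atoms. *)
Ltac trim_context :=
  repeat match goal with H : forall _, _ |- _ => clear H end;
  repeat match goal with x := _ |- _ => clearbody x end.
Ltac abstract_norms :=
  repeat match goal with H : context [@nrm] |- _ => revert H end;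
  repeat match goal with |- context [@nrm ?R ?X ?x] =>
    generalize (@nrm R X x) end;
  intros.
Ltac qlra := intros; trim_context; first [by abstract_norms; lra | lra].
Ltac qnra := intros; trim_context; first [by abstract_norms; nra | nra].

Section SecondDerivative.
Variables (R : realType) (n : nat).
Local Notation C := (cplx R).
Local Notation Cn := 'rV[C]_n.
Variable X : normedModType C.

Lemma fder_bounded (f : Cn -> X) y v : fder f y v ->
  exists d : R, exists2 K : R, 0 < d &
    forall h : Cn, nrm h < d -> nrm (f (y + h)) <= K.
Proof.
move=> hf; have [d d0 hd] := hf 1 ltr01.
pose S := \sum_i nrm (v i).
exists d, (nrm (f y) + (S + 1) * d) => // h hh.
have h1 := hd _ hh; have h2 := lmap_le v h.
have h3 := nrm_le_add (f (y + h)) (f y); have h4 := nrm_le_add (f (y + h) - f y) (lmap v h).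
have S0 : 0 <= S by apply: sumr_ge0 => i _; exact: nrm_ge0.
have h5 : (S + 1) * nrm h <= (S + 1) * d by rewrite ler_wpM2l ?ltW //; qlra.
rewrite -/S in h2; qlra.
Qed.

(** The difference quotients along e_b tend to the partial derivative, and
    they satisfy a common Taylor bound because they are bounded: by
    taylor_nd_all they differ from a partial derivative, itself bounded, by at
    most D s. So weierstrass applies. *)
Lemma dir_derivative_fder (f : Cn -> X) (v : Cn -> 'I_n -> X) (U : set Cn) y b :
  seq_complete X -> open U -> U y -> (forall x, U x -> fder f x (v x)) ->
  exists w, fder (fun x => v x b) y w.
Proof.
move=> cX oU Uy hf.
have [r1 r10 hU] := open_nrm oU Uy.
have [r2 [K r20 hK]] := fder_bounded (hf y Uy).
pose r := Num.min r1 r2 / 2.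
have r0 : 0 < r by rewrite divr_gt0 // lt_min r10.
have hr : r * 2 <= Num.min r1 r2 by rewrite divfK.
move: hr; rewrite le_min => /andP[hr1 hr2].
have inU (h : Cn) : nrm h <= r -> U (y + h).
  by move=> hh; apply: hU; rewrite addrAC subrr add0r; qlra.
have inK (h : Cn) : nrm h <= r -> nrm (f (y + h)) <= K by move=> hh; apply: hK; qlra.
have K0 : 0 <= K by apply: le_trans (inK 0 _); rewrite ?nrm_ge0 ?nrm0 ?ltW.
have r02 : 0 < r / 2 by qlra.
have loc (h : Cn) : nrm h <= r / 2 ->
    (forall k : Cn, nrm (lmap (v (y + h)) k) <= 32 * K / (r / 2) * nrm k) /\
    taylor2 f (y + h) (v (y + h)) (r / 2 / 16) (768 * K / (r / 2) ^+ 2).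
  move=> hh; have hk (k : Cn) : nrm k <= r / 2 -> nrm (h + k) <= r.
    by move=> hk; have := nrmD h k; qlra.
  apply: taylor_nd_all => // [k /hk|k /hk|]; rewrite -?addrA.
  - exact: inK.
  - by move=> /inU Uk; eexists; apply: hf.
  by apply: hf; apply: inU; qlra.
pose D := 768 * K / (r / 2) ^+ 2; pose A := 32 * K / (r / 2).
have D0 : 0 <= D by apply: divr_ge0; rewrite ?exprn_ge0; qlra.
have A0 : 0 <= A by apply: divr_ge0; qlra.
pose s (j : nat) := r / 32 / j.+1%:R.
have s0 j : 0 < s j by rewrite /s divr_gt0 ?ltr0Sn //; qlra.
have sr j : s j <= r / 32.
  by rewrite /s ler_pdivrMr ?ltr0Sn // ler_peMr ?ler1n // divr_ge0 ?ltW.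
pose eb : Cn := delta_mx 0 b.
pose k j (x : Cn) := (rc (s j))^-1 *: (f (x + rc (s j) *: eb) - f x).
have nse j : nrm (rc (s j) *: eb) <= s j.
  by rewrite nrmZ nrm_rc gtr0_norm //; have := nrm_delta R b; have := s0 j; rewrite -/eb; qnra.
have rcs j : rc (s j) != 0 by rewrite rc_eq0 gt_eqF.
have kv j (h : Cn) : nrm h <= r / 2 -> nrm (k j (y + h) - v (y + h) b) <= D * s j.
  move=> /loc[_ hT].
  have hs : nrm (rc (s j) *: eb) <= r / 2 / 16 by have := nse j; have := sr j; qlra.
  have := hT _ hs; rewrite lmapZ lmap_delta -/D => hT'.
  have -> : k j (y + h) - v (y + h) b = (rc (s j))^-1 *:
     (f (y + h + rc (s j) *: eb) - f (y + h) - rc (s j) *: v (y + h) b).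
    by rewrite scalerBr scalerA mulVf // scale1r.
  rewrite nrmZ nrmV nrm_rc gtr0_norm // mulrC ler_pdivrMr //.
  apply: le_trans hT' _.
  have -> : D * s j * s j = D * s j ^+ 2 by ring.
  rewrite ler_wpM2l //.
  by rewrite !expr2; have := nse j; have := nrm_ge0 (rc (s j) *: eb); qnra.
pose K1 := A + D * (r / 32).
have vA (h : Cn) : nrm h <= r / 2 -> nrm (v (y + h) b) <= A.
  move=> /loc[hL _]; have := hL (delta_mx 0 b); rewrite lmap_delta -/A.
  by have := nrm_delta R b; qnra.
have kK j (h : Cn) : nrm h <= r / 4 -> nrm (k j (y + h)) <= K1.
  move=> hh; have hh2 : nrm h <= r / 2 by qlra.
  have := nrm_le_add (k j (y + h)) (v (y + h) b).
  have := kv j _ hh2; have := vA _ hh2; have := sr j; rewrite /K1; qnra.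
pose vk j (x : Cn) i := (rc (s j))^-1 *: (v (x + rc (s j) *: eb) i - v x i).
have kd j (h : Cn) : nrm h <= r / 4 -> fder (k j) (y + h) (vk j (y + h)).
  move=> hh; apply: fderZ; apply: fderB; last by apply: hf; apply: inU; qlra.
  apply: fder_shift; rewrite -addrA; apply: hf; apply: inU.
  by have := nrmD h (rc (s j) *: eb); have := nse j; have := sr j; qlra.
have r04 : 0 < r / 4 by qlra.
have kT j : taylor2 (k j) y (vk j y) (r / 4 / 16) (768 * K1 / (r / 4) ^+ 2).
  have [|||_] := @taylor_nd_all R n X (k j) y (vk j y) (r / 4) K1 r04 => //.
  - exact: kK.
  - by move=> h hh; eexists; apply: kd.
  by have := kd j 0; rewrite addr0 nrm0; apply; exact: ltW.
have K10 : 0 <= K1 by rewrite /K1 addr_ge0 // mulr_ge0 //; qlra.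
have [||h hh|w hw] := @weierstrass R n X k (fun x => v x b) _ y _ _ cX _ _ kT.
- qlra.
- by apply: divr_ge0; rewrite ?exprn_ge0; qlra.
- move=> e e0.
  have c0 : 0 <= D * (r / 32) by rewrite mulr_ge0 //; qlra.
  have [j0 hj0] := seq_lim_inv c0 e0; exists j0 => j /hj0; rewrite -mulrA.
  by apply: le_trans; apply: kv; qlra.
by exists w; apply: taylor2_fder hw; qlra.
Qed.

End SecondDerivative.

Section RiemannExtension.
Variables (R : realType) (n : nat).
Local Notation C := (cplx R).
Local Notation Cn := 'rV[C]_n.

Let nadd (x y : Cn) : nrm (x + y) <= nrm x + nrm y.
Proof. exact: nrmD. Qed.
Let ndist (z x y : Cn) : nrm (x - y) <= nrm (x - z) + nrm (z - y).
Proof. exact: nrm_dist_add. Qed.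
Let ndistC (x y : Cn) : nrm (x - y) = nrm (y - x).
Proof. exact: nrm_distC. Qed.
Let nge0 (x : Cn) : 0 <= nrm x.
Proof. exact: nrm_ge0. Qed.
Let cdist (z x y : C) : nrm (x - y) <= nrm (x - z) + nrm (z - y).
Proof. exact: nrm_dist_add. Qed.
Let cdistC (x y : C) : nrm (x - y) = nrm (y - x).
Proof. exact: nrm_distC. Qed.

Lemma poly_zero_seq (P : {poly C}) : P != 0 ->
  exists E : seq C, forall z : C, P.[z] != 0 <-> z \notin E.
Proof.
move=> P0; have [E hE] := closed_field_poly_normal P; exists E => z.
rewrite {1}hE -rootE rootZ ?lead_coef_eq0 // root_prod_XsubC.
by split.
Qed.

Lemma small_real_notin (E : seq C) (e : R) : 0 < e ->
  exists2 s : R, 0 < s < e & rc s \notin E.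
Proof.
move=> e0; have [|d d0 hd] := @seq_away R [seq z <- E | z != 0].
  by rewrite mem_filter eqxx.
pose s := Num.min e d / 2; have s0 : 0 < s by rewrite divr_gt0 // lt_min e0.
have : s * 2 <= Num.min e d by rewrite divfK.
rewrite le_min => /andP[s1 s2]; exists s; first by qlra.
apply/negP => sE; have := hd (rc s); rewrite mem_filter sE rc_eq0 gt_eqF //=.
by rewrite nrm_rc gtr0_norm // => /(_ isT); qlra.
Qed.

(** What the extension theorem needs of the denominator p: on a complex line
    it has finitely many zeros or vanishes identically. *)
Definition poly_on_lines (p : Cn -> C) :=
  forall x h : Cn, exists P : {poly C}, forall z, p (x + z *: h) = P.[z].

Lemma nonzero_dense (p : Cn -> C) (x : Cn) (e : R) : poly_on_lines p ->
  (exists x1, p x1 != 0) -> 0 < e -> exists2 x', nrm (x' - x) < e & p x' != 0.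
Proof.
move=> pl [x1 px1] e0; have [P hP] := pl x (x1 - x).
have P0 : P != 0.
  apply: contraNneq px1 => P0; have := hP 1; rewrite scale1r addrC subrK => ->.
  by rewrite P0 horner0.
have [E hE] := poly_zero_seq P0.
have d0 := nrm_ge0 (x1 - x).
have e1 : 0 < e / (nrm (x1 - x) + 1) by rewrite divr_gt0 //; qlra.
have [s /andP[s0 s1] sE] := small_real_notin E e1.
exists (x + rc s *: (x1 - x)); last by rewrite hP; apply/hE.
rewrite addrAC subrr add0r nrmZ nrm_rc gtr0_norm //.
by rewrite ltr_pdivlMr in s1; qnra.
Qed.

Lemma fderM (f g : Cn -> C) y v w : fder f y v -> fder g y w ->
  exists u, fder (fun x => f x * g x) y u.
Proof.
move=> /fder_differentiable df /fder_differentiable dg.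
by eexists; apply: differentiable_fder; apply: differentiableM.
Qed.

Lemma fderV (f : Cn -> C) y v : f y != 0 -> fder f y v ->
  exists u, fder (fun x => (f x)^-1) y u.
Proof.
move=> f0 /fder_differentiable df.
by eexists; apply: differentiable_fder; apply: differentiableV.
Qed.

(** The quotient phi = f / p satisfies, at every zero-free point, a Taylor
    bound with constants depending on B only, since the zeros of p are finite
    in number on each complex line through that point. Hence phi is Lipschitz
    off the zeros and extends continuously to Phi. To see that Phi is
    differentiable at x0, translate it by small vectors Y j - x0 with p (Y j)
    != 0: the translates converge to Phi and inherit the Taylor bound of phi
    at Y j. *)
Lemma riemann_extension (f p : Cn -> C) (w : Cn) (r B : R) : 0 < r ->
  (forall x : Cn, nrm (x - w) <= r -> exists v, fder f x v) ->
  (forall x : Cn, nrm (x - w) <= r -> exists v, fder p x v) ->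
  poly_on_lines p -> (exists x, p x != 0) ->
  (forall x : Cn, nrm (x - w) <= r -> nrm (f x) <= B * nrm (p x)) ->
  exists2 d : R, 0 < d & exists Phi : Cn -> C, forall x : Cn, nrm (x - w) < d ->
    (exists v, fder Phi x v) /\ f x = Phi x * p x.
Proof.
move=> r0 fd pd pl pn fB.
(* There is a point with p x != 0 in the ball, where B |p x| is nonnegative.
   *)
have B0 : 0 <= B.
  have [x xr px] := nonzero_dense w pl pn r0.
  have px0 : 0 < nrm (p x) by rewrite nrm_gt0.
  rewrite -(pmulr_lge0 _ px0); apply: le_trans (fB x (ltW xr)); exact: nrm_ge0.
pose phi (x : Cn) := f x * (p x)^-1.
have phid (x : Cn) : nrm (x - w) <= r -> p x != 0 -> exists v, fder phi x v.
  move=> xr px; have [v hv] := fd x xr; have [v' hv'] := pd x xr.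
  have [u hu] := fderV px hv'; exact: fderM hv hu.
have phiB (x : Cn) : nrm (x - w) <= r -> nrm (phi x) <= B.
  move=> xr; have [px|px] := eqVneq (p x) 0; first by rewrite /phi px invr0 mulr0 nrm0.
  rewrite /phi nrmM nrmV ler_pdivrMr ?nrm_gt0 //; exact: fB.
pose r1 := r / 2; have r10 : 0 < r1 by rewrite /r1; qlra.
pose A := 32 * B / r1; pose D := 768 * B / r1 ^+ 2.
have A0 : 0 <= A by apply: divr_ge0; qlra.
have D0 : 0 <= D by apply: divr_ge0; rewrite ?exprn_ge0; qlra.
have /choice[l hl] : forall y : Cn, exists v, nrm (y - w) <= r1 -> p y != 0 ->
    (forall h : Cn, nrm (lmap v h) <= A * nrm h) /\
    (forall h : Cn, nrm h <= r1 / 16 -> p (y + h) != 0 ->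
      nrm (phi (y + h) - phi y - lmap v h) <= D * nrm h ^+ 2).
  move=> y; have [yr|yr] := pselect (nrm (y - w) <= r1); last by exists (fun=> 0).
  have [py|py] := pselect (p y != 0); last by exists (fun=> 0).
  have yr' : nrm (y - w) <= r by rewrite /r1 in yr; qlra.
  have [v hv] := phid y yr' py; exists v => _ _.
  have yh (h : Cn) : nrm h <= r1 -> nrm (y + h - w) <= r.
    by move=> hh; have := nadd (y - w) h; rewrite addrAC /r1 in hh yr *; qlra.
  apply: (@taylor_nd R n _ phi y v [set x | p x != 0] r1 B) => //.
  - move=> h; have [P hP] := pl y h.
    have P0 : P != 0.
      apply: contraNneq py => P0; have := hP 0; rewrite scale0r addr0 => ->.
      by rewrite P0 horner0.
    by have [E hE] := poly_zero_seq P0; exists E => z; rewrite /= hP.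
  - by move=> h /yh; exact: phiB.
  by move=> h /yh hh; exact: phid.
pose L := A + D * (r1 / 16).
have L0 : 0 <= L by rewrite /L addr_ge0 // mulr_ge0 //; qlra.
(* The Taylor bound at y, read to first order. *)
have lip (y z : Cn) : nrm (y - w) <= r1 -> p y != 0 -> p z != 0 -> nrm (z - y) <= r1 / 16 ->
    nrm (phi z - phi y) <= L * nrm (z - y).
  move=> yr py pz zy; have [h1 h2] := hl y yr py.
  have := h2 (z - y) zy; rewrite addrC subrK => /(_ pz) h3.
  have := h1 (z - y); have := nrm_le_add (phi z - phi y) (lmap (l y) (z - y)).
  have : D * nrm (z - y) ^+ 2 <= D * (r1 / 16) * nrm (z - y).
    by rewrite expr2 mulrA ler_wpM2r ?nrm_ge0 // ler_wpM2l.
  by rewrite /L; qlra.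
pose r2 := r1 / 64; have r20 : 0 < r2 by rewrite /r2; qlra.
(* Y x j are zero-free points tending to x, uniformly fast in x. *)
have /choice[sq hsq] : forall q : Cn * nat, exists y : Cn, nrm (y - q.1) < r2 / 4 / q.2.+1%:R /\ p y != 0.
  move=> [x j] /=; have e0 : 0 < r2 / 4 / j.+1%:R by rewrite !divr_gt0 ?ltr0Sn.
  by have [y y1 y2] := nonzero_dense x pl pn e0; exists y.
pose Y (x : Cn) j := sq (x, j).
have pY (x : Cn) j : p (Y x j) != 0 by have [] := hsq (x, j).
have YN (x : Cn) j : nrm (Y x j - x) <= r2 / 4.
  have [h _] := hsq (x, j); apply: (le_trans (ltW h)) => /=.
  by rewrite ler_pdivrMr ?ltr0Sn // ler_peMr ?ler1n //; qlra.
have Yl (x : Cn) (e : R) : 0 < e -> exists n0, forall j, (n0 <= j)%N -> nrm (Y x j - x) <= e.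
  have c0 : 0 <= r2 / 4 by qlra.
  move=> /(seq_lim_inv c0)[j0 hj0]; exists j0 => j /hj0; apply: le_trans.
  by have [h _] := hsq (x, j); apply: ltW.
have YLl (x : Cn) (e : R) : 0 < e -> exists n0, forall j, (n0 <= j)%N -> L * nrm (Y x j - x) <= e.
  move=> e0; have e1 : 0 < e / (L + 1) by rewrite divr_gt0 //; qlra.
  have [n0 h] := Yl x _ e1; exists n0 => j /h.
  by rewrite ler_pdivlMr; [have := nge0 (Y x j - x); qnra|qlra].
(* Phi x is the limit of phi (Y x j), characterised by a Lipschitz bound
   against all zero-free points near x. *)
have /choice[Phi hPhi] : forall x : Cn, exists c : C, nrm (x - w) <= r2 ->
    forall z : Cn, p z != 0 -> nrm (z - x) <= r2 -> nrm (phi z - c) <= L * nrm (z - x).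
  move=> x; have [xr|xr] := pselect (nrm (x - w) <= r2); last by exists 0.
  have Yw j : nrm (Y x j - w) <= r1.
    by have := YN x j; have := ndist x (Y x j) w; rewrite /r2 in xr *; qlra.
  have [|c hc] := @cplx_seq_complete R (fun j => phi (Y x j)).
    move=> e e0; have e2 : 0 < e / 2 by qlra.
    have [n0 h] := YLl x _ e2; exists n0 => i j hi hj.
    have d1 := ndist x (Y x i) (Y x j).
    rewrite [nrm (x - _)]ndistC in d1.
    have dL := ler_wpM2l L0 d1; rewrite mulrDr in dL.
    have := h i hi; have := h j hj; have := YN x i; have := YN x j => y1 y2 y3 y4.
    apply: (le_trans (lip (Y x j) (Y x i) (Yw j) (pY x j) (pY x i) _)).
      by rewrite /r2 in y1 y2; qlra.
    qlra.
  exists c => _ z pz zx.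
  apply/ler_addgt0Pr => e e0; have e2 : 0 < e / 2 by qlra.
  have [n0 h0] := YLl x _ e2; have [n1 h1] := hc _ e2.
  have {}h0 := h0 _ (leq_maxl n0 n1); have {}h1 := h1 _ (leq_maxr n0 n1).
  set y := Y x (maxn n0 n1) in h0 h1.
  have {}h1 : nrm (phi y - c) <= e / 2 by exact: h1.
  have d1 := ndist x z y; rewrite [nrm (x - y)]ndistC in d1.
  have dL := ler_wpM2l L0 d1; rewrite mulrDr in dL.
  have yN : nrm (y - x) <= r2 / 4 by exact: YN.
  have zy : nrm (z - y) <= r1 / 16 by rewrite /r2 in zx yN; qlra.
  have h2 : nrm (phi z - phi y) <= L * nrm (z - y) by exact: (lip y z (Yw _) (pY _ _) pz zy).
  have := cdist (phi y) (phi z) c.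
  qlra.
have PhiE (x : Cn) : nrm (x - w) <= r2 -> p x != 0 -> Phi x = phi x.
  move=> xr px; apply/eqP; rewrite eq_sym -subr_eq0 -nrm_eq0 eq_le nrm_ge0 andbT.
  by have := hPhi x xr x px; rewrite subrr nrm0 mulr0; apply; exact: ltW.
have Philip (x x' : Cn) : nrm (x - w) <= r2 -> nrm (x' - w) <= r2 -> nrm (x - x') <= r2 / 2 ->
    nrm (Phi x - Phi x') <= L * nrm (x - x').
  move=> xr xr' xx; apply/ler_addgt0Pr => e e0; have e2 : 0 < e / 2 by qlra.
  have [n0 h0] := YLl x _ e2; have {}h0 := h0 _ (leqnn n0); set y := Y x n0 in h0.
  have yN : nrm (y - x) <= r2 / 4 by exact: YN.
  have d1 := ndist x y x'.
  have dL := ler_wpM2l L0 d1; rewrite mulrDr in dL.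
  have yx : nrm (y - x) <= r2 by qlra.
  have yx' : nrm (y - x') <= r2 by qlra.
  have h1 : nrm (phi y - Phi x) <= L * nrm (y - x) by exact: (hPhi x xr y (pY _ _) yx).
  have h2 : nrm (phi y - Phi x') <= L * nrm (y - x') by exact: (hPhi x' xr' y (pY _ _) yx').
  have := cdist (phi y) (Phi x) (Phi x'); rewrite [nrm (Phi x - phi y)]cdistC.
  qlra.
exists (r2 / 4); first qlra.
exists Phi => x0 x0r; split; last first.
  have x0r' : nrm (x0 - w) <= r2 by qlra.
  have [px|px] := eqVneq (p x0) 0.
    have x0r'' : nrm (x0 - w) <= r by rewrite /r2 /r1 in x0r'; qlra.
    have := fB x0 x0r''; rewrite px nrm0 !mulr0 => h.
    by apply/eqP; rewrite -nrm_eq0 eq_le h nrm_ge0.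
  by rewrite PhiE // /phi divfK.
pose k j (x : Cn) := Phi (x + (Y x0 j - x0)).
(* The bound for phi at Y j is transported to Phi by approximating the end
   point y + h through zero-free points. The factor 4 comes from |z - y| <= 2
   |h|. *)
have kT j : taylor2 (k j) x0 (l (Y x0 j)) (r2 / 4) (4 * D).
  move=> h hh; set y := Y x0 j.
  have -> : k j (x0 + h) = Phi (y + h).
    by rewrite /k -/y; congr Phi; rewrite addrAC [x0 + _]addrC subrK.
  have -> : k j x0 = Phi y by rewrite /k -/y; congr Phi; rewrite addrC subrK.
  have [->|hn] := eqVneq h 0.
    by rewrite addr0 subrr lmap0 subr0 !nrm0 expr0n /= mulr0.
  have h0 : 0 < nrm h by rewrite nrm_gt0.
  have yN : nrm (y - x0) <= r2 / 4 by exact: YN.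
  have d1 := ndist x0 y w.
  have yr1 : nrm (y - w) <= r1 by rewrite /r2 in d1 yN x0r; qlra.
  have yr2 : nrm (y - w) <= r2 by qlra.
  have [l1 l2] := hl y yr1 (pY _ _).
  have yhw : nrm (y + h - w) <= r2.
    have -> : y + h - w = y - w + h by rewrite addrAC.
    by have := nadd (y - w) h; qlra.
  apply: (@seq_lim_nrm_le _ _ (fun i => phi (Y (y + h) i) - phi y - lmap (l y) (Y (y + h) i - y))).
    apply: seq_limD.
      apply: seq_limD; last by rewrite (PhiE y) //; [exact: seq_lim_cst|exact: pY].
      move=> e e0; have [n0 hn0] := YLl (y + h) _ e0; exists n0 => i /hn0.
      apply: le_trans; apply: hPhi => //.
      by have := YN (y + h) i; qlra.
    apply: seq_limN => e e0; have e1 : 0 < e / (A + 1) by rewrite divr_gt0 //; qlra.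
    have [n0 hn0] := Yl (y + h) _ e1; exists n0 => i /hn0 hi.
    rewrite -lmapB -addrA -opprD; apply: le_trans (l1 _) _.
    rewrite ler_pdivlMr in hi; last qlra.
    by have := nge0 (Y (y + h) i - (y + h)); qnra.
  have [n0 hn0] := Yl (y + h) _ h0; exists n0 => i /hn0 hi.
  have hYN := YN (y + h) i; set z := Y (y + h) i in hi hYN *.
  have e1 : z - y = z - (y + h) + h by rewrite opprD addrA subrK.
  have zy : nrm (z - y) <= 2 * nrm h by rewrite e1; have := nadd (z - (y + h)) h; qlra.
  have zy2 : nrm (z - y) <= r1 / 16.
    by rewrite e1; have := nadd (z - (y + h)) h; rewrite /r2 in hYN hh; qlra.
  have := l2 _ zy2; rewrite [y + _]addrC subrK => /(_ (pY _ _)) h3.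
  apply: le_trans h3 _; have -> : 4 * D * nrm h ^+ 2 = D * (4 * nrm h ^+ 2) by ring.
  apply: ler_wpM2l => //.
  by rewrite !expr2; have := nge0 (z - y); qnra.
have [||h hh|v hv] := @weierstrass R n C k Phi _ x0 (r2 / 4) (4 * D) (@cplx_seq_complete R) _ _ kT.
- qlra.
- qlra.
- move=> e e0; have [n0 hn0] := YLl x0 _ e0; exists n0 => j /hn0; apply: le_trans.
  have yN := YN x0 j; rewrite /k.
  have e1 : x0 + h + (Y x0 j - x0) - (x0 + h) = Y x0 j - x0 by rewrite addrAC subrr add0r.
  have d1 := nadd (x0 - w) h.
  have d2 := nadd (x0 - w + h) (Y x0 j - x0).
  rewrite -[in leRHS]e1; apply: Philip.
  + by rewrite [_ - w]addrAC [x0 + h - w]addrAC; qlra.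
  + by rewrite addrAC; qlra.
  by rewrite e1; qlra.
by exists v; apply: taylor2_fder hv; qlra.
Qed.

End RiemannExtension.

(** * Real derivatives, Wirtinger derivatives and change of scale of a Gram matrix *)

Section RealDerivative.
Variable R : realType.
Local Notation C := (cplx R).

Definition rder (X : normedModType C) (g : R -> X) (d : X) :=
  forall e : R, 0 < e -> exists2 r : R, 0 < r & forall s : R, `|s| < r ->
    nrm (g s - g 0 - rc s *: d) <= e * `|s|.

Section Rules.
Variable X : normedModType C.
Implicit Types (f g : R -> X).

Lemma rder_cst (x : X) : rder (fun=> x) 0.
Proof.
by move=> e e0; exists 1 => // s _; rewrite subrr scaler0 subr0 nrm0 mulr_ge0 // ltW.
Qed.

Lemma rder_near f g d (r : R) : 0 < r -> (forall s : R, `|s| < r -> f s = g s) ->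
  rder f d -> rder g d.
Proof.
move=> r0 fg hf e e0; have [r1 r10 h] := hf e e0.
exists (Num.min r r1); first by rewrite lt_min r0.
move=> s; rewrite lt_min => /andP[s1 s2]; rewrite -!fg ?normr0 //; exact: h.
Qed.

Lemma rderD f g d d' : rder f d -> rder g d' -> rder (fun s => f s + g s) (d + d').
Proof.
move=> hf hg e e0; have e2 : 0 < e / 2 by lra.
have [r1 r10 h1] := hf _ e2; have [r2 r20 h2] := hg _ e2.
exists (Num.min r1 r2); first by rewrite lt_min r10.
move=> s; rewrite lt_min => /andP[/h1 {}h1 /h2 {}h2].
have -> : f s + g s - (f 0 + g 0) - rc s *: (d + d') =
   (f s - f 0 - rc s *: d) + (g s - g 0 - rc s *: d').
  by rewrite scalerDr !opprD !addrA [RHS](ACl (1*4*2*5*3*6)).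
have := nrmD (f s - f 0 - rc s *: d) (g s - g 0 - rc s *: d'); lra.
Qed.

Lemma rder_lip f d : rder f d -> exists2 r : R, 0 < r &
  forall s : R, `|s| < r -> nrm (f s - f 0) <= (nrm d + 1) * `|s|.
Proof.
move=> hf; have [r r0 h] := hf 1 ltr01; exists r => // s /h {}h.
have := nrm_le_add (f s - f 0) (rc s *: d); rewrite nrmZ nrm_rc; lra.
Qed.

End Rules.

Lemma rder_bilinear (X Y Z : normedModType C) (B : X -> Y -> Z) (c : R)
    (f : R -> X) (g : R -> Y) df dg :
  0 <= c -> (forall x y, nrm (B x y) <= c * nrm x * nrm y) ->
  (forall x x' y, B (x - x') y = B x y - B x' y) ->
  (forall x y y', B x (y - y') = B x y - B x y') ->
  (forall s x y, B (rc s *: x) y = rc s *: B x y) ->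
  (forall s x y, B x (rc s *: y) = rc s *: B x y) ->
  rder f df -> rder g dg ->
  rder (fun s => B (f s) (g s)) (B df (g 0) + B (f 0) dg).
Proof.
move=> c0 Bc BDl BDr BZl BZr hf hg e e0.
have bd (Z' : normedModType C) (d : Z') (s : R) : nrm (rc s *: d) <= nrm d * `|s|.
  by rewrite nrmZ nrm_rc mulrC.
have [r r0 hr] := first_order_bilinear c0 Bc BDl BDr (@normr_ge0 _ R)
  (nrm_ge0 df) (nrm_ge0 dg) (bd X df) (bd Y dg) hf hg e0.
by exists r => // s /hr; rewrite BZl BZr -scalerDr.
Qed.

Lemma rderZ (X : normedModType C) (f : R -> C) (g : R -> X) df dg :
  rder f df -> rder g dg -> rder (fun s => f s *: g s) (df *: g 0 + f 0 *: dg).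
Proof.
apply: (@rder_bilinear C X X (fun a x => a *: x) 1) => //.
- by move=> x y; rewrite mul1r nrmZ.
- by move=> x x' y; rewrite scalerBl.
- by move=> x y y'; rewrite scalerBr.
- by move=> s x y; rewrite scalerA.
by move=> s x y; rewrite !scalerA mulrC.
Qed.

Lemma rderM (f g : R -> C) df dg :
  rder f df -> rder g dg -> rder (fun s => f s * g s) (df * g 0 + f 0 * dg).
Proof. exact: rderZ. Qed.

Lemma conj_rc (s : R) : (rc s)^* = rc s.
Proof. by apply/CrealP; rewrite realE !lecE /= eqxx /=; exact: le_total. Qed.

Lemma rderV (f : R -> C) df : f 0 != 0 -> rder f df ->
  rder (fun s => (f s)^-1) (- (f 0)^-2 * df).
Proof.
move=> f0 hf e e0.
have [r1 r10 h1] := rder_lip hf.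
pose L := nrm df + 1; have L0 : 0 < L by rewrite /L; have := nrm_ge0 df; lra.
pose a := nrm (f 0); have a0 : 0 < a by rewrite /a nrm_gt0.
have e1 : 0 < e / 2 * (a / 2 * a) by rewrite !mulr_gt0 // divr_gt0.
have [r2 r20 h2] := hf _ e1.
pose r3 := a / 2 / L; have r30 : 0 < r3 by rewrite !divr_gt0.
pose r4 := e / 2 * (a / 2 * a * a) / (L * L).
have r40 : 0 < r4 by rewrite divr_gt0 ?mulr_gt0 // divr_gt0.
exists (Num.min (Num.min r1 r2) (Num.min r3 r4)).
  by rewrite !lt_min r10 r20 r30.
move=> s; rewrite !lt_min => /andP[/andP[s1 s2] /andP[s3 s4]].
have {}h1 := h1 s s1; have {}h2 := h2 s s2; rewrite -/L in h1.
have t0 := normr_ge0 s; set t := `|s| in h1 h2 s3 s4 t0 *.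
have fs : a / 2 <= nrm (f s).
  have := nrm_le_add (f 0) (f s); rewrite nrm_distC -/a.
  rewrite ltr_pdivlMr // in s3; lra.
have fsn : f s != 0 by rewrite -nrm_gt0; lra.
have -> : (f s)^-1 - (f 0)^-1 - rc s *: (- (f 0)^-2 * df) =
   - ((f s - f 0 - rc s * df) / (f s * f 0)) + rc s * (df * (f s - f 0) / (f s * f 0 * f 0)).
  by rewrite scaleC; field; rewrite fsn f0.
have q1 : a / 2 * a <= nrm (f s) * a by apply: ler_wpM2r => //; exact: ltW.
have q2 : a / 2 * a * a <= nrm (f s) * a * a by apply: ler_wpM2r => //; exact: ltW.
have n1 : nrm (- ((f s - f 0 - rc s * df) / (f s * f 0))) <= e / 2 * t.
  rewrite nrmN nrmM nrmV nrmM -/a ler_pdivrMr; last by rewrite mulr_gt0 // nrm_gt0.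
  apply: le_trans h2 _; rewrite mulrAC ler_wpM2l //.
  by rewrite mulr_ge0 // ltW // divr_gt0.
have n2 : nrm (rc s * (df * (f s - f 0) / (f s * f 0 * f 0))) <= e / 2 * t.
  rewrite nrmM nrm_rc -/t [e / 2 * t]mulrC ler_wpM2l //.
  rewrite !nrmM nrmV !nrmM -/a ler_pdivrMr; last by rewrite !mulr_gt0 // nrm_gt0.
  have h5 : nrm df * nrm (f s - f 0) <= L * (L * t).
    by apply: ler_pM; rewrite ?nrm_ge0 // /L; lra.
  apply: le_trans h5 _.
  apply: (@le_trans _ _ (e / 2 * (a / 2 * a * a))); last by rewrite ler_wpM2l // ltW // divr_gt0.
  by rewrite mulrA -ler_pdivlMl ?mulr_gt0 // mulrC ltW.
have := nrmD (- ((f s - f 0 - rc s * df) / (f s * f 0)))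
   (rc s * (df * (f s - f 0) / (f s * f 0 * f 0))).
lra.
Qed.

(** The curvature form has to be differentiated only once more, and the result
    is compared on both sides without being computed: existence is enough. *)
Definition ex_rder (f : R -> C) := exists d, rder f d.

Lemma ex_rder_sum (I : Type) (r : seq I) (F : I -> R -> C) :
  (forall i, ex_rder (F i)) -> ex_rder (fun s => \sum_(i <- r) F i s).
Proof.
move=> h; elim: r => [|i r [d IH]].
  by exists 0; rewrite (_ : (fun=> _) = fun=> 0); [exact: rder_cst|apply/funext => s; rewrite big_nil].
have [d' hd'] := h i; exists (d' + d).
rewrite (_ : (fun=> _) = fun s => F i s + \sum_(j <- r) F j s); first exact: rderD.
by apply/funext => s; rewrite big_cons.
Qed.

Lemma ex_rderM (f g : R -> C) : ex_rder f -> ex_rder g -> ex_rder (fun s => f s * g s).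
Proof. by move=> [d hd] [d' hd']; eexists; apply: rderM hd hd'. Qed.

Lemma ex_rder_prod (I : Type) (r : seq I) (F : I -> R -> C) :
  (forall i, ex_rder (F i)) -> ex_rder (fun s => \prod_(i <- r) F i s).
Proof.
move=> h; elim: r => [|i r IH].
  by exists 0; rewrite (_ : (fun=> _) = fun=> 1); [exact: rder_cst|apply/funext => s; rewrite big_nil].
rewrite (_ : (fun=> _) = fun s => F i s * \prod_(j <- r) F j s); first exact: ex_rderM.
by apply/funext => s; rewrite big_cons.
Qed.

Lemma ex_rder_det n (A : R -> 'M[C]_n) : (forall i j, ex_rder (fun s => A s i j)) ->
  ex_rder (fun s => \det (A s)).
Proof.
move=> h; rewrite /determinant; apply: ex_rder_sum => g; apply: ex_rderM.
  by exists 0; exact: rder_cst.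
exact: ex_rder_prod.
Qed.

(** Through the adjugate formula, whose entries are polynomials in those of
    the matrix. *)
Lemma ex_rder_invmx n (A : R -> 'M[C]_n) (r : R) : 0 < r ->
  (forall s, `|s| < r -> A s \in unitmx) -> (forall i j, ex_rder (fun s => A s i j)) ->
  forall i j, ex_rder (fun s => invmx (A s) i j).
Proof.
move=> r0 Au h i j.
have dA0 : \det (A 0) != 0 by rewrite -unitfE -unitmxE; apply: Au; rewrite normr0.
have [d hd] : ex_rder (fun s => (\det (A s))^-1 * \adj (A s) i j).
  apply: ex_rderM.
    by have [d hd] := ex_rder_det h; eexists; apply: rderV hd.
  rewrite (_ : (fun s => \adj (A s) i j) = fun s => (-1) ^+ (j + i) * \det (row' j (col' i (A s)))).
    apply: ex_rderM; first by exists 0; exact: rder_cst.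
    apply: ex_rder_det => k l.
    by rewrite (_ : (fun s => _) = fun s => A s (lift j k) (lift i l)) //; apply/funext => s; rewrite !mxE.
  by apply/funext => s; rewrite mxE.
exists d; apply: rder_near r0 _ hd => s /Au uA.
by rewrite /invmx uA [in RHS]mxE.
Qed.

Lemma derive1_rder (f : R -> R) (l : R) :
  (forall e : R, 0 < e -> exists2 r : R, 0 < r & forall s : R, `|s| < r ->
     `|f s - f 0 - s * l| <= e * `|s|) -> derive1 f 0 = l.
Proof.
move=> hf; rewrite /derive1; apply: cvg_lim => //.
apply/cvgrPdist_lt => e e0; have e2 : 0 < e / 2 by lra.
have [r r0 h] := hf _ e2.
exists r => //= s; rewrite /ball_ /= sub0r normrN => sr s0.
rewrite addr0 /GRing.scale /= distrC.
have -> : s^-1 * (f s - f 0) - l = s^-1 * (f s - f 0 - s * l).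
  by rewrite [RHS]mulrBr mulrA mulVf // mul1r.
rewrite normrM normfV mulrC ltr_pdivrMr ?normr_gt0 //.
apply: le_lt_trans (h s sr) _; rewrite ltr_pM2r ?normr_gt0 //; lra.
Qed.

Lemma real_deriv_rder n (f : 'rV[C]_n -> C) (v x : 'rV[C]_n) (d : C) :
  rder (fun s => f (x + rc s *: v)) d -> real_deriv f v x = d.
Proof.
move=> hf; rewrite /real_deriv.
have ReB (a b : C) : complex.Re (a - b) = complex.Re a - complex.Re b.
  by case: a b => [? ?] [].
have ImB (a b : C) : complex.Im (a - b) = complex.Im a - complex.Im b.
  by case: a b => [? ?] [].
have ReZ (s : R) (a : C) : complex.Re (rc s *: a) = s * complex.Re a.
  by case: a => p q /=; rewrite mul0r subr0.
have ImZ (s : R) (a : C) : complex.Im (rc s *: a) = s * complex.Im a.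
  by case: a => p q /=; rewrite mul0r addr0.
rewrite (@derive1_rder _ (complex.Re d)); last first.
  move=> e e0; have [r r0 h] := hf e e0; exists r => // s /h; apply: le_trans.
  by rewrite -ReZ -!ReB; exact: Re_le_nrm.
rewrite (@derive1_rder _ (complex.Im d)); first by case: (d).
move=> e e0; have [r r0 h] := hf e e0; exists r => // s /h; apply: le_trans.
by rewrite -ImZ -!ImB; exact: Im_le_nrm.
Qed.

End RealDerivative.

Section Wirtinger.
Variables (R : realType) (n : nat).
Local Notation C := (cplx R).
Local Notation Cn := 'rV[C]_n.

(** First order behaviour of an anti-holomorphic map in the coordinate b: the
    derivative along i e_b is - i times the one along e_b, so that d is the
    derivative with respect to the conjugate of the coordinate. *)
Definition acr (X : normedModType C) (b : 'I_n) (A : Cn -> X) (y : Cn) (d : X) :=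
  rder (fun s => A (y + rc s *: delta_mx 0 b)) d /\
  rder (fun s => A (y + rc s *: ('i *: delta_mx 0 b))) (- 'i *: d).

Lemma conj_rVD (x y : Cn) : conj_rV (x + y) = conj_rV x + conj_rV y.
Proof. by apply/rowP => i; rewrite !mxE rmorphD. Qed.

Lemma conj_rVZ (a : C) (x : Cn) : conj_rV (a *: x) = a^* *: conj_rV x.
Proof. by apply/rowP => i; rewrite !mxE rmorphM. Qed.

Lemma conj_rVK (x : Cn) : conj_rV (conj_rV x) = x.
Proof. by apply/rowP => i; rewrite !mxE conjCK. Qed.

Lemma conj_rV_delta b : conj_rV (delta_mx 0 b : Cn) = delta_mx 0 b.
Proof. by apply/rowP => i; rewrite !mxE; case: (_ && _); rewrite ?conjC1 ?conjC0. Qed.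

Lemma fder_rder (X : normedModType C) (f : Cn -> X) y v (h : Cn) :
  fder f y v -> rder (fun s => f (y + rc s *: h)) (lmap v h).
Proof.
move=> /(fder_line h) hf e e0; have [d d0 hd] := hf e e0; exists d => // s hs.
have := hd (rc s); rewrite subr0 nrm_rc => /(_ hs).
by rewrite rc0.
Qed.

Lemma acr_fder (X : normedModType C) b (f : Cn -> X) y v :
  fder f (conj_rV y) v -> acr b (fun z => f (conj_rV z)) y (v b).
Proof.
move=> hf; split.
  have := fder_rder (delta_mx 0 b) hf; rewrite lmap_delta.
  congr rder; apply/funext => s.
  by rewrite conj_rVD conj_rVZ conj_rc conj_rV_delta.
have := fder_rder (- 'i *: delta_mx 0 b) hf; rewrite lmapZ lmap_delta.
congr rder; apply/funext => s.
by rewrite conj_rVD !conj_rVZ conj_rc conj_rV_delta conjCi.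
Qed.

Lemma acrZ (X : normedModType C) b (m : Cn -> C) (A : Cn -> X) y dm d :
  acr b m y dm -> acr b A y d ->
  acr b (fun z => m z *: A z) y (dm *: A y + m y *: d).
Proof.
move=> [m1 m2] [a1 a2]; split.
  by have := rderZ m1 a1; rewrite rc0 scale0r addr0.
have := rderZ m2 a2; rewrite rc0 scale0r addr0.
by rewrite scalerDr !scalerA scaleC [m y * _]mulrC.
Qed.

Lemma acrV b (m : Cn -> C) y dm : m y != 0 -> acr b m y dm ->
  acr b (fun z => (m z)^-1) y (- (m y)^-2 * dm).
Proof.
have y0 (h : Cn) : y + rc 0 *: h = y by rewrite rc0 scale0r addr0.
move=> my [m1 m2]; split.
  by have := rderV _ m1; rewrite y0; apply.
by have := rderV _ m2; rewrite y0 => /(_ my); rewrite !scaleC mulrCA.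
Qed.

Variables (H : normedModType C) (ip : H -> H -> C).
Hypothesis hip : inner_product ip.

Lemma ip_lin (a : C) f g h : ip (a *: f + g) h = a * ip f h + ip g h.
Proof. by have [h1 _ _] := hip. Qed.

Lemma ip_conj f g : ip g f = (ip f g)^*.
Proof. by have [_ h1 _] := hip. Qed.

Lemma ip_nrm f : ip f f = rc (nrm f ^+ 2).
Proof. by have [_ _ h1] := hip; rewrite h1 nrmE !expr2 rcM. Qed.

Lemma ipDl f g h : ip (f + g) h = ip f h + ip g h.
Proof. by have := ip_lin 1 f g h; rewrite scale1r mul1r. Qed.

Lemma ip0l h : ip 0 h = 0.
Proof. by apply: (@addrI _ (ip 0 h)); rewrite -ipDl !addr0. Qed.

Lemma ipZl a f h : ip (a *: f) h = a * ip f h.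
Proof. by have := ip_lin a f 0 h; rewrite ip0l !addr0. Qed.

Lemma ipNl f h : ip (- f) h = - ip f h.
Proof. by rewrite -scaleN1r ipZl mulN1r. Qed.

Lemma ipBl f g h : ip (f - g) h = ip f h - ip g h.
Proof. by rewrite ipDl ipNl. Qed.

Lemma ipZr a f h : ip h (a *: f) = a^* * ip h f.
Proof. by rewrite ip_conj ipZl rmorphM /= -ip_conj. Qed.

Lemma ipBr f g h : ip h (f - g) = ip h f - ip h g.
Proof. by rewrite ip_conj ipBl rmorphB /= -!ip_conj. Qed.

Lemma ip_suml (I : Type) (r : seq I) (F : I -> H) h :
  ip (\sum_(i <- r) F i) h = \sum_(i <- r) ip (F i) h.
Proof.
by elim: r => [|i r IH]; rewrite ?big_nil ?ip0l // !big_cons ipDl IH.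
Qed.

Lemma ip_sumr (I : Type) (r : seq I) (F : I -> H) h :
  ip h (\sum_(i <- r) F i) = \sum_(i <- r) ip h (F i).
Proof.
by rewrite ip_conj ip_suml rmorph_sum /=; apply: eq_bigr => i _; rewrite -ip_conj.
Qed.

(** The norm of f - (ip f g / |g|^2) g is nonnegative. *)
Lemma cauchy_schwarz f g : nrm (ip f g) <= nrm f * nrm g.
Proof.
have [->|g0] := eqVneq g 0.
  by rewrite ip_conj ip0l conjC0 !nrm0 mulr0.
have ng : 0 < nrm g by rewrite nrm_gt0.
pose c := ip f g / rc (nrm g ^+ 2).
have rg : rc (nrm g ^+ 2) != 0 by rewrite rc_eq0 expf_neq0 // gt_eqF.
have e : ip (f - c *: g) (f - c *: g) = rc (nrm f ^+ 2) - ip f g * (ip f g)^* / rc (nrm g ^+ 2).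
  rewrite ipBl !ipBr !ipZl !ipZr !ip_nrm [ip g f]ip_conj /c rmorphM /= fmorphV /= conj_rc.
  by field.
have nn (z : C) : z * z^* = rc (nrm z ^+ 2).
  by rewrite -normCK nrmE !expr2 rcM.
rewrite nn ip_nrm -rcV -rcM -rcB in e.
have := sqr_ge0 (nrm (f - c *: g)).
have {e} -> : nrm (f - c *: g) ^+ 2 = nrm f ^+ 2 - nrm (ip f g) ^+ 2 / nrm g ^+ 2.
  by have := congr1 (@complex.Re R) e.
rewrite subr_ge0 ler_pdivrMr ?exprn_gt0 // -exprMn => h.
by rewrite -(ler_pXn2r (ltn0Sn 1)) ?nnegrE ?mulr_ge0 ?nrm_ge0.
Qed.

Lemma rder_ip (f g : R -> H) df dg : rder f df -> rder g dg ->
  rder (fun s => ip (f s) (g s)) (ip df (g 0) + ip (f 0) dg).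
Proof.
apply: (@rder_bilinear R H H C ip 1) => //.
- by move=> x y; rewrite mul1r; exact: cauchy_schwarz.
- by move=> x x' y; exact: ipBl.
- by move=> x y y'; exact: ipBr.
- by move=> s x y; rewrite ipZl.
by move=> s x y; rewrite ipZr conj_rc.
Qed.

(** The inner product is conjugate linear on the right, so the second
    anti-holomorphic factor enters holomorphically and only the first one is
    differentiated. *)
Lemma wirtinger_bar_ip b (f : Cn -> C) (A B : Cn -> H) y dA dB (r : R) : 0 < r ->
  (forall s, `|s| < r ->
    f (y + rc s *: delta_mx 0 b) = ip (A (y + rc s *: delta_mx 0 b)) (B (y + rc s *: delta_mx 0 b))) ->
  (forall s, `|s| < r ->
    f (y + rc s *: ('i *: delta_mx 0 b)) =
    ip (A (y + rc s *: ('i *: delta_mx 0 b))) (B (y + rc s *: ('i *: delta_mx 0 b)))) ->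
  acr b A y dA -> acr b B y dB -> wirtinger_bar b f y = ip dA (B y).
Proof.
move=> r0 f1 f2 [A1 A2] [B1 B2].
have y0 (h : Cn) : y + rc 0 *: h = y by rewrite rc0 scale0r addr0.
have d1 := rder_near r0 (fun s hs => esym (f1 s hs)) (rder_ip A1 B1).
have d2 := rder_near r0 (fun s hs => esym (f2 s hs)) (rder_ip A2 B2).
rewrite /wirtinger_bar (real_deriv_rder d1) (real_deriv_rder d2) !y0 !ipZl !ipZr.
rewrite rmorphN /= conjCi opprK mulrDr !mulrA mulrN -expr2 sqrCi opprK mul1r mulN1r.
by field.
Qed.

(** With W = (ip (dg j) (g i)), the connection matrices are N^-1 W and, since
    N' = m conj(m) N, N^-1 W + (dm / m) 1. The additional term satisfies acr
    in the direction a, and the holomorphic Wirtinger derivative of such a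
    function vanishes because 1 + i i = 0. All identities hold on the slice S
    only, which is preserved by the directions a and b. *)
Lemma wirtinger_gauge t (S : set Cn) (x : Cn) (a b : 'I_n) (N N' : Cn -> 'M[C]_t)
    (g dg : 'I_t -> Cn -> H) (m dm : Cn -> C) (r : R) : 0 < r -> S x ->
  (forall y c (s : R), S y -> c = a \/ c = b ->
     S (y + rc s *: delta_mx 0 c) /\ S (y + rc s *: ('i *: delta_mx 0 c))) ->
  (forall y, S y -> nrm (y - x) < r ->
    [/\ N y \in unitmx, m y != 0, (forall i j, N y i j = ip (g j y) (g i y)),
        N' y = (m y * (m y)^*) *: N y
      & (forall j, acr b (g j) y (dg j y)) /\ acr b m y (dm y)]) ->
  (forall j, exists d, acr a (g j) x d) -> (forall j, exists d, acr a (dg j) x d) ->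
  (exists d, acr a m x d) -> (exists d, acr a dm x d) ->
  wirtinger_mx a (fun y => invmx (N y) *m wirtinger_bar_mx b N y) x =
  wirtinger_mx a (fun y => invmx (N' y) *m wirtinger_bar_mx b N' y) x.
Proof.
move=> r0 Sx Sline hN ga dga [dma hma] [ddma hddma].
pose W y : 'M[C]_t := \matrix_(i, j) ip (dg j y) (g i y).
(* Wirtinger derivatives at y only see a neighbourhood of y, in which the
   hypotheses on the ball around x persist. *)
have near y : nrm (y - x) < r -> exists2 r' : R, 0 < r' & forall (s : R) c, `|s| < r' ->
    nrm (y + rc s *: delta_mx 0 c - x) < r /\
    nrm (y + rc s *: ('i *: delta_mx 0 c) - x) < r.
  move=> yr; exists (r - nrm (y - x)); first lra.
  move=> s c hs.
  have h1 : nrm (rc s *: delta_mx 0 c : Cn) <= `|s|.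
    by rewrite nrmZ nrm_rc ler_piMr // nrm_delta.
  have h2 : nrm (rc s *: ('i *: delta_mx 0 c) : Cn) <= `|s|.
    rewrite nrmZ nrm_rc ler_piMr // nrmZ.
    by have -> : nrm ('i : C) = 1; [rewrite /nrm normCi|rewrite mul1r nrm_delta].
  have k (h : Cn) : nrm h <= `|s| -> nrm (y + h - x) < r.
    move=> hh; rewrite addrAC; apply: le_lt_trans (nrmD _ _) _.
    by rewrite -ltrBrDl; exact: le_lt_trans hh hs.
  by split; apply: k.
have wN y : S y -> nrm (y - x) < r -> wirtinger_bar_mx b N y = W y.
  move=> Sy yr; have [r' r'0 hr'] := near y yr; have [_ _ _ _ [gb mb]] := hN y Sy yr.
  apply/matrixP => i j; rewrite !mxE.
  apply: (wirtinger_bar_ip r'0 _ _ (gb j) (gb i)) => s hs.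
    have [h1 _] := hr' s b hs; have [S1 _] := Sline y b s Sy (or_intror erefl).
    by have [_ _ -> //] := hN _ S1 h1.
  have [_ h1] := hr' s b hs; have [_ S1] := Sline y b s Sy (or_intror erefl).
  by have [_ _ -> //] := hN _ S1 h1.
have wN' y : S y -> nrm (y - x) < r ->
    wirtinger_bar_mx b N' y = (m y * (m y)^*) *: W y + (dm y * (m y)^*) *: N y.
  move=> Sy yr; have [r' r'0 hr'] := near y yr; have [_ _ NE _ [gb mb]] := hN y Sy yr.
  apply/matrixP => i j; rewrite !mxE.
  rewrite (wirtinger_bar_ip r'0 _ _ (acrZ mb (gb j)) (acrZ mb (gb i))).
  - by rewrite ipDl !ipZl !ipZr NE [RHS]addrC; congr (_ + _); ring.
  - move=> s hs; have [h1 _] := hr' s b hs; have [S1 _] := Sline y b s Sy (or_intror erefl).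
    by have [_ _ NE1 -> _] := hN _ S1 h1; rewrite mxE NE1 ipZl ipZr; ring.
  move=> s hs; have [_ h1] := hr' s b hs; have [_ S1] := Sline y b s Sy (or_intror erefl).
  by have [_ _ NE1 -> _] := hN _ S1 h1; rewrite mxE NE1 ipZl ipZr; ring.
pose X y := invmx (N y) *m W y.
have XE y : S y -> nrm (y - x) < r ->
    invmx (N y) *m wirtinger_bar_mx b N y = X y /\
    invmx (N' y) *m wirtinger_bar_mx b N' y = X y + (dm y * (m y)^-1)%:M.
  move=> Sy yr; split; first by rewrite wN.
  have [Nu my _ N'E _] := hN y Sy yr; rewrite wN' // N'E.
  have mm : m y * (m y)^* != 0 by rewrite mulf_neq0 // conjC_eq0.
  rewrite invmxZ; last by rewrite unitmxZ ?unitfE.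
  rewrite -scalemxAl mulmxDr -!scalemxAr scalerDr !scalerA mulVf // scale1r.
  rewrite mulVmx // scalemx1; congr (_ + _%:M).
  by field; rewrite my conjC_eq0 my.
have x0 (h : Cn) : x + rc 0 *: h = x by rewrite rc0 scale0r addr0.
have xr : nrm (x - x) < r by rewrite subrr nrm0.
have [r' r'0 hr'] := near x xr.
have [_ mx _ _ _] := hN x Sx xr.
have hq := acrZ hddma (acrV mx hma).
(* The first connection matrix is differentiable along each of the two real
   directions. *)
have Xr (v : Cn) : (forall s, S (x + rc s *: v)) ->
    (forall s : R, `|s| < r' -> nrm (x + rc s *: v - x) < r) ->
    (forall j, exists d, rder (fun s => g j (x + rc s *: v)) d) ->
    (forall j, exists d, rder (fun s => dg j (x + rc s *: v)) d) ->
    forall i j, ex_rder (fun s => X (x + rc s *: v) i j).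
  move=> Sv vr gr dgr i j.
  have eN k l : ex_rder (fun s => N (x + rc s *: v) k l).
    have [d1 h1] := gr l; have [d2 h2] := gr k.
    eexists; apply: (rder_near r'0 _ (rder_ip h1 h2)) => s hs.
    by have [_ _ -> //] := hN _ (Sv s) (vr s hs).
  rewrite /X (_ : (fun s => _) = fun s => \sum_k invmx (N (x + rc s *: v)) i k * W (x + rc s *: v) k j).
    apply: ex_rder_sum => k; apply: ex_rderM.
      apply: (ex_rder_invmx r'0) => // s hs.
      by have [] := hN _ (Sv s) (vr s hs).
    have [d1 h1] := dgr j; have [d2 h2] := gr k.
    eexists; rewrite (_ : (fun s => W _ _ _) = fun s => ip (dg j (x + rc s *: v)) (g k (x + rc s *: v))).
      exact: rder_ip h1 h2.
    by apply/funext => s; rewrite mxE.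
  by apply/funext => s; rewrite mxE.
have S1 s := (Sline x a s Sx (or_introl erefl)).1.
have S2 s := (Sline x a s Sx (or_introl erefl)).2.
have n1 (s : R) hs := (hr' s a hs).1; have n2 (s : R) hs := (hr' s a hs).2.
have g1 j : exists d, rder (fun s => g j (x + rc s *: delta_mx 0 a)) d.
  by have [d [h _]] := ga j; exists d.
have g2 j : exists d, rder (fun s => g j (x + rc s *: ('i *: delta_mx 0 a))) d.
  by have [d [_ h]] := ga j; exists (- 'i *: d).
have dg1 j : exists d, rder (fun s => dg j (x + rc s *: delta_mx 0 a)) d.
  by have [d [h _]] := dga j; exists d.
have dg2 j : exists d, rder (fun s => dg j (x + rc s *: ('i *: delta_mx 0 a))) d.
  by have [d [_ h]] := dga j; exists (- 'i *: d).
apply/matrixP => i j; pose k : C := (i == j)%:R.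
have [d1 h1] := Xr _ S1 n1 g1 dg1 i j; have [d2 h2] := Xr _ S2 n2 g2 dg2 i j.
move: hq => [q1 q2]; set D := ddma *: _ + _ in q1 q2.
have c1 : rder (fun s => X (x + rc s *: delta_mx 0 a) i j
    + k *: (dm (x + rc s *: delta_mx 0 a) *: (m (x + rc s *: delta_mx 0 a))^-1)) (d1 + k * D).
  by have := rderD h1 (rderZ (rder_cst k) q1); rewrite scale0r add0r.
have c2 : rder (fun s => X (x + rc s *: ('i *: delta_mx 0 a)) i j
    + k *: (dm (x + rc s *: ('i *: delta_mx 0 a)) *: (m (x + rc s *: ('i *: delta_mx 0 a)))^-1))
    (d2 + k * (- 'i * D)).
  by have := rderD h2 (rderZ (rder_cst k) q2); rewrite scale0r add0r.
pose A y := (invmx (N y) *m wirtinger_bar_mx b N y) i j.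
pose A' y := (invmx (N' y) *m wirtinger_bar_mx b N' y) i j.
have D1 : real_deriv A (delta_mx 0 a) x = d1.
  apply: real_deriv_rder; apply: (rder_near r'0 _ h1) => s hs.
  by rewrite /A (XE _ (S1 s) (n1 s hs)).1.
have D2 : real_deriv A ('i *: delta_mx 0 a) x = d2.
  apply: real_deriv_rder; apply: (rder_near r'0 _ h2) => s hs.
  by rewrite /A (XE _ (S2 s) (n2 s hs)).1.
have D'1 : real_deriv A' (delta_mx 0 a) x = d1 + k * D.
  apply: real_deriv_rder; apply: (rder_near r'0 _ c1) => s hs.
  rewrite /A' (XE _ (S1 s) (n1 s hs)).2 [in RHS]mxE; congr (_ + _).
  by rewrite mxE !scaleC mulr_natl.
have D'2 : real_deriv A' ('i *: delta_mx 0 a) x = d2 + k * (- 'i * D).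
  apply: real_deriv_rder; apply: (rder_near r'0 _ c2) => s hs.
  rewrite /A' (XE _ (S2 s) (n2 s hs)).2 [in RHS]mxE; congr (_ + _).
  by rewrite mxE !scaleC mulr_natl.
have wA : wirtinger a A x = (d1 - 'i * d2) / 2 by rewrite /wirtinger D1 D2.
have wA' : wirtinger a A' x = (d1 + k * D - 'i * (d2 + k * (- 'i * D))) / 2.
  by rewrite /wirtinger D'1 D'2.
suff e : wirtinger a A x = wirtinger a A' x by rewrite [LHS]mxE [RHS]mxE; exact: e.
apply: etrans wA _; apply: etrans _ (esym wA'); congr (_ / 2).
have ii : 'i * 'i = -1 :> C by rewrite -expr2 sqrCi.
have -> : d1 + k * D - 'i * (d2 + k * (- 'i * D)) =
   d1 - 'i * d2 + (1 + 'i * 'i) * k * D by ring.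
by rewrite ii subrr !mul0r addr0.
Qed.

End Wirtinger.

(** * Calculus of complex derivatives and conjugation *)

Section FderCalculus.
Variables (R : realType) (n : nat).
Local Notation C := (cplx R).
Local Notation Cn := 'rV[C]_n.

Lemma fder_first_order (X : normedModType C) (f : Cn -> X) y v :
  fder f y v <-> first_order (@nrm R Cn) (fun h => f (y + h)) (lmap v).
Proof.
by split=> hf e e0; have [d d0 hd] := hf e e0; exists d => // h /hd; rewrite addr0.
Qed.

Lemma fder_scale (X : normedModType C) (a : Cn -> C) (f : Cn -> X) y u v :
  fder a y u -> fder f y v ->
  fder (fun x => a x *: f x) y (fun i => u i *: f y + a y *: v i).
Proof.
move=> /fder_first_order ha /fder_first_order hf; apply/fder_first_order => e e0.
have sum0 (Z : normedModType C) (w : 'I_n -> Z) : 0 <= \sum_i nrm (w i).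
  by apply: sumr_ge0 => i _; exact: nrm_ge0.
have [|||d d0 hd] := @first_order_bilinear R Cn (@nrm R Cn) C X X (fun x y => x *: y) 1
  _ _ _ _ _ _ ler01 _ _ _ (@nrm_ge0 R Cn) (sum0 C u) (sum0 X v)
  (@lmap_le R n C u) (@lmap_le R n X v) ha hf e e0.
- by move=> x z; rewrite mul1r nrmZ.
- by move=> x x' z; rewrite scalerBl.
- by move=> x z z'; rewrite scalerBr.
exists d => // h /hd; rewrite !addr0; congr (nrm (_ - _) <= _).
rewrite /lmap scaler_suml scaler_sumr -big_split /=; apply: eq_bigr => i _.
by rewrite scalerDr !scalerA scaleC [a y * _]mulrC.
Qed.

Lemma fder_cst (X : normedModType C) (x : X) (y : Cn) : fder (fun=> x) y (fun=> 0).
Proof.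
move=> e e0; exists 1 => // h _.
by rewrite subrr sub0r nrmN /lmap big1 ?nrm0 ?mulr_ge0 ?nrm_ge0 ?ltW // => i _; rewrite scaler0.
Qed.

Lemma fderD (X : normedModType C) (f g : Cn -> X) y v w :
  fder f y v -> fder g y w -> fder (fun x => f x + g x) y (fun i => v i + w i).
Proof.
move=> hf hg; have := fderB hf (fderZ (-1) hg).
congr (fder _ _ _); apply/funext => x; by rewrite scaleN1r opprK.
Qed.

Lemma fder_continuous (X : normedModType C) (f : Cn -> X) y v : fder f y v ->
  forall e : R, 0 < e -> exists2 d : R, 0 < d & forall x, nrm (x - y) < d ->
    nrm (f x - f y) < e.
Proof.
by move=> /fder_differentiable/differentiable_continuous/continuous_nrm.
Qed.

Lemma fder_comp (X : normedModType C) (f : Cn -> X) (g : Cn -> Cn) y v w :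
  fder g y w -> fder f (g y) v -> exists u, fder (fun x => f (g x)) y u.
Proof.
move=> /fder_differentiable dg /fder_differentiable df.
have h : differentiable (f \o g) y by exact: differentiable_comp dg df.
by have := differentiable_fder h; exists (fun i => 'd (f \o g) y (delta_mx 0 i)).
Qed.

Lemma nrm_conj_rV (x : Cn) : nrm (conj_rV x) <= nrm x.
Proof.
rewrite -ler_rc -nrmE.
have -> : `|conj_rV x| = mx_norm (conj_rV x) by [].
have [->|h] := eqVneq (mx_norm (conj_rV x)) 0; first by rewrite ler_rc nrm_ge0.
have [[a b] ->] := mx_norm_neq0 h; rewrite mxE /= norm_conjC nrmE ler_rc (ord1 a).
exact: coord_le_nrm.
Qed.

(** Conjugating both the variable and the values keeps a map holomorphic. *)
Lemma fder_conj (X Y : normedModType C) (J : X -> Y) (f : Cn -> X) z v :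
  (forall x y, J (x - y) = J x - J y) -> (forall (a : C) x, J (a *: x) = a^* *: J x) ->
  (forall x, nrm (J x) <= nrm x) ->
  fder f (conj_rV z) v -> fder (fun x => J (f (conj_rV x))) z (fun i => J (v i)).
Proof.
move=> JB JZ Jn hf e e0; have [d d0 hd] := hf e e0; exists d => // h hh.
have J0 : J 0 = 0 by rewrite -(subrr 0) JB subrr.
have JN x : J (- x) = - J x by rewrite -sub0r JB J0 sub0r.
have JD x y : J (x + y) = J x + J y by rewrite -{1}[y]opprK JB JN opprK.
have Jsum (I : Type) (s : seq I) (F : I -> X) : J (\sum_(i <- s) F i) = \sum_(i <- s) J (F i).
  elim: s => [|i s IH]; first by rewrite !big_nil.
  by rewrite !big_cons -IH JD.
have hc : nrm (conj_rV h) < d by exact: le_lt_trans (nrm_conj_rV h) hh.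
have -> : J (f (conj_rV (z + h))) - J (f (conj_rV z)) - lmap (fun i => J (v i)) h =
    J (f (conj_rV z + conj_rV h) - f (conj_rV z) - lmap v (conj_rV h)).
  rewrite !JB conj_rVD; congr (_ - _); rewrite /lmap Jsum; apply: eq_bigr => i _.
  by rewrite JZ mxE conjCK.
apply: le_trans (Jn _) _; apply: le_trans (hd _ hc) _.
by apply: ler_wpM2l; [exact: ltW|exact: nrm_conj_rV].
Qed.

Lemma fder_conjC (f : Cn -> C) z v : fder f (conj_rV z) v ->
  fder (fun x => (f (conj_rV x))^*) z (fun i => (v i)^*).
Proof.
apply: (@fder_conj C C (fun x => x^*)).
- by move=> x y; rewrite rmorphB.
- by move=> a x; rewrite rmorphM.
by move=> x; rewrite nrm_conj.
Qed.

Lemma fder_conj_rV (f : Cn -> Cn) z v : fder f (conj_rV z) v ->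
  fder (fun x => conj_rV (f (conj_rV x))) z (fun i => conj_rV (v i)).
Proof.
apply: (@fder_conj Cn Cn (@conj_rV R n)).
- by move=> x y; apply/rowP => i; rewrite !mxE rmorphB.
- exact: conj_rVZ.
exact: nrm_conj_rV.
Qed.

(** The derivative of a map with values in a closed linear subspace M stays in
    M, so a map that is linear and bounded on M only may be applied. *)
Lemma fder_linear_on (X Y : normedModType C) (M : set X) (L : X -> Y) (c : R)
    (f : Cn -> X) y v (r : R) :
  (forall (a : C) x x', M x -> M x' -> M (a *: x + x')) ->
  (forall x, (forall e : R, 0 < e -> exists2 x', M x' & nrm (x' - x) < e) -> M x) ->
  (forall (a : C) x x', M x -> M x' -> L (a *: x + x') = a *: L x + L x') ->
  (forall x, M x -> nrm (L x) <= c * nrm x) -> 0 <= c ->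
  0 < r -> (forall x, nrm (x - y) < r -> M (f x)) ->
  fder f y v -> fder (fun x => L (f x)) y (fun i => L (v i)).
Proof.
move=> Ml Mc Ll Lc c0 r0 Mf hf.
have My : M (f y) by apply: Mf; rewrite subrr nrm0.
have MB x x' : M x -> M x' -> M (x - x').
  by move=> h h'; rewrite addrC -scaleN1r; exact: Ml.
have M0 : M 0 by rewrite -(subrr (f y)); exact: MB.
have MZ (a : C) x : M x -> M (a *: x) by move=> h; rewrite -[a *: x]addr0; exact: Ml.
have L0 : L 0 = 0.
  have := Ll 0 0 0 M0 M0; rewrite scale0r addr0 => e.
  by have := Ll (-1) 0 0 M0 M0; rewrite scaler0 addr0 scaleN1r addNr.
have LB x x' : M x -> M x' -> L (x - x') = L x - L x'.
  by move=> h h'; rewrite addrC -scaleN1r Ll // scaleN1r addrC.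
have LZ (a : C) x : M x -> L (a *: x) = a *: L x.
  by move=> h; rewrite -[a *: x]addr0 Ll // L0 addr0.
have Mv i : M (v i).
  apply: Mc => e e0; have e2 : 0 < e / 2 by lra.
  have [d d0 hd] := hf _ e2.
  pose s := Num.min r d / 2.
  have s0 : 0 < s by rewrite divr_gt0 // lt_min r0.
  have : s * 2 <= Num.min r d by rewrite divfK.
  rewrite le_min => /andP[s1 s2].
  pose h : Cn := rc s *: delta_mx 0 i.
  have hs : nrm h <= s.
    by rewrite nrmZ nrm_rc gtr0_norm // ler_piMr ?nrm_delta // ltW.
  have rs : rc s != 0 by rewrite rc_eq0 gt_eqF.
  exists ((rc s)^-1 *: (f (y + h) - f y)).
    apply: MZ; apply: MB => //; apply: Mf.
    by rewrite addrAC subrr add0r; apply: le_lt_trans hs _; lra.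
  have -> : (rc s)^-1 *: (f (y + h) - f y) - v i = (rc s)^-1 *: (f (y + h) - f y - lmap v h).
    by rewrite /h lmapZ lmap_delta [RHS]scalerBr scalerA mulVf // scale1r.
  rewrite nrmZ nrmV nrm_rc gtr0_norm // mulrC ltr_pdivrMr //.
  have hd1 : nrm h < d by apply: le_lt_trans hs _; lra.
  apply: le_lt_trans (hd _ hd1) _.
  apply: (@le_lt_trans _ _ (e / 2 * s)); first by rewrite ler_wpM2l // ltW.
  by rewrite ltr_pM2r //; lra.
have lmapM (h : Cn) : M (lmap v h) /\ L (lmap v h) = lmap (fun i => L (v i)) h.
  rewrite /lmap; elim/big_ind2 : _ => //.
    move=> _ x1 _ x2 [m1 <-] [m2 <-].
    by have := Ml 1 x1 x2 m1 m2; have := Ll 1 x1 x2 m1 m2; rewrite !scale1r.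
  by move=> i _; split; [exact: MZ|rewrite LZ].
move=> e e0; have e1 : 0 < e / (c + 1) by rewrite divr_gt0 //; lra.
have [d d0 hd] := hf _ e1; exists (Num.min r d); first by rewrite lt_min r0.
move=> h; rewrite lt_min => /andP[hr hhd]; have [m1 m2] := lmapM h.
have m3 : M (f (y + h)) by apply: Mf; rewrite addrAC subrr add0r.
have -> : L (f (y + h)) - L (f y) - lmap (fun i => L (v i)) h =
  L (f (y + h) - f y - lmap v h).
  by rewrite -m2 -LB // -LB //; exact: MB.
have Mx : M (f (y + h) - f y - lmap v h) by apply: (MB _ _ (MB _ _ m3 My) m1).
apply: le_trans (Lc _ Mx) _.
apply: (@le_trans _ _ (c * (e / (c + 1) * nrm h))); first by apply: ler_wpM2l => //; exact: hd.
rewrite mulrA ler_wpM2r ?nrm_ge0 //.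
by rewrite mulrA ler_pdivrMr ?mulrDr; [rewrite mulrC lerDl mulr1 ltW|lra].
Qed.

Lemma fder_peval (q : mpoly.mpoly n C) z : exists v, fder (fun x : Cn => peval q x) z v.
Proof.
have coord i y : fder (fun x : Cn => x 0 i) y (fun j => (j == i)%:R).
  move=> e e0; exists 1 => // h _.
  have -> : (y + h) 0 i - y 0 i = h 0 i by rewrite mxE addrAC subrr add0r.
  have -> : lmap (fun j => (j == i)%:R : C) h = h 0 i.
    rewrite /lmap (bigD1 i) //= eqxx big1 => [|j /negPf ->]; last by rewrite scaler0.
    by rewrite addr0 scaleC mulr1.
  by rewrite subrr nrm0 mulr_ge0 ?nrm_ge0 // ltW.
have power i k : exists v, fder (fun x : Cn => x 0 i ^+ k) z v.
  elim: k => [|k [v IH]]; first by exists (fun=> 0); exact: fder_cst.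
  have [u hu] := fderM (coord i z) IH; exists u; move: hu.
  by congr fder; apply/funext => x; rewrite exprS.
have prod (I : Type) (s : seq I) (F : I -> Cn -> C) :
    (forall i, exists v, fder (F i) z v) -> exists v, fder (fun x => \prod_(i <- s) F i x) z v.
  move=> hF; elim: s => [|i s [v IH]].
    exists (fun=> 0); rewrite (_ : (fun=> _) = fun=> 1); first exact: fder_cst.
    by apply/funext => x; rewrite big_nil.
  have [w hw] := hF i; rewrite (_ : (fun=> _) = fun x => F i x * \prod_(j <- s) F j x).
    exact: fderM hw IH.
  by apply/funext => x; rewrite big_cons.
rewrite /peval.
rewrite (_ : (fun x : Cn => _) = fun x : Cn => \sum_(m <- mpoly.msupp q)
    mpoly.mcoeff m q * \prod_i x 0 i ^+ mpoly.fun_of_multinom m i); last first.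
  by apply/funext => x; rewrite mpoly.mevalE.
elim: (mpoly.msupp q) => [|m s [v IH]].
  exists (fun=> 0); rewrite (_ : (fun=> _) = fun=> 0); first exact: fder_cst.
  by apply/funext => x; rewrite big_nil.
have [w hw] : exists w, fder (fun x : Cn => \prod_i x 0 i ^+ mpoly.fun_of_multinom m i) z w.
  by apply: prod => i; exact: power.
have [u hu] := fderM (fder_cst (mpoly.mcoeff m q) z) hw.
eexists; rewrite (_ : (fun=> _) = fun x : Cn => mpoly.mcoeff m q * \prod_i x 0 i ^+ mpoly.fun_of_multinom m i
    + \sum_(j <- s) mpoly.mcoeff j q * \prod_i x 0 i ^+ mpoly.fun_of_multinom j i); first exact: fderD hu IH.
by apply/funext => x; rewrite big_cons.
Qed.

Lemma peval_on_lines (q : mpoly.mpoly n C) : poly_on_lines (fun x : Cn => peval q x).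
Proof.
move=> x h; exists (\sum_(m <- mpoly.msupp q) mpoly.mcoeff m q *:
   \prod_i ((x 0 i)%:P + h 0 i *: 'X) ^+ mpoly.fun_of_multinom m i) => z.
rewrite /peval mpoly.mevalE horner_sum; apply: eq_bigr => m _.
rewrite hornerZ horner_prod; congr (_ * _); apply: eq_bigr => i _.
by rewrite horner_exp !hornerE !mxE [z * _]mulrC.
Qed.

End FderCalculus.

(** * Anti-holomorphic maps and the closure of an ideal *)

Section AntiHolomorphic.
Variables (R : realType) (m : nat).
Local Notation C := (cplx R).
Local Notation Cm := 'rV[C]_m.

Lemma antiholomorphic_fder (X : normedModType C) (U : set Cm) (g : Cm -> X) :
  antiholomorphic_on U g <->
  forall z, U (conj_rV z) -> exists v, fder (fun x => g (conj_rV x)) z v.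
Proof.
split=> h z Uz; first by have := differentiable_fder (h z Uz); eexists; eassumption.
by have [v /fder_differentiable] := h z Uz.
Qed.

Lemma antiholomorphic_bounded (X : normedModType C) (U : set Cm) (g : Cm -> X) w :
  antiholomorphic_on U g -> U w ->
  exists d : R, exists2 K : R, 0 < d & forall u, nrm (u - w) < d -> nrm (g u) <= K.
Proof.
move=> /antiholomorphic_fder hg Uw; have [|v hv] := hg (conj_rV w).
  by rewrite conj_rVK.
have [d [K d0 hK]] := fder_bounded hv; exists d, K => // u ud.
have := hK (conj_rV u - conj_rV w).
have e : conj_rV u - conj_rV w = conj_rV (u - w).
  by apply/rowP => i; rewrite !mxE rmorphB.
rewrite [conj_rV w + _]addrC subrK conj_rVK; apply; rewrite e.
exact: le_lt_trans (nrm_conj_rV _) ud.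
Qed.

Lemma open_setI_ball (U : set Cm) w : open U -> U w -> forall d : R, 0 < d ->
  exists U' : set Cm, [/\ open U', U' w, U' `<=` U & forall u, U' u -> nrm (u - w) < d].
Proof.
move=> oU Uw d d0; exists (U `&` [set u | nrm (u - w) < d]); split.
- by apply: openI => //; exact: open_nrm_ball.
- by split=> //=; rewrite subrr nrm0.
- exact: subIsetl.
by move=> u [].
Qed.

Lemma antiholomorphic_sub (X : normedModType C) (U U' : set Cm) (g : Cm -> X) :
  U' `<=` U -> antiholomorphic_on U g -> antiholomorphic_on U' g.
Proof. by move=> sU h z Uz; apply: h; exact: sU. Qed.

Lemma antiholomorphic_scale_conj (X : normedModType C) (U : set Cm)
    (c : Cm -> C) (g : Cm -> X) :
  (forall u, U u -> exists v, fder c u v) -> antiholomorphic_on U g ->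
  antiholomorphic_on U (fun z => (c z)^* *: g z).
Proof.
move=> hc /antiholomorphic_fder hg; apply/antiholomorphic_fder => z Uz.
have [v hv] := hc _ Uz; have [w hw] := hg _ Uz.
by have := fder_scale (fder_conjC hv) hw; eexists; eassumption.
Qed.

End AntiHolomorphic.

Section OneModule.
Variables (R : realType) (m t : nat).
Local Notation C := (cplx R).
Local Notation Cm := 'rV[C]_m.
Variables (Omega : set Cm) (p : 'I_t -> mpoly.mpoly m C).
Variables (H : completeNormedModType C) (ip : H -> H -> C) (ev : H -> Cm -> C).
Hypothesis hfs : hilbert_function_space Omega ip ev.
Hypothesis hpoly : forall q, exists f, represents Omega ev f q.
Let M := ideal_closure Omega ev p.

Lemma hfs_ip : inner_product ip.
Proof. by have [h _ _ _] := hfs. Qed.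

Lemma ev_lin (a : C) f g z : Omega z -> ev (a *: f + g) z = a * ev f z + ev g z.
Proof. by have [_ h _ _] := hfs; exact: h. Qed.

Lemma evB f g z : Omega z -> ev (f - g) z = ev f z - ev g z.
Proof. by move=> Oz; rewrite addrC -scaleN1r ev_lin // mulN1r addrC. Qed.

Lemma ev_fder f z : Omega z -> exists v, fder (ev f) z v.
Proof.
move=> Oz; have [_ _ _ h] := hfs.
by have := differentiable_fder (h f z Oz); eexists; eassumption.
Qed.

Lemma closure_nrm (X : normedModType C) (A : set X) x :
  closure A x <-> forall e : R, 0 < e -> exists2 a, A a & nrm (a - x) < e.
Proof.
split=> [h e e0|h B /nbhs_nrm[e e0 hB]].
  have [|a [Aa Ba]] := h [set y | nrm (y - x) < e]; last by exists a.
  by apply/nbhs_nrm; exists e.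
by have [a Aa ax] := h e e0; exists a; split=> //; apply: hB.
Qed.

Lemma ideal_lin (a : C) q1 q2 : in_ideal p q1 -> in_ideal p q2 -> in_ideal p (a *: q1 + q2).
Proof.
move=> [c1 ->] [c2 ->]; exists (fun j => a *: c1 j + c2 j).
rewrite scaler_sumr -big_split /=; apply: eq_bigr => j _.
by rewrite mulrDl scalerAl.
Qed.

Lemma ideal_mul q q1 : in_ideal p q1 -> in_ideal p (q * q1).
Proof.
move=> [c1 ->]; exists (fun j => q * c1 j).
by rewrite mulr_sumr; apply: eq_bigr => j _; rewrite mulrA.
Qed.

Lemma ideal_gen i : in_ideal p (p i).
Proof.
exists (fun j => (j == i)%:R); rewrite (bigD1 i) //= eqxx mul1r big1 ?addr0 // => j /negPf ->.
by rewrite mul0r.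
Qed.

Lemma pevalM q1 q2 (z : Cm) : peval (q1 * q2) z = peval q1 z * peval q2 z.
Proof. by rewrite /peval mpoly.mevalM. Qed.

Lemma M_dense f : M f -> forall e : R, 0 < e ->
  exists g, exists q, [/\ M g, in_ideal p q, represents Omega ev g q & nrm (g - f) < e].
Proof.
move=> /closure_nrm h e e0; have [g [q [q1 q2]] gf] := h e e0.
exists g, q; split=> //; apply/closure_nrm => e' e'0.
by exists g; [exists q|rewrite subrr nrm0].
Qed.

Lemma M_rep f q : in_ideal p q -> represents Omega ev f q -> M f.
Proof.
move=> h1 h2; apply/closure_nrm => e e0; exists f; first by exists q.
by rewrite subrr nrm0.
Qed.

Lemma M_lin (a : C) f g : M f -> M g -> M (a *: f + g).
Proof.
move=> hf hg; apply/closure_nrm => e e0; have a0 := nrm_ge0 a.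
have e1 : 0 < e / 2 / (nrm a + 1) by rewrite !divr_gt0 //; lra.
have e2 : 0 < e / 2 by lra.
have [f' [q1 [_ q1i q1r hf']]] := M_dense hf e1; have [g' [q2 [_ q2i q2r hg']]] := M_dense hg e2.
exists (a *: f' + g').
  exists (a *: q1 + q2); split; first exact: ideal_lin.
  by move=> z Oz; rewrite ev_lin // q1r // q2r // /peval mpoly.mevalD mpoly.mevalZ.
have -> : a *: f' + g' - (a *: f + g) = a *: (f' - f) + (g' - g).
  by rewrite scalerBr opprD addrACA.
apply: le_lt_trans (nrmD _ _) _; rewrite nrmZ.
have h1 : nrm a * nrm (f' - f) <= e / 2.
  apply: (@le_trans _ _ (nrm a * (e / 2 / (nrm a + 1)))); first by rewrite ler_wpM2l // ltW.
  by rewrite mulrA ler_pdivrMr ?mulrDr; [rewrite mulrC lerDl mulr1 ltW|lra].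
lra.
Qed.

Lemma M_closed f : (forall e : R, 0 < e -> exists2 g, M g & nrm (g - f) < e) -> M f.
Proof.
move=> h; apply/closure_nrm => e e0; have e2 : 0 < e / 2 by lra.
have [g Mg gf] := h _ e2; have [g' [q [_ q1 q2 gg]]] := M_dense Mg e2.
exists g'; first by exists q.
by have := nrm_dist_add g g' f; lra.
Qed.

Lemma M_scale (a : C) f : M f -> M (a *: f).
Proof.
move=> hf; have M0 : M 0.
  by rewrite -[0](subrr f) addrC -scaleN1r; exact: M_lin.
by rewrite -[a *: f]addr0; exact: M_lin.
Qed.

Lemma M_sub f g : M f -> M g -> M (f - g).
Proof. by move=> hf hg; rewrite addrC -scaleN1r; exact: M_lin. Qed.

Lemma nonzero_near (q : mpoly.mpoly m C) w : open Omega -> Omega w ->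
  (exists v : Cm, peval q v != 0) -> exists2 u, Omega u & peval q u != 0.
Proof.
move=> oO Ow qn; have [e e0 he] := open_nrm oO Ow.
have [u uw qu] := nonzero_dense w (@peval_on_lines R m q) qn e0.
by exists u => //; exact: he.
Qed.

(** The kernel of M reproduces p_i, that is, sum_k conj(p_k u) conj(ip (P i)
    (G k u)) = conj(p_i u). Hence adding to every F k the multiple ip (F k) (P
    i) - (i == k) of a fixed vector h does not change the sum that represents
    the kernel. By uniqueness of the frame these multiples vanish. *)
Lemma frame_biorthogonal (F : 'I_t -> Cm -> H) (h : H) (P : 'I_t -> H) :
  canonical_frame Omega ip ev p M F -> M h -> h != 0 ->
  (forall i, represents Omega ev (P i) (p i)) ->
  forall w, zero_set Omega ev M w -> forall i j, ip (P i) (F j w) = (i == j)%:R.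
Proof.
move=> [[FM FA FL] Funiq] Mh h0 hP w Vw i j.
have ipH := hfs_ip.
pose T k (x : H) : H := x + (ip x (P i) - (i == k)%:R) *: h.
have MT k x : M x -> M (T k x).
  by move=> Mx; rewrite /T addrC; exact: M_lin.
have AT k (U : set Cm) g : antiholomorphic_on U g -> antiholomorphic_on U (fun z => T k (g z)).
  move=> /antiholomorphic_fder hg; apply/antiholomorphic_fder => z Uz.
  have [v hv] := hg z Uz.
  pose L (x : H) : H := x + ip x (P i) *: h.
  have hL : fder (fun x => L (g (conj_rV x))) z (fun l => L (v l)).
    apply: (@fder_linear_on _ _ _ _ setT L (1 + nrm (P i) * nrm h) _ _ _ 1) => //.
    - by move=> a x x' _ _; rewrite /L (ip_lin ipH) scalerDr scalerDl -scalerA addrACA.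
    - move=> x _; apply: le_trans (nrmD _ _) _; rewrite nrmZ mulrDl mul1r lerD2l.
      rewrite [_ * nrm h * _]mulrAC ler_wpM2r ?nrm_ge0 // mulrC.
      exact: cauchy_schwarz.
    by rewrite addr_ge0 ?mulr_ge0 ?nrm_ge0.
  have := fderB hL (fder_cst ((i == k)%:R *: h) z) => hB.
  eexists; move: hB; congr (fder _ _ _).
  by apply/funext => x; rewrite /L /T scalerBl addrA.
have dec : frame_decomposition Omega ip ev p M (fun k z => T k (F k z)).
  split.
  - by move=> k z Vz; apply: MT; exact: FM.
  - move=> k z Vz; have [U [g [oU Uz gA gF]]] := FA k z Vz.
    exists U, (fun y => T k (g y)); split=> //; first exact: AT.
    by move=> y Vy Uy; rewrite gF.
  move=> z Vz; have [U [G [oU UO GA GF GK]]] := FL z Vz.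
  exists U, (fun k y => T k (G k y)); split=> //.
  - by move=> k; have [GM GA'] := GA k; split; [move=> y /GM /MT|exact: AT].
  - by move=> k y Vy Uy; rewrite GF.
  move=> u Uu; have [KM KE] := GK u Uu; have Ou := UO u Uu.
  have MPi : M (P i) by apply: (M_rep (ideal_gen i)).
  rewrite (_ : \sum_k _ = \sum_k (peval (p k) u)^* *: G k u) //.
  under eq_bigr do rewrite scalerDr scalerA.
  rewrite big_split /= -scaler_suml [X in _ + X *: _](_ : _ = 0) ?scale0r ?addr0 //.
  under eq_bigr do rewrite mulrBr -(ipZl ipH).
  have e : \sum_k (peval (p k) u)^* * (i == k)%:R = (peval (p i) u)^*.
    rewrite (bigD1 i) //= eqxx mulr1 big1 ?addr0 // => k /negPf ki.
    by rewrite eq_sym ki mulr0.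
  rewrite sumrB -(ip_suml ipH) e.
  by rewrite (ip_conj ipH) KE // hP // subrr.
have := Funiq _ dec j w Vw; rewrite /T -[X in _ = X]addr0 => /addrI /eqP.
rewrite scaler_eq0 (negPf h0) orbF subr_eq0 => /eqP e.
by rewrite (ip_conj ipH) e; case: (i == j); rewrite ?conjC1 ?conjC0.
Qed.

End OneModule.

(** * Unitary module maps act by multipliers *)


Section Local.
Variables (R : realType) (n : nat).
Local Notation C := (cplx R).
Local Notation Cn := 'rV[C]_n.

(** A finite intersection of balls around w is a ball. *)
Lemma common_radius (I : finType) (w : Cn) (Q : I -> Cn -> Prop) :
  (forall i, exists2 d : R, 0 < d & forall u : Cn, nrm (u - w) < d -> Q i u) ->
  exists2 d : R, 0 < d & forall i (u : Cn), nrm (u - w) < d -> Q i u.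
Proof.
move=> h; have [d dP] := choice (fun i => (exists2P _ _).1 (h i)).
exists (\big[Num.min/1]_i d i).
  by elim/big_ind: _ => // [x y x0 y0|i _]; [rewrite lt_min x0|exact: (dP i).1].
move=> i u hu; apply: (dP i).2; apply: lt_le_trans hu _; exact: bigmin_le_cond.
Qed.

(** The points with p x != 0 are dense, and f is continuous at u. *)
Lemma eq0_off_zeros (p f : Cn -> C) (u : Cn) (d : R) : poly_on_lines p ->
  (exists x, p x != 0) -> (exists v, fder f u v) -> 0 < d ->
  (forall x : Cn, nrm (x - u) < d -> p x * f x = 0) -> f u = 0.
Proof.
move=> pl pn [v fv] d0 pf; apply: nrm_small => e e0.
have [d' d'0 hd'] := fder_continuous fv e0.
have m0 : 0 < Num.min d d' by rewrite lt_min d0.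
have [x] := nonzero_dense u pl pn m0; rewrite lt_min => /andP[x1 x2] px.
have fx : f x = 0 by apply/eqP; have /eqP := pf x x1; rewrite mulf_eq0 (negPf px).
by have := hd' x x2; rewrite fx sub0r nrmN => /ltW.
Qed.

(** If all generators vanished identically, V would be Omega; but in a slice
    chart with t > 0 the points of V cannot be moved along the first
    coordinate. *)
Lemma generator_nonzero t (Omega V : set Cn) (p : 'I_t -> mpoly.mpoly n C) w : (0 < t)%N ->
  V = [set z | Omega z /\ forall j, peval (p j) z = 0] -> submanifold t Omega V -> V w ->
  exists i, exists v : Cn, peval (p i) v != 0.
Proof.
move=> t0 VE [_ sub] Vw; apply: contrapT => hn.
have p0 i (v : Cn) : peval (p i) v = 0.
  by apply/eqP/negP => /negP pv; apply: hn; exists i, v.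
have [U [W [phi [psi [Uw UO [tn [oU oW] _ [c1 c2] c3]]]]]] := sub w Vw.
have VO z : Omega z -> V z by rewrite VE.
have [Ww _] := c1 w Uw; have [e e0 hW] := open_nrm oW Ww.
pose k : 'I_n := Ordinal (leq_trans t0 tn).
pose x : Cn := phi w + rc (e / 2) *: delta_mx 0 k.
have Wx : W x.
  apply: hW; rewrite /x addrAC subrr add0r nrmZ nrm_rc gtr0_norm; last lra.
  have := nrm_delta R k; nra.
have [Ux xE] := c2 x Wx.
have h1 := (c3 _ Uw).1 Vw k t0; have := (c3 _ Ux).1 (VO _ (UO _ Ux)) k t0.
rewrite xE /x !mxE h1 !eqxx mulr1 add0r => /eqP; rewrite rc_eq0.
by rewrite mulf_eq0 invr_eq0 pnatr_eq0 orbF gt_eqF.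
Qed.

Lemma antiholomorphic_conj (U : set Cn) (c : Cn -> C) :
  (forall u, U u -> exists v, fder c u v) -> antiholomorphic_on U (fun z => (c z)^* : C).
Proof.
move=> hc; apply/antiholomorphic_fder => z Uz; have [v hv] := hc _ Uz.
by have := fder_conjC hv; eexists; eassumption.
Qed.

Lemma antiholomorphic_comp (X : normedModType C) (U W : set Cn) (g : Cn -> X) (psi : Cn -> Cn) :
  antiholomorphic_on U g -> (forall x, W x -> U (psi x) /\ exists v, fder psi x v) ->
  antiholomorphic_on W (fun x => g (psi x)).
Proof.
move=> /antiholomorphic_fder hg hpsi; apply/antiholomorphic_fder => z Wz.
have [Uz [v hv]] := hpsi _ Wz; have h1 := fder_conj_rV hv.
have [|v2 h2] := hg (conj_rV (psi (conj_rV z))); first by rewrite conj_rVK.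
have [u hu] := fder_comp h1 h2; exists u; move: hu; congr (fder _ _ _).
by apply/funext => x; rewrite conj_rVK.
Qed.

(** In the conjugate variable f is holomorphic, and so is its derivative. *)
Lemma antiholomorphic_acr (X : normedModType C) (f : Cn -> X) (x : Cn) (a b : 'I_n) (r : R) :
  seq_complete X -> 0 < r -> antiholomorphic_on [set y | nrm (y - x) < r] f ->
  exists df : Cn -> X, [/\ forall y : Cn, nrm (y - x) < r -> acr b f y (df y),
    exists d, acr a f x d & exists d, acr a df x d].
Proof.
move=> cX r0 /antiholomorphic_fder hf.
pose B : set Cn := [set z | nrm (z - conj_rV x) < r].
have conjB (y z : Cn) : nrm (conj_rV y - conj_rV z) <= nrm (y - z).
  have -> : conj_rV y - conj_rV z = conj_rV (y - z) by apply/rowP => i; rewrite !mxE rmorphB.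
  exact: nrm_conj_rV.
have hB z : exists v, B z -> fder (fun y => f (conj_rV y)) z v.
  have [Bz|nB] := pselect (B z); last by exists (fun=> 0).
  have [|v hv] := hf z; last by exists v.
  by have := conjB z (conj_rV x); rewrite conj_rVK => h; exact: le_lt_trans h Bz.
have [v hv] := choice hB.
have fE : f = fun y => f (conj_rV (conj_rV y)) by apply/funext => y; rewrite conj_rVK.
have Bx y : nrm (y - x) < r -> B (conj_rV y) by exact: le_lt_trans (conjB _ _).
have xx : nrm (x - x) < r by rewrite subrr nrm0.
exists (fun y => v (conj_rV y) b); split.
- by move=> y /Bx /hv /(acr_fder b); rewrite -fE.
- by exists (v (conj_rV x) a); move: (hv _ (Bx x xx)) => /(acr_fder a); rewrite -fE.
have [w hw] := dir_derivative_fder b cX (@open_nrm_ball _ _ (conj_rV x) r) (Bx x xx) hv.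
by exists (w a); exact: (acr_fder a hw).
Qed.

End Local.

Section TwoModules.
Variables (R : realType) (m t : nat).
Local Notation C := (cplx R).
Local Notation Cm := 'rV[C]_m.
Variables (Omega : set Cm) (p : 'I_t -> mpoly.mpoly m C).
Variables (H H' : completeNormedModType C).
Variables (ip : H -> H -> C) (ev : H -> Cm -> C).
Variables (ip' : H' -> H' -> C) (ev' : H' -> Cm -> C).
Hypothesis oOmega : open Omega.
Hypotheses (hfs : hilbert_function_space Omega ip ev)
  (hfs' : hilbert_function_space Omega ip' ev').
Hypotheses (hker : forall u, Omega u -> exists k, forall f, ip f k = ev f u)
  (hker' : forall u, Omega u -> exists k, forall f, ip' f k = ev' f u).
Variables (P : 'I_t -> H) (P' : 'I_t -> H').
Hypothesis hpoly : forall q, exists f, represents Omega ev f q.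
Hypotheses (hP : forall i, represents Omega ev (P i) (p i))
  (hP' : forall i, represents Omega ev' (P' i) (p i)).
Let M := ideal_closure Omega ev p.
Let M' := ideal_closure Omega ev' p.
Variable L : H -> H'.
Hypothesis Llin : forall (a : C) f g, M f -> M g -> L (a *: f + g) = a *: L f + L g.
Hypothesis Limg : L @` M = M'.
Hypothesis Lip : forall f g, M f -> M g -> ip' (L f) (L g) = ip f g.
Hypothesis Lmul : forall (q : mpoly.mpoly m C) f g, M f -> M g ->
  is_mul Omega ev q f g -> is_mul Omega ev' q (L f) (L g).

Let ipH := hfs_ip hfs.
Let ipH' := hfs_ip hfs'.

Lemma M_P i : M (P i). Proof. exact: M_rep (ideal_gen p i) (hP i). Qed.
Lemma M_P' i : M' (P' i). Proof. exact: M_rep (ideal_gen p i) (hP' i). Qed.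

Lemma L_M f : M f -> M' (L f).
Proof. by move=> Mf; rewrite -Limg; exists f. Qed.

Lemma L_sub f g : M f -> M g -> L (f - g) = L f - L g.
Proof.
by move=> Mf Mg; rewrite addrC -scaleN1r Llin // scaleN1r addrC.
Qed.

Lemma M0 : M 0.
Proof.
by apply/closure_nrm => e e0; exists 0; [exists 0; split; [exists (fun=> 0); rewrite big1 // => j _; rewrite mul0r|move=> z Oz; rewrite -(subrr (0 : H)) (evB hfs) // subrr /peval mpoly.meval0]|rewrite subrr nrm0].
Qed.

Lemma L0 : L 0 = 0.
Proof. by rewrite -(subrr 0) L_sub ?subrr //; exact: M0. Qed.

Lemma L_nrm f : M f -> nrm (L f) = nrm f.
Proof.
move=> Mf; have := Lip Mf Mf; rewrite (ip_nrm ipH) (ip_nrm ipH') => /eqP.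
rewrite -subr_eq0 -rcB rc_eq0 subr_eq0 eqrXn2 ?nrm_ge0 // => /eqP; exact.
Qed.

Lemma L_sum (a : 'I_t -> C) (x : 'I_t -> H) : (forall j, M (x j)) ->
  M (\sum_j a j *: x j) /\ L (\sum_j a j *: x j) = \sum_j a j *: L (x j).
Proof.
move=> Mx; apply: (big_rec2 (fun s s' => M s /\ L s = s')) => [|j s' s _ [Ms <-]].
  by split; [exact: M0|exact: L0].
by split; [exact: (M_lin hfs (Mx j) Ms)|rewrite Llin].
Qed.

(** For f = q in the ideal, p_i (L q) and q (L p_i) are both L (p_i q). Both
    sides of the relation are continuous in f because evaluations are inner
    products with kernels, so the relation passes to the closure of the ideal.
    *)
Lemma module_relation f i u : M f -> Omega u ->
  peval (p i) u * ev' (L f) u = ev f u * ev' (L (P i)) u.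
Proof.
move=> Mf Ou; have [k hk] := hker Ou; have [k' hk'] := hker' Ou.
pose D g := peval (p i) u * ev' (L g) u - ev g u * ev' (L (P i)) u.
pose K := nrm (peval (p i) u) * nrm k' + nrm k * nrm (ev' (L (P i)) u).
have K0 : 0 <= K by rewrite /K addr_ge0 // mulr_ge0 // nrm_ge0.
have DK g : M g -> nrm (D g) <= K * nrm g.
  move=> Mg; apply: le_trans (nrmD _ _) _; rewrite nrmN !nrmM -hk -(hk' (L g)).
  have h1 := cauchy_schwarz ipH g k; have h2 := cauchy_schwarz ipH' (L g) k'.
  rewrite L_nrm // in h2; rewrite /K mulrDl lerD //.
    by rewrite -mulrA ler_wpM2l ?nrm_ge0 // mulrC.
  rewrite [X in _ <= X]mulrAC; apply: ler_wpM2r; first exact: nrm_ge0.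
  by rewrite [X in _ <= X]mulrC.
suff D0 : D f = 0 by apply/eqP; rewrite -subr_eq0; apply/eqP; exact: D0.
apply: nrm_small => e e0; have e1 : 0 < e / (K + 1) by rewrite divr_gt0 //; lra.
have [g [q [Mg qi qr gf]]] := M_dense Mf e1.
have Dg : D g = 0.
  have [h hh] := hpoly (p i * q).
  have Mh : M h := M_rep (ideal_mul (p i) qi) hh.
  have e2 : ev' (L h) u = peval (p i) u * ev' (L g) u.
    by apply: Lmul => // z Oz; rewrite hh // qr // pevalM.
  have e3 : ev' (L h) u = peval q u * ev' (L (P i)) u.
    by apply: Lmul => //; [exact: M_P|move=> z Oz; rewrite hh // hP // pevalM mulrC].
  by rewrite /D -e2 e3 qr // subrr.
have DE : D f = D (f - g).
  rewrite -[LHS]subr0 -Dg /D (evB hfs) // L_sub // (evB hfs') //; ring.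
rewrite DE; apply: le_trans (DK _ (M_sub hfs Mf Mg)) _.
rewrite nrm_distC; apply: (@le_trans _ _ (K * (e / (K + 1)))); first by rewrite ler_wpM2l // ltW.
by rewrite mulrA ler_pdivrMr; nra.
Qed.

Variables (F : 'I_t -> Cm -> H) (F' : 'I_t -> Cm -> H').
Hypothesis hF : canonical_frame Omega ip ev p M F.
Hypothesis hF' : canonical_frame Omega ip' ev' p M' F'.
Variable V : set Cm.
Hypotheses (hVM : zero_set Omega ev M = V) (hVM' : zero_set Omega ev' M' = V).
Variables (i0 : 'I_t).
Hypothesis pi0 : exists v : Cm, peval (p i0) v != 0.

(** Near w the kernel of M' gives |f_i| <= A S with S = sum_j |p_j| and f_i =
    L p_i. Multiplying by |p_k| and exchanging indices, |p_k| |f_i| = |p_i|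
    |f_k| <= A S |p_i|; the sum over k is S |f_i| <= t A S |p_i|, and S may be
    cancelled unless it is 0, in which case f_i = 0. *)
Lemma generator_bound w : V w -> exists d : R, exists2 B : R, 0 < d &
  forall u : Cm, nrm (u - w) < d -> Omega u /\ nrm (ev' (L (P i0)) u) <= B * nrm (peval (p i0) u).
Proof.
rewrite -hVM' => Vw; have [[_ _ FL] _] := hF'.
have [U [G [[oU Uw] UO GA _ GK]]] := FL w Vw.
have [e e0 he] := open_nrm oU Uw.
have bd j : exists K : R, exists2 d : R, 0 < d & forall u : Cm, nrm (u - w) < d -> nrm (G j u) <= K.
  by have [d [K d0 h]] := antiholomorphic_bounded (GA j).2 Uw; exists K, d.
have [K hK] := choice bd; have [d d0 hd] := common_radius hK.
have K0 j : 0 <= K j.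
  by apply: le_trans (nrm_ge0 (G j w)) _; apply: hd; rewrite subrr nrm0.
pose A := (\sum_i nrm (P i)) * \sum_j K j.
have A0 : 0 <= A by rewrite mulr_ge0 // sumr_ge0 // => i _; exact: nrm_ge0.
exists (Num.min d e), (t%:R * A); first by rewrite lt_min d0.
move=> u; rewrite lt_min => /andP[ud ue]; have Uu := he u ue; have Ou := UO u Uu.
split=> //; pose S := \sum_j nrm (peval (p j) u).
have S0 : 0 <= S by apply: sumr_ge0 => j _; exact: nrm_ge0.
have fS i : nrm (ev' (L (P i)) u) <= A * S.
  have [_ KE] := GK u Uu; rewrite -KE; last by apply: L_M; exact: M_P.
  rewrite (ip_sumr ipH'); apply: le_trans (nrm_sum _ _ _) _.
  rewrite /S mulr_sumr; apply: ler_sum => j _.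
  rewrite (ipZr ipH') conjCK nrmM mulrC; apply: ler_wpM2r; first exact: nrm_ge0.
  apply: le_trans (cauchy_schwarz ipH' _ _) _; rewrite L_nrm; last exact: M_P.
  apply: ler_pM; rewrite ?nrm_ge0 //.
    by rewrite (bigD1 i) //= lerDl sumr_ge0 // => k _; exact: nrm_ge0.
  rewrite (bigD1 j) //=; apply: le_trans (hd j u ud) _.
  by rewrite lerDl sumr_ge0.
have hS : S * nrm (ev' (L (P i0)) u) <= (t%:R * A * nrm (peval (p i0) u)) * S.
  rewrite /S mulr_suml; apply: (@le_trans _ _ (\sum_(k < t) nrm (peval (p i0) u) * (A * S))).
    apply: ler_sum => k _; rewrite -nrmM (module_relation _ (@M_P i0)) // hP // nrmM.
    by apply: ler_wpM2l; [exact: nrm_ge0|exact: fS].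
  rewrite sumr_const card_ord -/S -[X in X <= _]mulr_natl le_eqVlt; apply/orP; left.
  by apply/eqP; ring.
have [SE|SN] := eqVneq S 0.
  have := fS i0; rewrite SE mulr0 => h; apply: le_trans h _.
  by rewrite mulr_ge0 ?nrm_ge0 // mulr_ge0.
by move: hS; rewrite mulrC ler_pM2r // lt_neqAle eq_sym SN.
Qed.

(** Phi is the extension of the quotient of L p_i0 by p_i0. For other f, p_i0
    (L f - Phi f) = 0 by module_relation, and p_i0 is nonzero on a dense set.
    *)
Lemma local_multiplier w : V w -> exists2 d : R, 0 < d & exists Phi : Cm -> C,
  forall u : Cm, nrm (u - w) < d -> [/\ Omega u, exists v, fder Phi u v
    & forall f, M f -> ev' (L f) u = Phi u * ev f u].
Proof.
move=> Vw; have [d [B d0 hd]] := generator_bound Vw.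
have d2 : 0 < d / 2 by lra.
have lt2 (u : Cm) : nrm (u - w) <= d / 2 -> nrm (u - w) < d by move=> h; lra.
have [||r r0 [Phi hPhi]] := @riemann_extension _ _ (ev' (L (P i0))) (fun u => peval (p i0) u)
  w (d / 2) B d2 _ _ (peval_on_lines (p i0)) pi0 (fun u hu => (hd u (lt2 u hu)).2).
- by move=> u /lt2 /hd[Ou _]; exact: (ev_fder hfs').
- by move=> u _; exact: fder_peval.
have r'0 : 0 < Num.min r d by rewrite lt_min r0.
exists (Num.min r d) => //; exists Phi => u hu.
move: (hu); rewrite lt_min => /andP[ur ud]; have [Ou _] := hd u ud.
have [v hv] := (hPhi u ur).1; split=> //; first by exists v.
move=> f Mf; apply/eqP; rewrite -subr_eq0; apply/eqP.
apply: (@eq0_off_zeros _ _ (fun u => peval (p i0) u) (fun u => ev' (L f) u - Phi u * ev f u) u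
  (Num.min r d - nrm (u - w)) (peval_on_lines (p i0)) pi0).
- have [v1 h1] := ev_fder hfs' (L f) Ou; have [v2 h2] := ev_fder hfs f Ou.
  by have [v3 h3] := fderM hv h2; have := fderB h1 h3; eexists; eassumption.
- by rewrite subr_gt0.
move=> x hx; have : nrm (x - w) < Num.min r d.
  by move: (nrm_dist_add u x w) hx; qlra.
rewrite lt_min => /andP[xr xd]; have [Ox _] := hd x xd.
rewrite mulrBr module_relation // (hPhi x xr).2; ring.
Qed.

(** Local multipliers agree where both are defined, being equal to the
    quotient of L p_i0 by p_i0 off the zeros of p_i0. On V itself the
    functions of M vanish, so their values there cannot identify the
    multiplier. *)
Lemma global_multiplier : exists c : Cm -> C, forall w, V w -> exists2 d : R, 0 < d &
  exists Phi : Cm -> C, (forall u : Cm, nrm (u - w) < d -> [/\ Omega u, exists v, fder Phi u v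
    & forall f, M f -> ev' (L f) u = Phi u * ev f u]) /\
  forall u : Cm, V u -> nrm (u - w) < d -> c u = Phi u.
Proof.
have h w : exists dPhi : R * (Cm -> C), V w -> 0 < dPhi.1 /\
  forall u : Cm, nrm (u - w) < dPhi.1 -> [/\ Omega u, exists v, fder dPhi.2 u v
    & forall f, M f -> ev' (L f) u = dPhi.2 u * ev f u].
  have [/local_multiplier[d d0 [Phi hPhi]]|nV] := pselect (V w); last by exists (1, fun=> 0).
  by exists (d, Phi).
have [D hD] := choice h; exists (fun w => (D w).2 w) => w Vw.
have [d0 hd] := hD w Vw; exists (D w).1 => //; exists (D w).2; split=> // u Vu uw.
have [e0 he] := hD u Vu; apply/eqP; rewrite -subr_eq0; apply/eqP.
have uu : nrm (u - u) < (D u).1 by rewrite subrr nrm0.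
have m0 : 0 < Num.min (D u).1 ((D w).1 - nrm (u - w)) by rewrite lt_min e0 subr_gt0.
apply: (@eq0_off_zeros _ _ (fun u => peval (p i0) u) (fun x => (D u).2 x - (D w).2 x) u _
  (peval_on_lines (p i0)) pi0 _ m0).
  have [_ [v1 h1] _] := he u uu; have [_ [v2 h2] _] := hd u uw.
  by have := fderB h1 h2; eexists; eassumption.
move=> x; rewrite lt_min => /andP[x1 x2].
have xw : nrm (x - w) < (D w).1 by have := nrm_dist_add u x w; qlra.
have [Ox _ h1] := he x x1; have [_ _ h2] := hd x xw.
have := h1 _ (@M_P i0); rewrite (h2 _ (@M_P i0)) hP // => e.
by rewrite mulrBr mulrC -e mulrC subrr.
Qed.

(** L is linear on M only, which suffices because derivatives of M-valued maps
    lie in M. *)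
Lemma L_antiholomorphic (U : set Cm) (G : Cm -> H) : open U -> (forall u, U u -> M (G u)) ->
  antiholomorphic_on U G -> antiholomorphic_on U (fun u => L (G u)).
Proof.
move=> oU GM /antiholomorphic_fder hG; apply/antiholomorphic_fder => z Uz.
have [v hv] := hG z Uz; have [e e0 he] := open_nrm oU Uz.
exists (fun i => L (v i)).
apply: (@fder_linear_on _ _ _ _ M L 1 (fun x => G (conj_rV x)) z v e) => //.
- by move=> a x x' Mx Mx'; exact: (M_lin hfs Mx Mx').
- by move=> x hx; exact: (M_closed hx).
- by move=> x Mx; rewrite L_nrm // mul1r.
move=> x hx; apply: GM; apply: he.
have -> : conj_rV x - conj_rV z = conj_rV (x - z) by apply/rowP => i; rewrite !mxE rmorphB.
exact: le_lt_trans (nrm_conj_rV _) hx.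
Qed.

Variable c : Cm -> C.
Hypothesis hc : forall w, V w -> exists2 d : R, 0 < d &
  exists Phi : Cm -> C, (forall u : Cm, nrm (u - w) < d -> [/\ Omega u, exists v, fder Phi u v
    & forall f, M f -> ev' (L f) u = Phi u * ev f u]) /\
  forall u : Cm, V u -> nrm (u - w) < d -> c u = Phi u.

Lemma frame_M j w : V w -> M (F j w).
Proof. by rewrite -hVM; have [[h _ _] _] := hF; exact: h. Qed.

Lemma local_frame w : V w -> exists U : set Cm, exists Phi : Cm -> C, exists G : 'I_t -> Cm -> H,
    [/\ open U /\ U w, U `<=` Omega,
      forall u, U u -> (exists v, fder Phi u v) /\
        (forall f, M f -> ev' (L f) u = Phi u * ev f u) /\ (V u -> c u = Phi u),
      forall j, (forall u, U u -> M (G j u)) /\ antiholomorphic_on U (G j)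
    & (forall j u, V u -> U u -> G j u = F j u) /\
      forall u, U u -> is_kernel_at ip ev M u (\sum_j (peval (p j) u)^* *: G j u)].
Proof.
have [[_ _ FL] _] := hF.
move=> Vw; have [d d0 [Phi [hPhi cPhi]]] := hc Vw.
have Vw' := Vw; rewrite -hVM in Vw'; have [U [G [[oU Uw] UO GA GF GK]]] := FL w Vw'.
have [U' [oU' Uw' sU hd]] := open_setI_ball oU Uw d0.
exists U', Phi, G; split=> //.
- by move=> u /sU /UO.
- move=> u Uu; have [_ h1 h2] := hPhi u (hd u Uu); split=> //; split=> // Vu.
  by apply: cPhi => //; exact: hd.
- move=> j; have [h1 h2] := GA j; split; first by move=> u /sU /h1.
  exact: antiholomorphic_sub h2.
split; first by move=> j u; rewrite -hVM => Vu /sU Uu; rewrite GF.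
by move=> u /sU Uu; exact: GK.
Qed.

(** The kernel of M' at u is conj(Phi u) L K_u, because <L f, conj(Phi u) L
    K_u> = Phi(u) <f, K_u> = (Phi f)(u) = (L f)(u). Applying L to the
    decomposition of K_u shows that the maps conj(Phi) L G_j decompose the
    kernel of M', so the uniqueness of the canonical frame applies to conj(c)
    L F_j. *)
Lemma frame_transport j w : V w -> F' j w = (c w)^* *: L (F j w).
Proof.
rewrite -{1}hVM' => Vw; have [_ Funiq] := hF'; symmetry.
apply: (Funiq (fun j w => (c w)^* *: L (F j w)) _ j w Vw) => {j w Vw}.
have along j w : V w -> exists U : set Cm, exists g : Cm -> H',
    [/\ open U, U w, antiholomorphic_on U g
      & forall z, V z -> U z -> g z = (c z)^* *: L (F j z)].
  move=> Vw; have [U [Phi [G [[oU Uw] UO hPhi GA [GF _]]]]] := local_frame Vw.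
  exists U, (fun z => (Phi z)^* *: L (G j z)); split=> //.
    apply: antiholomorphic_scale_conj; first by move=> u /hPhi[].
    by apply: L_antiholomorphic => //; [exact: (GA j).1|exact: (GA j).2].
  by move=> z Vz Uz; have [_ [_ ->]] := hPhi z Uz => //; rewrite GF.
split.
- move=> j w; rewrite hVM' => Vw; apply: (M_scale hfs').
  by apply: L_M; exact: frame_M.
- by rewrite hVM' => j w; exact: along.
move=> w; rewrite hVM' => Vw; have [U [Phi [G [[oU Uw] UO hPhi GA [GF GK]]]]] := local_frame Vw.
exists U, (fun j z => (Phi z)^* *: L (G j z)); split=> //.
- move=> j; have [GM Ga] := GA j; split.
    by move=> u Uu; apply: (M_scale hfs'); apply: L_M; exact: GM.
  apply: antiholomorphic_scale_conj; first by move=> u /hPhi[].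
  exact: L_antiholomorphic.
- by move=> j z Vz Uz; have [_ [_ ->]] := hPhi z Uz => //; rewrite GF.
move=> u Uu; have [_ [hPu _]] := hPhi u Uu; have [KM KE] := GK u Uu.
have [MK LK] := L_sum (fun j => (peval (p j) u)^*) (fun j => (GA j).1 u Uu).
have -> : \sum_j (peval (p j) u)^* *: ((Phi u)^* *: L (G j u)) =
    (Phi u)^* *: L (\sum_j (peval (p j) u)^* *: G j u).
  rewrite LK scaler_sumr; apply: eq_bigr => j _.
  by rewrite !scalerA mulrC.
split; first by apply: (M_scale hfs'); exact: L_M.
rewrite -Limg => _ [f Mf <-].
by rewrite (ipZr ipH') conjCK Lip // KE // hPu.
Qed.

Lemma generator_rep_neq0 (K : completeNormedModType C) (ipK : K -> K -> C)
    (evK : K -> Cm -> C) (Q : K) w : hilbert_function_space Omega ipK evK ->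
  Omega w -> represents Omega evK Q (p i0) -> Q != 0.
Proof.
move=> hK Ow hQ; have [u Ou] := nonzero_near oOmega Ow pi0.
apply: contraNneq => Q0; rewrite -(hQ u Ou) Q0.
by rewrite -(subrr (0 : K)) (evB hK) // subrr.
Qed.

Lemma V_Omega w : V w -> Omega w.
Proof. by rewrite -hVM => -[]. Qed.

(** Biorthogonality keeps the vectors of the canonical frame away from 0. *)
Lemma multiplier_neq0 w : V w -> c w != 0.
Proof.
move=> Vw; have Q0 := generator_rep_neq0 hfs' (V_Omega Vw) (hP' i0).
have Vw' := Vw; rewrite -hVM' in Vw'.
have := frame_biorthogonal hfs' hF' (@M_P' i0) Q0 hP' Vw' i0 i0.
rewrite eqxx frame_transport // => e; apply/eqP => c0; move/eqP: e.
by rewrite c0 conjC0 scale0r (ip_conj ipH') (ip0l ipH') conjC0 eq_sym oner_eq0.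
Qed.

(** A vector x = sum_i conj(v_i) F_i orthogonal to all F_j is 0, and then v_k
    = <P_k, x> = 0 by biorthogonality. *)
Lemma gram_unit w : V w -> gram ip F w \in unitmx.
Proof.
move=> Vw; rewrite unitmxE unitfE; apply/det0P => -[v v0 vN].
have Q0 := generator_rep_neq0 hfs (V_Omega Vw) (hP i0).
have Vw' := Vw; rewrite -hVM in Vw'.
have bi := frame_biorthogonal hfs hF (@M_P i0) Q0 hP Vw'.
pose x := \sum_i (v 0 i)^* *: F i w.
have Fx j : ip (F j w) x = 0.
  have /rowP/(_ j) := vN; rewrite !mxE => <-; rewrite (ip_sumr ipH).
  by apply: eq_bigr => i _; rewrite (ipZr ipH) conjCK mxE.
have x0 : x = 0.
  apply/eqP; rewrite -nrm_eq0 -sqrf_eq0 -rc_eq0 -(ip_nrm ipH) {1}/x (ip_suml ipH).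
  by rewrite big1 // => i _; rewrite (ipZl ipH) Fx mulr0.
case/eqP: v0; apply/rowP => k; rewrite mxE.
have : ip (P k) x = v 0 k.
  rewrite (ip_sumr ipH) (bigD1 k) //= (ipZr ipH) conjCK bi eqxx mulr1 big1 ?addr0 // => i ik.
  by rewrite (ipZr ipH) bi eq_sym (negPf ik) mulr0.
by rewrite x0 (ip_conj ipH) (ip0l ipH) conjC0 => <-.
Qed.

Lemma gram_transport w : V w -> gram ip' F' w = ((c w)^* * c w) *: gram ip F w.
Proof.
move=> Vw; apply/matrixP => i j; rewrite !mxE !frame_transport //.
rewrite (ipZl ipH') (ipZr ipH') conjCK Lip; [by rewrite mulrA|exact: frame_M|exact: frame_M].
Qed.

Lemma fibre_M w x : V w -> fibre F w x -> M x.
Proof. by move=> Vw [a ->]; apply: (L_sum a _).1 => j; exact: frame_M. Qed.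

(** L maps F_j to (1 / conj c) F'_j, so it is a fibrewise isometric bijection
    with an anti-holomorphic scalar matrix. *)
Lemma bundle_transport : bundle_equivalent ip ip' V F F'.
Proof.
exists (fun=> L); split.
  move=> w Vw; have cw : (c w)^* != 0 by rewrite conjC_eq0 multiplier_neq0.
  have FM j : M (F j w) by exact: frame_M.
  split.
  - by move=> a x y /(fibre_M Vw) Mx /(fibre_M Vw) My; exact: Llin.
  - split.
    + move=> _ [a ->]; exists (fun j => a j / (c w)^*).
      rewrite (L_sum _ FM).2; apply: eq_bigr => j _.
      by rewrite frame_transport // scalerA divfK.
    + move=> x y; rewrite !inE => /(fibre_M Vw) Mx /(fibre_M Vw) My e.
      apply/eqP; rewrite -subr_eq0 -nrm_eq0 -L_nrm ?L_sub ?e ?subrr ?nrm0 //.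
      exact: (M_sub hfs Mx My).
    move=> _ [a ->]; exists (\sum_j (a j * (c w)^*) *: F j w); first by exists (fun j => a j * (c w)^*).
    rewrite (L_sum _ FM).2; apply: eq_bigr => j _.
    by rewrite frame_transport // scalerA.
  by move=> x y /(fibre_M Vw) Mx /(fibre_M Vw) My; exact: Lip.
exists (fun i j w => (i == j)%:R * ((c w)^-1)^*); split; last first.
  move=> w Vw j; rewrite (bigD1 j) //= eqxx mul1r frame_transport // scalerA.
  rewrite -rmorphM mulVf ?multiplier_neq0 // rmorph1 scale1r big1 ?addr0 // => i /negPf ->.
  by rewrite mul0r scale0r.
move=> i j w Vw; have [d d0 [Phi [hPhi cPhi]]] := hc Vw.
have Phiw : Phi w != 0 by rewrite -cPhi ?multiplier_neq0 // subrr nrm0.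
have ww : nrm (w - w) < d by rewrite subrr nrm0.
have [_ [v hv] _] := hPhi w ww; have n0 : 0 < nrm (Phi w) by rewrite nrm_gt0.
have [e e0 he] := fder_continuous hv n0.
have [U [oU Uw sU Ud]] := open_setI_ball (open_nrm_ball w d) ww e0.
have Phi0 u : U u -> Phi u != 0.
  move=> Uu; apply: contraTneq (he u (Ud u Uu)) => ->.
  by rewrite sub0r nrmN ltxx.
exists U, (fun z => (i == j)%:R * ((Phi z)^-1)^*); split=> //.
  apply/antiholomorphic_fder => z Uz.
  have [_ [v1 h1] _] := hPhi _ (sU _ Uz); have [v2 h2] := fderV (Phi0 _ Uz) h1.
  by have := fderZ (i == j)%:R (fder_conjC h2); eexists; eassumption.
by move=> z Vz Uz; rewrite cPhi //; exact: sU.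
Qed.

(** In the chart the frames are G_j o psi and the conjugate multiplier
    conj(Phi o psi) is the scale factor. The directions a, b >= t are tangent
    to the slice, and the Gram matrices are related by |c|^2 on the slice. *)
Lemma curvature_transport (U W : set Cm) (phi psi : Cm -> Cm) :
  slice_chart t V U W phi psi -> forall x, W x -> V (psi x) ->
  forall a b : 'I_m, (t <= a)%N -> (t <= b)%N ->
  curvature ip F psi a b x = curvature ip' F' psi a b x.
Proof.
move=> [_ [oU oW] [_ hpsi] [_ c2] c3] x Wx Vx a b ta tb.
pose S : set Cm := [set y | forall i : 'I_m, (i < t)%N -> y 0 i = 0].
have SV y : W y -> (V (psi y) <-> S y).
  by move=> Wy; have [Uy e] := c2 y Wy; have := c3 _ Uy; rewrite e.
have [U0 [Phi [G [[oU0 U0x] _ hPhi GA [GF _]]]]] := local_frame Vx.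
have dpsi y : W y -> exists v, fder psi y v.
  by move=> Wy; have := differentiable_fder (hpsi y Wy); eexists; eassumption.
have [e1 e10 h1] := open_nrm oU0 U0x; have [e2 e20 h2] := open_nrm oW Wx.
have [v hv] := dpsi x Wx; have [e3 e30 h3] := fder_continuous hv e10.
pose r := Num.min e2 e3; have r0 : 0 < r by rewrite lt_min e20.
have near y : nrm (y - x) < r -> W y /\ U0 (psi y).
  by rewrite lt_min => /andP[y2 y3]; split; [exact: h2|apply: h1; exact: h3].
pose B : set Cm := [set y | nrm (y - x) < r].
have gA j : antiholomorphic_on B (fun y => G j (psi y)).
  apply: antiholomorphic_comp (GA j).2 _ => y By; have [Wy Uy] := near y By.
  by split=> //; exact: dpsi.
have mA : antiholomorphic_on B (fun y => (Phi (psi y))^* : C).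
  apply: (@antiholomorphic_comp _ _ _ U0 B (fun u => (Phi u)^*)).
    by apply: antiholomorphic_conj => u /hPhi[].
  by move=> y By; have [Wy Uy] := near y By; split=> //; exact: dpsi.
have [dg hdg] := choice (fun j => antiholomorphic_acr a b (@complete_seq_complete _ H) r0 (gA j)).
have [dm [dm1 dm2 dm3]] := antiholomorphic_acr a b (@cplx_seq_complete R) r0 mA.
apply: (@wirtinger_gauge _ _ _ _ ipH _ S x a b _ _ (fun j y => G j (psi y)) dg
  (fun y => (Phi (psi y))^*) dm r r0).
- exact/SV.
- move=> y k s Sy kab; have kt : (t <= k)%N by case: kab => ->.
  by split=> i it; rewrite !mxE Sy // add0r -[_ == k]/(val i == val k :> nat) (ltn_eqF (leq_trans it kt)) ?andbF !mulr0.
- move=> y Sy yr; have [Wy Uy] := near y yr; have Vy := (SV y Wy).2 Sy.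
  have [_ [_ cE]] := hPhi _ Uy.
  split.
  + exact: gram_unit.
  + by rewrite conjC_eq0 -cE // multiplier_neq0.
  + by move=> i j; rewrite mxE !GF.
  + by rewrite gram_transport // cE // conjCK.
  by split; [move=> j; have [h _ _] := hdg j; exact: h|exact: dm1].
- by move=> j; have [] := hdg j.
- by move=> j; have [] := hdg j.
- exact: dm2.
exact: dm3.
Qed.

End TwoModules.

Theorem theorem5p1 (R : realType) (m t : nat)
  (Omega : set 'rV[cplx R]_m) (hOmega : bounded_domain Omega)
  (p : 'I_t -> mpoly.mpoly m (cplx R))
  (H H' : completeNormedModType (cplx R))
  (ip : H -> H -> cplx R) (ev : H -> 'rV[cplx R]_m -> cplx R)
  (ip' : H' -> H' -> cplx R) (ev' : H' -> 'rV[cplx R]_m -> cplx R)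
  (hH : analytic_hilbert_module Omega ip ev)
  (hH' : analytic_hilbert_module Omega ip' ev')
  (M : set H) (hM : M = ideal_closure Omega ev p)
  (M' : set H') (hM' : M' = ideal_closure Omega ev' p)
  (V : set 'rV[cplx R]_m)
  (hV : V = [set z | Omega z /\ forall j, peval (p j) z = 0])
  (hVM : zero_set Omega ev M = V) (hVM' : zero_set Omega ev' M' = V)
  (hsub : submanifold t Omega V)
  (F : 'I_t -> 'rV[cplx R]_m -> H) (F' : 'I_t -> 'rV[cplx R]_m -> H')
  (hF : canonical_frame Omega ip ev p M F)
  (hF' : canonical_frame Omega ip' ev' p M' F')
  (hequiv : unitarily_equivalent Omega ip ev ip' ev' M M') :
  bundle_equivalent ip ip' V F F' /\
  (forall (U W : set 'rV[cplx R]_m) (phi psi : 'rV[cplx R]_m -> 'rV[cplx R]_m),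
     slice_chart t V U W phi psi ->
     forall x, W x -> V (psi x) ->
     forall a b : 'I_m, (t <= a)%N -> (t <= b)%N ->
       curvature ip F psi a b x = curvature ip' F' psi a b x).
Proof.
have [oO _ _] := hOmega.
have [hfs [k [hk _ _]] _ hpoly _] := hH; have [hfs' [k' [hk' _ _]] _ hpoly' _] := hH'.
have hker u : Omega u -> exists k0, forall f, ip f k0 = ev f u.
  by move=> /hk[_ h]; exists (k u) => f; exact: h.
have hker' u : Omega u -> exists k0, forall f, ip' f k0 = ev' f u.
  by move=> /hk'[_ h]; exists (k' u) => f; exact: h.
have [P hP] := choice (fun i => hpoly (p i)); have [P' hP'] := choice (fun i => hpoly' (p i)).
have [L [Llin Limg Lip Lmul]] := hequiv.
subst M M'.
(* Over an empty base there is nothing to compare. *)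
have [[w0 Vw0]|nV] := pselect (exists w, V w); last first.
  have no w : ~ V w by move=> Vw; apply: nV; exists w.
  split; last by move=> U W phi psi _ x _ Vx; case: (no _ Vx).
  exists (fun=> L); split; first by move=> w /no.
  by exists (fun _ _ _ => 0); split=> [i j w /no|w /no].
(* Without generators all fibres are 0 and the matrices are empty. *)
have [t0|t0] := posnP t.
  have no (i : 'I_t) : False by have := leq_trans (ltn_ord i) (eq_leq t0); rewrite ltn0.
  split; last by move=> U W phi psi _ x _ _ a b _ _; apply/matrixP => i; case: (no i).
  have fib (K : completeNormedModType (cplx R)) (G : 'I_t -> 'rV[cplx R]_m -> K) w x :
      fibre G w x -> x = 0 by move=> [a ->]; rewrite big1 // => i; case: (no i).
  have fib0 (K : completeNormedModType (cplx R)) (G : 'I_t -> 'rV[cplx R]_m -> K) w :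
      fibre G w 0 by exists (fun=> 0); rewrite big1 // => i; case: (no i).
  exists (fun _ _ => 0); split; last first.
    by exists (fun _ _ _ => 0); split=> [i|w Vw i]; case: (no i).
  move=> w Vw; split=> [a x y _ _|| x y /fib -> /fib ->].
  - by rewrite scaler0 addr0.
  - split=> [x _|x y|x /fib ->]; first exact: fib0.
      by rewrite !inE => /fib -> /fib ->.
    by exists 0; first exact: fib0.
  by rewrite (ip0l (hfs_ip hfs')) (ip0l (hfs_ip hfs)).
have [i0 pi0] := generator_nonzero t0 hV hsub Vw0.
have [c hc] := global_multiplier hfs hfs' hker hker' hpoly hP Llin Limg Lip Lmul hF' hVM' pi0.
split; first exact: (bundle_transport oO hfs hfs' hP' Llin Limg Lip hF hF' hVM hVM' pi0 hc).
move=> U W phi psi sc x Wx Vx a b ta tb.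
exact: (curvature_transport oO hfs hfs' hP hP' Llin Limg Lip hF hF' hVM hVM' pi0 hc sc).
Qed.
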